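(* Let $n\ge3$ be odd, and let $\mathbb L_0$, $G_0$, $\mathfrak q$, $\mathcal Q$ be as in the context, with $\mathcal Q'(a)=\mathcal Q'(b)=0$. Then for every acceptable sequence of contours $\gamma_\ell$, $$\lim_{\ell\to\infty}\int_{\gamma_\ell}\int_{[a,b]}G_0(x,x,\lambda)\,\mathfrak q(dx)\,d\lambda=0.$$
   Context: $[a,b]$ bounded, $D=d/dx$; boundary conditions $(P_j(D)y)(a)+(Q_j(D)y)(b)=0$, $j=0,\dots,n-1$, with complex polynomials of degree $<n$, normalized and Birkhoff regular (Naimark). $\mathbb L_0$ is the operator generated by $(-i)^nD^n$ and these conditions (eigenvalues $\lambda_N^0$), $\mathbb L$ the one generated by $(-i)^nD^n+\sum_{k=0}^{n-2}p_kD^k$, $p_k\in L_1(a,b)$ complex (eigenvalues $\lambda_N$). $G_0(x,y,\lambda)$ is the Green function of $\mathbb L_0-\lambda$, i.e. the kernel of $(\mathbb L_0-\lambda)^{-1}$. $\mathfrak q$ is a finite complex Borel measure on $[a,b]$ with no atoms at $a,b$ and $\int_{[a,b]}\mathfrak q(dx)=0$; $\mathcal Q(x)=\mathfrak q([a,x])$. Let $\Gamma^1=\{e^{i\phi}:0<\phi<\pi/n\}$, $\Gamma^2=\{e^{i\phi}:\pi/n<\phi<2\pi/n\}$. For a function $R$ on $\overline{\Gamma^1\cup\Gamma^2}$ such that $\gamma(w)=R(w)^nw^n$ is a closed smooth contour, set $\Gamma(w)=R(w)w$. A sequence of such contours $\gamma_\ell$ (functions $R_\ell$) is acceptable if $R_\ell(1)\to\infty$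 and for some $c_1,c_2>0$ and all $\ell$: $|R_\ell(w)-R_\ell(1)|\le c_1$, $|dR_\ell/dw|\le c_2R_\ell(w)$ on $\overline{\Gamma^1\cup\Gamma^2}$, and the contours $\Gamma_\ell$ are separated from the points $(\lambda^0_N)^{1/n}$ and $(\lambda_N)^{1/n}$ (branch with argument in $[0,2\pi/n)$) uniformly in $\ell$. *)

(* Defs.v *)
From HB Require Import structures.
From mathcomp Require Import all_boot all_order all_algebra.
From mathcomp Require Import all_classical all_reals all_analysis.
From mathcomp Require Import complex.
Set Implicit Arguments. Unset Strict Implicit. Unset Printing Implicit Defensive.
Import Order.TTheory GRing.Theory Num.Theory.
Import numFieldTopology.Exports numFieldNormedType.Exports.
Local Open Scope ring_scope.
Local Open Scope classical_set_scope.

Definition Rec {R : realType} (z : R[i]) : R := complex.Re z.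
Definition Imc {R : realType} (z : R[i]) : R := complex.Im z.
Definition cR {R : realType} (x : R) : R[i] := (x +i* 0)%C.
Definition ci {R : realType} : R[i] := (0 +i* 1)%C.
Definition expi {R : realType} (t : R) : R[i] := (cos t +i* sin t)%C.
Definition cabs {R : realType} (z : R[i]) : R :=
  Num.sqrt (Rec z ^+ 2 + Imc z ^+ 2).

Definition ccont {R : realType} (A : set R) (f : R -> R[i]) : Prop :=
  {within A, continuous (fun t => Rec (f t))} /\
  {within A, continuous (fun t => Imc (f t))}.

Definition cintegrable {R : realType} (x y : R) (f : R -> R[i]) : Prop :=
  (lebesgue_measure).-integrable `[x, y] (EFin \o (fun t => Rec (f t))) /\
  (lebesgue_measure).-integrable `[x, y] (EFin \o (fun t => Imc (f t))).

Definition cint {R : realType} (x y : R) (f : R -> R[i]) : R[i] :=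
  (Rintegral lebesgue_measure `[x, y] (fun t => Rec (f t))
   +i* Rintegral lebesgue_measure `[x, y] (fun t => Imc (f t)))%C.

(* Y k stands for y^{(k)}, k = 0..n-1.  ode_sol n a b p lam f Y says that
   y = Y 0 is a (Caratheodory) solution on [a,b] of
      (-i)^n y^{(n)} + sum_{k=0}^{n-2} p_k y^{(k)} - lam y = f,
   i.e. y^{(0)},...,y^{(n-1)} are continuous on [a,b], y^{(k)} is the
   indefinite integral of y^{(k+1)} (k < n-1), and y^{(n-1)} is the
   indefinite integral of  i^n (f + lam y - sum p_k y^{(k)})
   (note ((-i)^n)^{-1} = i^n); so y^{(n-1)} is absolutely continuous. *)
Definition ode_sol {R : realType} (n : nat) (a b : R) (p : nat -> R -> R[i])
    (lam : R[i]) (f : R -> R[i]) (Y : nat -> R -> R[i]) : Prop :=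
  let rhs := fun t => ci ^+ n *
      (f t + lam * Y 0%N t - \sum_(k < n.-1) p k t * Y k t) in
  (forall k, (k < n)%N -> ccont `[a, b] (Y k)) /\
  (forall k, (k.+1 < n)%N -> forall x, x \in `[a, b] ->
      Y k x = Y k a + cint a x (Y k.+1)) /\
  cintegrable a b rhs /\
  (forall x, x \in `[a, b] -> Y n.-1 x = Y n.-1 a + cint a x rhs).

Definition bform {R : realType} (n : nat) (Pa Pb : nat -> {poly R[i]})
    (a b : R) (Y : nat -> R -> R[i]) (j : nat) : R[i] :=
  \sum_(k < n) ((Pa j)`_k * Y k a + (Pb j)`_k * Y k b).

Definition bc_hold {R : realType} (n : nat) (Pa Pb : nat -> {poly R[i]})
    (a b : R) (Y : nat -> R -> R[i]) : Prop :=
  forall j, (j < n)%N -> bform n Pa Pb a b Y j = 0.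

Definition eigenvalue {R : realType} (n : nat) (a b : R)
    (p : nat -> R -> R[i]) (Pa Pb : nat -> {poly R[i]}) (lam : R[i]) : Prop :=
  exists Y : nat -> R -> R[i],
    ode_sol n a b p lam (fun _ => 0) Y /\ bc_hold n Pa Pb a b Y /\
    exists x, x \in `[a, b] /\ Y 0%N x != 0.

Definition zero_pot {R : realType} : nat -> R -> R[i] := fun _ _ => 0.

Definition border {R : realType} (Pa Pb : nat -> {poly R[i]}) (j : nat) : nat :=
  (maxn (size (Pa j)) (size (Pb j))).-1.

Definition bcomb {R : realType} (n : nat) (M : nat -> nat -> R[i])
    (P : nat -> {poly R[i]}) : nat -> {poly R[i]} :=
  fun j => \sum_(i < n) M j i *: P i.

Definition bc_lin_indep {R : realType} (n : nat) (Pa Pb : nat -> {poly R[i]}) : Prop :=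
  forall c : nat -> R[i],
    \sum_(j < n) c j *: Pa j = 0 -> \sum_(j < n) c j *: Pb j = 0 ->
    forall j, (j < n)%N -> c j = 0.

Definition bc_normalized {R : realType} (n : nat) (Pa Pb : nat -> {poly R[i]}) : Prop :=
  bc_lin_indep n Pa Pb /\
  forall M : nat -> nat -> R[i],
    (\matrix_(i < n, j < n) M i j) \in unitmx ->
    (\sum_(j < n) border Pa Pb j <=
     \sum_(j < n) border (bcomb n M Pa) (bcomb n M Pb) j)%N.

Definition balpha {R : realType} (Pa Pb : nat -> {poly R[i]}) (j : nat) : R[i] :=
  (Pa j)`_(border Pa Pb j).
Definition bbeta {R : realType} (Pa Pb : nat -> {poly R[i]}) (j : nat) : R[i] :=
  (Pb j)`_(border Pa Pb j).

(* omega_1,...,omega_n (here indexed 0..n-1): the n-th roots of -1 ordered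
   so that Re(rho omega_1) < ... < Re(rho omega_n) for rho in the sector
   0 < arg rho < pi/n (we take rho = e^{i pi/(2n)}) *)
Definition naimark_roots {R : realType} (n : nat) (w : nat -> R[i]) : Prop :=
  (forall m, (m < n)%N -> w m ^+ n = -1) /\
  (forall m1 m2, (m1 < n)%N -> (m2 < n)%N -> w m1 = w m2 -> m1 = m2) /\
  (forall m, (m.+1 < n)%N ->
     Rec (expi (pi / (2 * n%:R)) * w m) < Rec (expi (pi / (2 * n%:R)) * w m.+1)).

Definition btheta {R : realType} (n : nat) (Pa Pb : nat -> {poly R[i]})
    (w : nat -> R[i]) (c : nat) : R[i] :=
  \det (\matrix_(j < n, m < n)
          ((if (m < c)%N then balpha Pa Pb j else bbeta Pa Pb j)
           * w m ^+ border Pa Pb j)).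

(* Birkhoff regularity for odd n = 2 mu - 1 (Naimark):  theta_{-1} != 0
   (alpha in columns 1..mu) and theta_1 != 0 (alpha in columns 1..mu-1). *)
Definition birkhoff_regular_odd {R : realType} (n : nat) (Pa Pb : nat -> {poly R[i]}) : Prop :=
  forall w, naimark_roots n w ->
    btheta n Pa Pb w n.+1./2 != 0 /\ btheta n Pa Pb w n./2 != 0.

Definition green0 {R : realType} (n : nat) (a b : R) (Pa Pb : nat -> {poly R[i]})
    (G : R -> R -> R[i] -> R[i]) : Prop :=
  forall lam : R[i], ~ eigenvalue n a b zero_pot Pa Pb lam ->
    ({within `[a, b] `*` `[a, b], continuous (fun xy : R * R => Rec (G xy.1 xy.2 lam))} /\
     {within `[a, b] `*` `[a, b], continuous (fun xy : R * R => Imc (G xy.1 xy.2 lam))}) /\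
    forall f : R -> R[i], ccont `[a, b] f ->
      exists Y, ode_sol n a b zero_pot lam f Y /\ bc_hold n Pa Pb a b Y /\
        forall x, x \in `[a, b] -> Y 0%N x = cint a b (fun y => G x y lam * f y).

Definition cmeas {R : realType} (m1 m2 m3 m4 : {finite_measure set R -> \bar R})
    (A : set R) : R[i] :=
  ((fine (m1 A) - fine (m2 A)) +i* (fine (m3 A) - fine (m4 A)))%C.

Definition rmint {R : realType} (m1 m2 : {finite_measure set R -> \bar R})
    (D : set R) (g : R -> R) : R :=
  Rintegral m1 D g - Rintegral m2 D g.

Definition cmint {R : realType} (m1 m2 m3 m4 : {finite_measure set R -> \bar R})
    (D : set R) (f : R -> R[i]) : R[i] :=
  (rmint m1 m2 D (fun x => Rec (f x)) +i* rmint m1 m2 D (fun x => Imc (f x)))%C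
  + ci * (rmint m3 m4 D (fun x => Rec (f x)) +i* rmint m3 m4 D (fun x => Imc (f x)))%C.

(* A contour is given by r(phi) = R(e^{i phi}), phi in [0, 2 pi / n];
   Gamma(phi) = r(phi) e^{i phi}, gamma(phi) = r(phi)^n e^{i n phi}. *)
Definition cperiod {R : realType} (n : nat) : R := 2 * pi / n%:R.

Definition Gam {R : realType} (r : R -> R) (t : R) : R[i] := cR (r t) * expi t.
Definition gam {R : realType} (n : nat) (r : R -> R) (t : R) : R[i] :=
  cR (r t ^+ n) * expi (n%:R * t).
Definition dgam {R : realType} (n : nat) (r : R -> R) (t : R) : R[i] :=
  (derive1 (fun s => Rec (gam n r s)) t +i* derive1 (fun s => Imc (gam n r s)) t)%C.

Definition smooth_closed {R : realType} (n : nat) (r : R -> R) : Prop :=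
  (forall t, t \in `[0, cperiod n] -> 0 < r t) /\
  (forall t, t \in `[0, cperiod n] -> derivable r t 1) /\
  {within `[0, cperiod n], continuous (derive1 r)} /\
  r 0 = r (cperiod n) /\ derive1 r 0 = derive1 r (cperiod n).

Definition cont_int {R : realType} (n : nat) (r : R -> R) (F : R[i] -> R[i]) : R[i] :=
  cint 0 (cperiod n) (fun t => F (gam n r t) * dgam n r t).

Definition nroot_branch {R : realType} (n : nat) (mu w : R[i]) : Prop :=
  w ^+ n = mu /\
  exists rho th : R, 0 <= rho /\ 0 <= th < cperiod n /\ w = cR rho * expi th.

Definition acceptable {R : realType} (n : nat) (a b : R) (p : nat -> R -> R[i])
    (Pa Pb : nat -> {poly R[i]}) (rr : nat -> R -> R) : Prop :=
  (forall l, smooth_closed n (rr l)) /\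
  ((fun l => rr l 0) @ \oo --> +oo) /\
  (exists c1 c2 : R, 0 < c1 /\ 0 < c2 /\
     forall l t, t \in `[0, cperiod n] ->
       `|rr l t - rr l 0| <= c1 /\ `|derive1 (rr l) t| <= c2 * rr l t) /\
  (exists delta : R, 0 < delta /\
     forall l t, t \in `[0, cperiod n] ->
     forall mu w : R[i],
       (eigenvalue n a b zero_pot Pa Pb mu \/ eigenvalue n a b p Pa Pb mu) ->
       nroot_branch n mu w -> delta <= cabs (Gam (rr l) t - w)).

(* Main.v *)
(** With u^n = i^n lambda the solutions of the equation are exponentials exp(u zeta^m x), and on the
    diagonal the Green function is a constant plus products of two bounded exponentials, at least
    one of them decaying from an endpoint, weighted by the inverse of the characteristic matrix. Birkhoff regularity makes the
    main term of the characteristic determinant bounded below outside small discs; if the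
    determinant itself were small at a point of the contour, then by approximation with polynomials
    and a discrete Jensen inequality it would vanish nearby, contradicting the separation from the
    eigenvalues. For odd n at most one exponent can be close to the imaginary axis, so the derivative
    of x |-> G0(x,x,lambda) is O(|u|^(2-n)) times a function of x that decays like
    exp(-c|u| dist(x,{a,b})). Integrating by parts against q and using Q'(a) = Q'(b) = 0, where Q is
    o(dist), the inner integral is o(|u|^(-n)), whereas the contour has length O(|u|^n). *)
Require Import Defs.
From HB Require Import structures.
From mathcomp Require Import all_boot all_order all_algebra.
From mathcomp Require Import all_classical all_reals all_analysis.
From mathcomp Require Import complex perm.
From mathcomp Require Import ring lra zify.
Import Order.TTheory GRing.Theory Num.Theory.
Import numFieldTopology.Exports numFieldNormedType.Exports.
Local Open Scope ring_scope.
Local Open Scope classical_set_scope.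
Set Implicit Arguments. Unset Strict Implicit. Unset Printing Implicit Defensive.

(** The separation hypothesis only says where eigenvalues are not; what is needed is a lower bound
    for the characteristic determinant, uniform along the contours. Passing from one to the other is
    the main obstacle, and it is why the determinant is treated as a locally uniform limit of
    polynomials. The second obstacle is exponential growth: every exponential is measured from the
    endpoint where it is largest, and the one whose exponent may be nearly imaginary is assigned by
    the sign of its real part, so that the characteristic matrix and its inverse stay bounded. The
    orders balance exactly. With k = c|u|, a mass function bounded by eps t + K t^2 at distance t
    from an endpoint gives |u|^(2-n) (eps/k^2 + K/k^3), and the line element costs |u|^n. So Q =
    O(dist) would only give boundedness; the vanishing derivatives supply an arbitrary eps, and K,
    which depends on eps, is beaten by |u|. Finally, separation is stated for roots on one branch,
    so points near either end of a contour must be rotated by 2 pi / n before it applies. *)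

(** * Modulus and arithmetic of complex numbers *)

Section ComplexModulus.
Context {R : realType}.
Implicit Types (x y t : R) (z w : R[i]).

Lemma RecD z w : Rec (z + w) = Rec z + Rec w.
Proof. by case: z w => [? ?] [? ?]. Qed.

Lemma ImcD z w : Imc (z + w) = Imc z + Imc w.
Proof. by case: z w => [? ?] [? ?]. Qed.

Lemma RecN z : Rec (- z) = - Rec z.
Proof. by case: z => [? ?]. Qed.

Lemma ImcN z : Imc (- z) = - Imc z.
Proof. by case: z => [? ?]. Qed.

Lemma RecM z w : Rec (z * w) = Rec z * Rec w - Imc z * Imc w.
Proof. by case: z w => [? ?] [? ?]. Qed.

Lemma ImcM z w : Imc (z * w) = Rec z * Imc w + Imc z * Rec w.
Proof. by case: z w => [? ?] [? ?]. Qed.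

Lemma cR_Rec_Imc z : z = cR (Rec z) + ci * cR (Imc z).
Proof.
by apply/eqP; case: z => x y; rewrite /cR /ci eq_complex /= !(mul0r, mulr0, mul1r, addr0, add0r, subr0) !eqxx.
Qed.

Lemma ceqP z w : Rec z = Rec w -> Imc z = Imc w -> z = w.
Proof. by case: z w => [? ?] [? ?] /= -> ->. Qed.

Lemma Rec_cR x : Rec (cR x) = x. Proof. by []. Qed.

Lemma cRD x y : cR (x + y) = cR x + cR y.
Proof. by apply: ceqP; rewrite ?RecD ?ImcD /= ?addr0. Qed.

Lemma cRM x y : cR (x * y) = cR x * cR y.
Proof. by apply: ceqP; rewrite ?RecM ?ImcM /= ?mulr0 ?mul0r ?subr0 ?addr0. Qed.

Lemma cRN x : cR (- x) = - cR x.
Proof. by apply: ceqP; rewrite ?RecN ?ImcN /= ?oppr0. Qed.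

Lemma cRB x y : cR (x - y) = cR x - cR y.
Proof. by rewrite cRD cRN. Qed.

Lemma cR0 : cR (0 : R) = 0. Proof. by []. Qed.
Lemma cR1 : cR (1 : R) = 1. Proof. by []. Qed.

Lemma cRX x n : cR (x ^+ n) = cR x ^+ n.
Proof. by elim: n => [|n IH]; rewrite ?expr0 // !exprS cRM IH. Qed.

Lemma cRMn n : cR (n%:R : R) = n%:R.
Proof. by elim: n => [|n IH] //; rewrite -natr1 cRD IH natr1. Qed.

Lemma cR_eq0 x : (cR x == 0) = (x == 0).
Proof. by rewrite eq_complex /= eqxx andbT. Qed.

Lemma cabsE z : cabs z = Normc.normc z.
Proof. by case: z. Qed.

Lemma cabsM z w : cabs (z * w) = cabs z * cabs w.
Proof. by rewrite !cabsE Normc.normcM. Qed.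

Lemma cabsD z w : cabs (z + w) <= cabs z + cabs w.
Proof. by rewrite !cabsE; exact: (@le_normcD R z w). Qed.

Lemma cabsN z : cabs (- z) = cabs z.
Proof. by rewrite /cabs RecN ImcN !sqrrN. Qed.

Lemma cabsB z w : cabs (z - w) <= cabs z + cabs w.
Proof. by apply: le_trans (cabsD _ _) _; rewrite cabsN. Qed.

Lemma cabs_distC z w : cabs (z - w) = cabs (w - z).
Proof. by rewrite -cabsN opprB. Qed.

Lemma cabs_ge0 z : 0 <= cabs z. Proof. exact: sqrtr_ge0. Qed.

Lemma cabs0 : cabs (0 : R[i]) = 0. Proof. by rewrite cabsE Normc.normc0. Qed.
Lemma cabs1 : cabs (1 : R[i]) = 1. Proof. by rewrite cabsE Normc.normc1. Qed.

Lemma cabs_eq0 z : (cabs z == 0) = (z == 0).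
Proof.
apply/eqP/eqP => [|->]; last exact: cabs0.
by rewrite cabsE; exact: Normc.eq0_normc.
Qed.

Lemma cabs_gt0 z : (0 < cabs z) = (z != 0).
Proof. by rewrite lt_def cabs_ge0 andbT cabs_eq0. Qed.

Lemma cabsV z : cabs z^-1 = (cabs z)^-1.
Proof. by rewrite !cabsE Normc.normcV. Qed.

Lemma cabsX z n : cabs (z ^+ n) = cabs z ^+ n.
Proof. by elim: n => [|n IH]; rewrite ?expr0 ?cabs1 // !exprS cabsM IH. Qed.

Lemma cabs_cR x : cabs (cR x) = `|x|.
Proof. by rewrite /cabs /= expr0n addr0 sqrtr_sqr. Qed.

Lemma cabs_ci : cabs (ci : R[i]) = 1.
Proof. by rewrite /cabs /= expr0n add0r expr1n sqrtr1. Qed.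

Lemma le_Rec_cabs z : `|Rec z| <= cabs z.
Proof. by rewrite -sqrtr_sqr /cabs ler_wsqrtr // lerDl sqr_ge0. Qed.

Lemma le_Imc_cabs z : `|Imc z| <= cabs z.
Proof. by rewrite -sqrtr_sqr /cabs ler_wsqrtr // lerDr sqr_ge0. Qed.

Lemma cabs_le_RecImc z : cabs z <= `|Rec z| + `|Imc z|.
Proof.
rewrite {1}(cR_Rec_Imc z); apply: le_trans (cabsD _ _) _.
by rewrite cabsM cabs_ci mul1r !cabs_cR.
Qed.

Lemma cabs_ge_sub z w : cabs z - cabs w <= cabs (z + w).
Proof.
rewrite lerBlDr; have := cabsB (z + w) w; by rewrite addrK.
Qed.

Lemma cabs_sum (I : Type) (r : seq I) (P : pred I) (F : I -> R[i]) :
  cabs (\sum_(i <- r | P i) F i) <= \sum_(i <- r | P i) cabs (F i).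
Proof.
elim/big_rec2: _ => [|i x y _ h]; first by rewrite cabs0.
by apply: le_trans (cabsD _ _) _; rewrite lerD2l.
Qed.

Lemma cabs_prod (I : Type) (r : seq I) (P : pred I) (F : I -> R[i]) :
  cabs (\prod_(i <- r | P i) F i) = \prod_(i <- r | P i) cabs (F i).
Proof. by elim/big_rec2: _ => [|i x y _ h]; rewrite ?cabs1 // cabsM h. Qed.

End ComplexModulus.

(** * The complex exponential and its Taylor estimates *)

Section ComplexExponential.
Context {R : realType}.
Implicit Types (x y t : R) (z w : R[i]).

Definition cexp z : R[i] := cR (expR (Rec z)) * expi (Imc z).

Lemma expiD x y : expi (x + y) = expi x * expi y.
Proof.
apply: ceqP; rewrite ?RecM ?ImcM /= ?cosD ?sinD //.
by rewrite addrC.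
Qed.

Lemma expi0 : expi (0 : R) = 1.
Proof. by apply: ceqP; rewrite /= ?cos0 ?sin0. Qed.

Lemma expiN_mul x : expi (- x) * expi x = 1.
Proof. by rewrite -expiD addNr expi0. Qed.

Lemma expiMn x n : expi (n%:R * x) = expi x ^+ n.
Proof.
elim: n => [|n IH]; first by rewrite mul0r expi0 expr0.
by rewrite -natr1 mulrDl mul1r expiD IH exprSr.
Qed.

Lemma cabs_expi t : cabs (expi t) = 1.
Proof. by rewrite /cabs /= cos2Dsin2 sqrtr1. Qed.

Lemma expi_neq0 t : expi t != 0.
Proof. by rewrite -cabs_gt0 cabs_expi. Qed.

Lemma expi_pi : expi (pi : R) = -1.
Proof. by apply: ceqP; rewrite /= ?cospi ?sinpi ?oppr0. Qed.

Lemma expi_2pi : expi (2 * pi : R) = 1.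
Proof. by rewrite mulr_natl mulr2n expiD expi_pi mulrNN mulr1. Qed.

Lemma cexpD z w : cexp (z + w) = cexp z * cexp w.
Proof. by rewrite /cexp RecD ImcD expRD cRM expiD mulrACA. Qed.

Lemma cexp0 : cexp 0 = 1.
Proof. by rewrite /cexp /= expR0 expi0 mulr1. Qed.

Lemma cexpNM z : cexp (- z) * cexp z = 1.
Proof. by rewrite -cexpD addNr cexp0. Qed.

Lemma cabs_cexp z : cabs (cexp z) = expR (Rec z).
Proof. by rewrite /cexp cabsM cabs_expi mulr1 cabs_cR ger0_norm // expR_ge0. Qed.

Lemma cexp_neq0 z : cexp z != 0.
Proof. by rewrite -cabs_gt0 cabs_cexp expR_gt0. Qed.

Lemma cexpN z : cexp (- z) = (cexp z)^-1.
Proof. by apply: (mulIf (cexp_neq0 z)); rewrite cexpNM mulVf // cexp_neq0. Qed.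

Lemma cexpMn z n : cexp (n%:R * z) = cexp z ^+ n.
Proof.
elim: n => [|n IH]; first by rewrite mul0r cexp0 expr0.
by rewrite -natr1 mulrDl mul1r cexpD IH exprSr.
Qed.

Lemma derivable1_continuous (f : R -> R) x : derivable f x 1 -> {for x, continuous f}.
Proof. by move=> /derivable1_diffP/differentiable_continuous. Qed.

Lemma bounded_derivative_lipschitz (f df : R -> R) (C x y : R) :
  x <= y ->
  (forall t, x <= t <= y -> is_derive t 1 f (df t)) ->
  (forall t, x <= t <= y -> `|df t| <= C) -> `|f y - f x| <= C * (y - x).
Proof.
rewrite le_eqVlt => /predU1P[->|xy] fdf dfC.
  by rewrite !subrr normr0 mulr0.
have [t txy ->] : exists2 c, c \in `]x, y[%R & f y - f x = df c * (y - x).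
  apply: MVT => //.
    by move=> t; rewrite in_itv /= => /andP[/ltW h1 /ltW h2]; apply: fdf; rewrite h1 h2.
  apply: continuous_in_subspaceT => t; rewrite inE /= in_itv /= => h.
  by apply: derivable1_continuous; have [] := fdf _ h.
move: txy; rewrite in_itv /= => /andP[/ltW h1 /ltW h2].
rewrite normrM (ger0_norm (_ : 0 <= y - x)) ?subr_ge0 ?(ltW xy) //.
by rewrite ler_wpM2r ?subr_ge0 ?(ltW xy) // dfC // h1 h2.
Qed.

Lemma lipschitz_between (f df : R -> R) (C x y : R) :
  (forall t, is_derive t 1 f (df t)) ->
  (forall t, `|t| <= Num.max `|x| `|y| -> `|df t| <= C) ->
  `|f y - f x| <= C * `|y - x|.
Proof.
move=> fdf dfC; have [xy|/ltW yx] := leP x y.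
  rewrite (ger0_norm (_ : 0 <= y - x)) ?subr_ge0 //.
  apply: (@bounded_derivative_lipschitz f df) => // t /andP[h1 h2].
  apply: dfC; rewrite le_max !ler_norml.
  have := ler_norm y; have := ler_norm (- x); rewrite normrN => hx hy.
  have [t0|/ltW t0] := leP 0 t.
    have -> : t <= `|y| by rewrite (le_trans h2).
    have -> : - `|y| <= t by rewrite (le_trans _ t0) // oppr_le0 normr_ge0.
    by rewrite orbT.
  by rewrite (le_trans t0) ?normr_ge0 // andbT lerNl (le_trans _ hx) // lerN2.
rewrite distrC (distrC y) (ger0_norm (_ : 0 <= x - y)) ?subr_ge0 //.
apply: (@bounded_derivative_lipschitz f df) => // t /andP[h1 h2].
apply: dfC; rewrite le_max !ler_norml.
have := ler_norm x; have := ler_norm (- y); rewrite normrN => hx hy.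
have [t0|/ltW t0] := leP 0 t.
  have -> : t <= `|x| by rewrite (le_trans h2).
  by have -> : - `|x| <= t by rewrite (le_trans _ t0) // oppr_le0 normr_ge0.
apply/orP; right; by rewrite (le_trans t0) ?normr_ge0 // andbT lerNl (le_trans _ hx) // lerN2.
Qed.

Lemma abs_sin_le x : `|sin x| <= `|x|.
Proof.
have := @lipschitz_between sin cos 1 0 x; rewrite sin0 !subr0 mul1r; apply => // t _.
by rewrite ler_norml cos_geN1 cos_le1.
Qed.

Lemma abs_cosB1_le x : `|cos x - 1| <= `|x| ^+ 2.
Proof.
have := @lipschitz_between cos (fun t => - sin t) `|x| 0 x.
rewrite cos0 subr0 expr2; apply => // t.
by rewrite normr0 max_r ?normr_ge0 // => h; rewrite normrN (le_trans (abs_sin_le _)).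
Qed.

Lemma abs_sinB_le x : `|sin x - x| <= `|x| ^+ 3.
Proof.
have := @lipschitz_between (fun t => sin t - t) (fun t => cos t - 1) (`|x| ^+ 2) 0 x.
rewrite sin0 !subr0 -exprSr; apply => // t.
rewrite normr0 max_r ?normr_ge0 // => h.
by rewrite (le_trans (abs_cosB1_le _)) // lerXn2r ?nnegrE.
Qed.

Lemma abs_expRB1_le x : `|expR x - 1| <= expR `|x| * `|x|.
Proof.
have := @lipschitz_between expR expR (expR `|x|) 0 x.
rewrite expR0 subr0; apply => // t.
by rewrite normr0 max_r ?normr_ge0 // => h; rewrite ger0_norm ?expR_ge0 // ler_expR (le_trans (ler_norm _)).
Qed.

Lemma abs_expRB1B_le x : `|expR x - 1 - x| <= expR `|x| * `|x| ^+ 2.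
Proof.
have := @lipschitz_between (fun t => expR t - t) (fun t => expR t - 1) (expR `|x| * `|x|) 0 x.
rewrite expR0 !subr0 -mulrA -expr2 -addrA (addrC (- x)) addrA; apply => // t.
rewrite normr0 max_r ?normr_ge0 // => h.
by rewrite (le_trans (abs_expRB1_le _)) // ler_pM ?ler_expR.
Qed.

Lemma cabs_expiB1 t : cabs (expi t - 1) <= 2 * `|t|.
Proof.
have [t1|t1] := leP `|t| 1; last first.
  apply: le_trans (cabsB _ _) _; rewrite cabs_expi cabs1; lra.
apply: le_trans (cabs_le_RecImc _) _.
rewrite RecD ImcD RecN ImcN /= subr0.
have := abs_sin_le t; have := abs_cosB1_le t.
have : `|t| ^+ 2 <= `|t| by rewrite expr2 ler_piMl.
lra.
Qed.

Lemma cabs_expiB x y : cabs (expi x - expi y) <= 2 * `|x - y|.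
Proof.
have -> : expi x - expi y = expi y * (expi (x - y) - 1).
  by rewrite mulrBr mulr1 -expiD (addrC y) subrK.
by rewrite cabsM cabs_expi mul1r cabs_expiB1.
Qed.

(** The remainder splits as (e^x - 1 - x) + e^x (e^(iy) - 1 - iy) + iy (e^x - 1), and the three
    parts are at most 1, 2 and 1 times [expR 1] |z|^2. The estimate serves twice: to approximate the
    exponential by polynomials and to bound |e^z - 1| from below near 0. *)
Lemma cabs_cexpB1B z : cabs z <= 1 -> cabs (cexp z - 1 - z) <= 4 * expR 1 * cabs z ^+ 2.
Proof.
move=> z1; have rz := le_Rec_cabs z; have iz := le_Imc_cabs z; have z0 := cabs_ge0 z.
set x := Rec z in rz *; set y := Imc z in iz *.
have e3 : expR `|x| <= expR 1 by rewrite ler_expR; lra.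
have -> : cexp z - 1 - z =
   cR (expR x - 1 - x) + cR (expR x) * (expi y - 1 - ci * cR y) + ci * cR y * cR (expR x - 1).
  rewrite (_ : cexp z = cR (expR x) * expi y) // [X in _ - X = _](cR_Rec_Imc z) -/x -/y !cRB cR1; ring.
have h1 : cabs (cR (expR x - 1 - x)) <= expR 1 * cabs z ^+ 2.
  rewrite cabs_cR (le_trans (abs_expRB1B_le _)) // ler_pM ?expR_ge0 ?sqr_ge0 //.
  by rewrite lerXn2r ?nnegrE.
have h2 : cabs (cR (expR x) * (expi y - 1 - ci * cR y)) <= expR 1 * (2 * cabs z ^+ 2).
  rewrite cabsM ler_pM ?cabs_ge0 //.
    rewrite cabs_cR ger0_norm ?expR_ge0 // (le_trans _ e3) // ler_expR ler_norm //.
  apply: le_trans (cabs_le_RecImc _) _; rewrite !RecD !ImcD !RecN !ImcN RecM ImcM /=.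
  rewrite !(mul0r, mulr0, mul1r, subr0, addr0, add0r).
  have := abs_cosB1_le y; have := abs_sinB_le y.
  have : `|y| ^+ 2 <= cabs z ^+ 2 by rewrite lerXn2r ?nnegrE.
  have : `|y| ^+ 3 <= cabs z ^+ 2.
    rewrite exprS (le_trans (_ : _ <= 1 * `|y| ^+ 2)) ?ler_wpM2r ?sqr_ge0 //; first lra.
    by rewrite mul1r lerXn2r ?nnegrE.
  lra.
have h3 : cabs (ci * cR y * cR (expR x - 1)) <= expR 1 * cabs z ^+ 2.
  rewrite !cabsM cabs_ci mul1r !cabs_cR expr2 mulrCA ler_pM //.
  by rewrite (le_trans (abs_expRB1_le _)) // ler_pM ?expR_ge0.
have := cabsD (cR (expR x - 1 - x) + cR (expR x) * (expi y - 1 - ci * cR y)) (ci * cR y * cR (expR x - 1)).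
have := cabsD (cR (expR x - 1 - x)) (cR (expR x) * (expi y - 1 - ci * cR y)).
lra.
Qed.

End ComplexExponential.

(** * Derivatives and integrals of complex-valued functions of a real variable *)

Section ComplexCalculus.
Context {R : realType}.
Implicit Types (a b x y s t : R) (z w k l : R[i]) (F G : R -> R[i]).

Lemma in_seg a b x : (x \in (`[a, b] : set R)) = (a <= x <= b).
Proof. by apply/idP/idP; rewrite inE /= in_itv. Qed.

Definition cdrv F x l : Prop :=
  is_derive x 1 (fun t => Rec (F t)) (Rec l) /\ is_derive x 1 (fun t => Imc (F t)) (Imc l).

Lemma is_derive_congr (f g : R -> R) x d e : f =1 g -> d = e -> is_derive x 1 f d -> is_derive x 1 g e.
Proof. by move=> /funext -> ->. Qed.

Lemma cdrv_eq F G x l k : F =1 G -> l = k -> cdrv F x l -> cdrv G x k.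
Proof. by move=> /funext -> ->. Qed.

Lemma cdrv_cst k x : cdrv (fun=> k) x 0.
Proof. by split; apply: is_derive_cst. Qed.

Lemma cdrvD F G x k l : cdrv F x k -> cdrv G x l -> cdrv (fun t => F t + G t) x (k + l).
Proof.
move=> [F1 F2] [G1 G2]; split.
  apply: (is_derive_congr _ _ (is_deriveD F1 G1)); last by rewrite RecD.
  by move=> t; rewrite RecD.
apply: (is_derive_congr _ _ (is_deriveD F2 G2)); last by rewrite ImcD.
by move=> t; rewrite ImcD.
Qed.

Lemma cdrvM F G x k l : cdrv F x k -> cdrv G x l ->
  cdrv (fun t => F t * G t) x (k * G x + F x * l).
Proof.
move=> [F1 F2] [G1 G2]; split.
  apply: (is_derive_congr _ _ (is_deriveB (is_deriveM F1 G1) (is_deriveM F2 G2))).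
    by move=> t; rewrite RecM.
  by rewrite RecD !RecM /= /GRing.scale /=; ring.
apply: (is_derive_congr _ _ (is_deriveD (is_deriveM F1 G2) (is_deriveM F2 G1))).
  by move=> t; rewrite ImcM.
by rewrite ImcD !ImcM /= /GRing.scale /=; ring.
Qed.

Lemma cdrvZ F x k l : cdrv F x l -> cdrv (fun t => k * F t) x (k * l).
Proof.
move=> Fl; apply: (cdrv_eq _ _ (cdrvM (cdrv_cst k x) Fl)) => //.
by rewrite mul0r add0r.
Qed.

Lemma cdrv_sum (I : Type) (r : seq I) (P : pred I) (F : I -> R -> R[i]) x (l : I -> R[i]) :
  (forall i, P i -> cdrv (F i) x (l i)) ->
  cdrv (fun t => \sum_(i <- r | P i) F i t) x (\sum_(i <- r | P i) l i).
Proof.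
move=> Fl; elim: r => [|i r IH].
  by apply: (cdrv_eq _ _ (cdrv_cst 0 x)) => [t|]; rewrite big_nil.
case Pi : (P i).
  by apply: (cdrv_eq _ _ (cdrvD (Fl i Pi) IH)) => [t|]; rewrite big_cons Pi.
by apply: (cdrv_eq _ _ IH) => [t|]; rewrite big_cons Pi.
Qed.

Lemma is_derive_affine (u s x : R) : is_derive x 1 (fun t => u * (t - s)) u.
Proof.
apply: (is_derive_congr _ _ (is_deriveM (is_derive_cst u x 1) (is_deriveB (is_derive_id x 1) (is_derive_cst s x 1)))) => //.
by rewrite /= /GRing.scale /=; ring.
Qed.

Lemma cdrv_cexp k s x : cdrv (fun t => cexp (k * cR (t - s))) x (k * cexp (k * cR (x - s))).
Proof.
have kE t : k * cR (t - s) = (Rec k * (t - s) +i* (Imc k * (t - s)))%C.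
  by apply: ceqP; rewrite ?RecM ?ImcM /= ?mulr0 ?subr0 ?add0r.
pose f t : R := expR (Rec k * (t - s)).
have fE : is_derive x 1 f (Rec k * f x).
  apply: is_derive_congr (is_derive1_comp (is_derive_expR _) (is_derive_affine (Rec k) s x)) => //.
  by rewrite /GRing.scale /= mulrC.
pose g t : R := cos (Imc k * (t - s)).
pose h t : R := sin (Imc k * (t - s)).
have gE : is_derive x 1 g (- (Imc k * h x)).
  apply: is_derive_congr (is_derive1_comp (is_derive_cos _) (is_derive_affine (Imc k) s x)) => //.
  by rewrite /GRing.scale /= mulrC mulrN.
have hE : is_derive x 1 h (Imc k * g x).
  apply: is_derive_congr (is_derive1_comp (is_derive_sin _) (is_derive_affine (Imc k) s x)) => //.
  by rewrite /GRing.scale /= mulrC.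
have eE t : cexp (k * cR (t - s)) = (f t * g t +i* (f t * h t))%C.
  by rewrite kE /cexp /=; apply: ceqP; rewrite ?RecM ?ImcM /= ?mul0r ?subr0 ?addr0.
split.
  apply: (is_derive_congr _ _ (is_deriveM fE gE)) => [t|]; first by rewrite eE.
  by rewrite eE RecM /= /GRing.scale /=; ring.
apply: (is_derive_congr _ _ (is_deriveM fE hE)) => [t|]; first by rewrite eE.
by rewrite eE ImcM /= /GRing.scale /=; ring.
Qed.

Lemma within_continuousD (A : set R) (f g : R -> R) :
  {within A, continuous f} -> {within A, continuous g} -> {within A, continuous (fun t => f t + g t)}.
Proof. by move=> cf cg x; apply: cvgD; [exact: cf|exact: cg]. Qed.

Lemma within_continuousM (A : set R) (f g : R -> R) :
  {within A, continuous f} -> {within A, continuous g} -> {within A, continuous (fun t => f t * g t)}.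
Proof. by move=> cf cg x; apply: cvgM; [exact: cf|exact: cg]. Qed.

Lemma within_continuousN (A : set R) (f : R -> R) :
  {within A, continuous f} -> {within A, continuous (fun t => - f t)}.
Proof. by move=> cf x; apply: cvgN; exact: cf. Qed.

Lemma ccont_eq (A : set R) F G : F =1 G -> ccont A F -> ccont A G.
Proof. by move=> /funext ->. Qed.

Lemma ccont_cst (A : set R) k : ccont A (fun=> k).
Proof. by split => x; apply: cvg_cst. Qed.

Lemma ccontD (A : set R) F G : ccont A F -> ccont A G -> ccont A (fun t => F t + G t).
Proof.
move=> [F1 F2] [G1 G2]; split.
  under [X in {within _, continuous X}]eq_fun do rewrite RecD; exact: within_continuousD.
under [X in {within _, continuous X}]eq_fun do rewrite ImcD; exact: within_continuousD.
Qed.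

Lemma ccontM (A : set R) F G : ccont A F -> ccont A G -> ccont A (fun t => F t * G t).
Proof.
move=> [F1 F2] [G1 G2]; split.
  under [X in {within _, continuous X}]eq_fun do rewrite RecM.
  by apply: within_continuousD; [|apply: within_continuousN]; exact: within_continuousM.
under [X in {within _, continuous X}]eq_fun do rewrite ImcM.
by apply: within_continuousD; exact: within_continuousM.
Qed.

Lemma ccont_sum (A : set R) (I : Type) (r : seq I) (P : pred I) (F : I -> R -> R[i]) :
  (forall i, P i -> ccont A (F i)) -> ccont A (fun t => \sum_(i <- r | P i) F i t).
Proof.
move=> Fl; elim: r => [|i r IH].
  by apply: ccont_eq (ccont_cst A 0) => t; rewrite big_nil.
case Pi : (P i).
  by apply: ccont_eq (ccontD (Fl i Pi) IH) => t; rewrite big_cons Pi.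
by apply: ccont_eq IH => t; rewrite big_cons Pi.
Qed.

Lemma cdrv_ccont a b F (F' : R -> R[i]) :
  (forall x, a <= x <= b -> cdrv F x (F' x)) -> ccont `[a, b] F.
Proof.
move=> FF'; split; apply: continuous_in_subspaceT => x; rewrite in_seg => /FF'[[? _] [? _]];
  exact: derivable1_continuous.
Qed.

Lemma ccont_cintegrable a b F : ccont `[a, b] F -> cintegrable a b F.
Proof.
by move=> [F1 F2]; split; apply: continuous_compact_integrable => //; exact: segment_compact.
Qed.

Lemma ccont_sub a b c d F : a <= c -> d <= b -> ccont `[a, b] F -> ccont `[c, d] F.
Proof.
move=> ac db [F1 F2]; split; apply: continuous_subspaceW; try eassumption;
  by move=> x /=; rewrite !in_itv /= => /andP[h1 h2]; apply/andP; split; [exact: le_trans h1|exact: le_trans db].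
Qed.

Lemma eq_cint a b F G : (forall t, a <= t <= b -> F t = G t) -> cint a b F = cint a b G.
Proof.
by move=> FG; congr (_ +i* _)%C; apply: eq_Rintegral => t; rewrite in_seg => /FG ->.
Qed.

Lemma cintD a b F G : ccont `[a, b] F -> ccont `[a, b] G ->
  cint a b (fun t => F t + G t) = cint a b F + cint a b G.
Proof.
move=> /ccont_cintegrable[F1 F2] /ccont_cintegrable[G1 G2]; apply: ceqP; rewrite ?RecD ?ImcD /=.
  by rewrite -RintegralD //; apply: eq_Rintegral => t _; rewrite RecD.
by rewrite -RintegralD //; apply: eq_Rintegral => t _; rewrite ImcD.
Qed.

Lemma integrable_scale a b (u : R) (f : R -> R) :
  lebesgue_measure.-integrable `[a, b] (EFin \o f) ->
  lebesgue_measure.-integrable `[a, b] (EFin \o (fun t => u * f t)).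
Proof. by move=> h; apply: eq_integrable (integrableZl _ u h) => // t _; rewrite /= EFinM. Qed.

Lemma cintZ a b k F : ccont `[a, b] F -> cint a b (fun t => k * F t) = k * cint a b F.
Proof.
move=> /ccont_cintegrable[F1 F2]; apply: ceqP; rewrite ?RecM ?ImcM /= -!RintegralZl //.
  rewrite -RintegralB //; try exact: integrable_scale.
  by apply: eq_Rintegral => t _; rewrite RecM.
rewrite -RintegralD //; try exact: integrable_scale.
by apply: eq_Rintegral => t _; rewrite ImcM.
Qed.

Lemma cint0 a b : cint a b (fun=> 0) = 0 :> R[i].
Proof. by congr (_ +i* _)%C; rewrite Rintegral_cst // mul0r. Qed.

Lemma cint_sum a b (I : Type) (r : seq I) (P : pred I) (F : I -> R -> R[i]) :
  (forall i, P i -> ccont `[a, b] (F i)) ->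
  cint a b (fun t => \sum_(i <- r | P i) F i t) = \sum_(i <- r | P i) cint a b (F i).
Proof.
move=> Fl; elim: r => [|i r IH].
  rewrite big_nil; transitivity (cint a b (fun=> 0 : R[i])); last exact: cint0.
  by apply: eq_cint => t _; rewrite big_nil.
rewrite big_cons -IH; case Pi : (P i).
  rewrite -cintD //; [|exact: Fl|exact: ccont_sum].
  by apply: eq_cint => t _; rewrite big_cons Pi.
by apply: eq_cint => t _; rewrite big_cons Pi.
Qed.

Lemma Rintegral_point (f : R -> R) a : \int[lebesgue_measure]_(t in `[a, a]) f t = 0.
Proof. by rewrite set_itv1 Rintegral_set1. Qed.

Lemma cint_point a F : cint a a F = 0.
Proof. by rewrite /cint !Rintegral_point. Qed.

Lemma Rintegral_derivative (f df : R -> R) a b : a <= b ->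
  (forall x, a <= x <= b -> is_derive x 1 f (df x)) ->
  {within `[a, b], continuous df} ->
  \int[lebesgue_measure]_(t in `[a, b]) df t = f b - f a.
Proof.
rewrite le_eqVlt => /predU1P[<-|ab] fdf cdf; first by rewrite Rintegral_point subrr.
have cf x : a <= x <= b -> {for x, continuous f}.
  by move=> /fdf[h _]; exact: derivable1_continuous.
rewrite /Rintegral (@continuous_FTC2 _ df f a b ab cdf) //.
  split.
  - by move=> x; rewrite in_itv /= => /andP[/ltW h1 /ltW h2]; have [] := fdf x; rewrite ?h1 ?h2.
  - by apply: cvg_at_right_filter; apply: cf; rewrite lexx ltW.
  - by apply: cvg_at_left_filter; apply: cf; rewrite lexx ltW.
move=> x; rewrite in_itv /= => /andP[/ltW h1 /ltW h2].
by rewrite derive1E; have [] := fdf x; rewrite ?h1 ?h2.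
Qed.

Lemma cint_derivative a b F (F' : R -> R[i]) :
  (forall x, a <= x <= b -> cdrv F x (F' x)) -> ccont `[a, b] F' ->
  forall x, a <= x <= b -> F x = F a + cint a x F'.
Proof.
move=> FF' cF' x /andP[ax xb].
have [c1 c2] := ccont_sub (lexx a) xb cF'.
have FF'x t : a <= t <= x -> cdrv F t (F' t).
  by move=> /andP[h1 h2]; apply: FF'; rewrite h1 (le_trans h2).
have e1 := Rintegral_derivative ax (fun t ht => proj1 (FF'x t ht)) c1.
have e2 := Rintegral_derivative ax (fun t ht => proj2 (FF'x t ht)) c2.
rewrite /cint e1 e2.
by apply: ceqP; rewrite ?RecD ?ImcD /= addrC subrK.
Qed.

(** Projection onto [a,b]; composing with it turns continuity within the segment into continuity on
    the whole line. *)
Definition clamp a b t : R := Num.max a (Num.min t b).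

Lemma clamp_in a b t : a <= b -> a <= clamp a b t <= b.
Proof. by move=> ab; rewrite /clamp le_max lexx /= ge_max ab /= ge_min lexx orbT. Qed.

Lemma clamp_id a b t : a <= t <= b -> clamp a b t = t.
Proof. by move=> /andP[h1 h2]; rewrite /clamp (min_idPl h2) (max_idPr h1). Qed.

Lemma continuous_clamp a b : continuous (clamp a b).
Proof.
move=> t; apply: (@continuous_max _ _ (fun=> a) (fun u => Num.min u b)); first exact: cvg_cst.
by apply: (@continuous_min _ _ id (fun=> b)); [exact: cvg_id|exact: cvg_cst].
Qed.

Lemma continuous_comp_clamp a b (f : R -> R) : a <= b -> {within `[a, b], continuous f} ->
  continuous (fun t => f (clamp a b t)).
Proof.
move=> ab cf t.
have fA : f x @[x --> within `[a, b] (nbhs (clamp a b t))] --> f (clamp a b t).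
  have := cf (clamp a b t); rewrite /prop_for /continuous_at.
  by rewrite /nbhs /= nbhs_subspace_in //= in_itv /= clamp_in.
apply: cvg_comp fA; move=> U wU.
apply: (@filterS _ (nbhs t) _ (fun u => `[a, b] (clamp a b u) -> U (clamp a b u))).
  by move=> u; apply; rewrite /= in_itv /= clamp_in.
exact: (@continuous_clamp a b t _ wU).
Qed.

(** The clamped function is integrated from a - 1 and slightly beyond the point considered, so a and
    b become interior points. The primitive thus has two-sided derivatives at the endpoints as well,
    which is what [is_derive] asks for. *)
Lemma continuous_primitive (f : R -> R) a b : a <= b -> {within `[a, b], continuous f} ->
  exists Phi : R -> R, forall x, a <= x <= b ->
    is_derive x 1 Phi (f x) /\ Phi x = \int[lebesgue_measure]_(t in `[a, x]) f t.
Proof.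
move=> ab cf; pose g t := f (clamp a b t).
have cg : continuous g by exact: continuous_comp_clamp.
have ig u v : lebesgue_measure.-integrable `[u, v] (EFin \o g).
  apply: continuous_compact_integrable; first exact: segment_compact.
  exact: continuous_subspaceT.
pose J x := \int[lebesgue_measure]_(t in `[a - 1, x]) g t.
exists (fun x => J x - J a) => x /andP[ax xb]; split.
  have [dJ J'] : derivable J x 1 /\ J^`() x = g x.
    by apply: (@continuous_FTC1_closed _ g (a - 1) x (x + 1)); rewrite ?ltrDl //; [lra|exact: cg].
  have Jx : is_derive x 1 J (f x).
    by apply: DeriveDef => //; rewrite -derive1E J' /g clamp_id // ax.
  apply: is_derive_congr (is_deriveB Jx (is_derive_cst (J a) x 1)) => //.
  by rewrite subr0.
rewrite /J Rintegral_itvB; [|exact: ig|by rewrite bnd_simp; lra|by rewrite bnd_simp].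
rewrite Rintegral_itv_obnd_cbnd; last first.
  by apply: integrableS (ig a x) => //; exact: subset_itv_oc_cc.

by apply: eq_Rintegral => t; rewrite in_seg => /andP[h1 h2]; rewrite /g clamp_id // h1 (le_trans h2).
Qed.

Lemma ccont_primitive F a b : a <= b -> ccont `[a, b] F ->
  exists Phi : R -> R[i], forall x, a <= x <= b -> cdrv Phi x (F x) /\ Phi x = cint a x F.
Proof.
move=> ab [cF1 cF2].
have [P1 h1] := continuous_primitive ab cF1; have [P2 h2] := continuous_primitive ab cF2.
exists (fun x => P1 x +i* P2 x)%C => x hx.
by have [? e1] := h1 x hx; have [? e2] := h2 x hx; split; [split|rewrite e1 e2].
Qed.

End ComplexCalculus.

(** * Locally uniform limits of polynomials and the location of their zeros *)

Section PolynomialApproximation.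
Context {R : realType}.
Implicit Types (B e d c : R) (z w k : R[i]) (P : {poly R[i]}) (F G : R[i] -> R[i]).

Lemma cabs_dist_dist z w : `|cabs z - cabs w| <= cabs (z - w).
Proof.
rewrite ler_norml; apply/andP; split.
  rewrite lerNl opprB cabs_distC; have := cabs_ge_sub w (- z); rewrite cabsN; lra.
by have := cabs_ge_sub z (- w); rewrite cabsN.
Qed.

Lemma poly_bounded P B : exists2 K : R, 0 < K & forall z, cabs z <= B -> cabs P.[z] <= K.
Proof.
elim/poly_ind: P => [|p c [K K0 pK]].
  by exists 1 => // z _; rewrite horner0 cabs0.
exists (K * `|B| + cabs c + 1).
  by rewrite ltr_wpDl ?ltr01 // addr_ge0 ?cabs_ge0 // mulr_ge0 // ltW.
move=> z zB; rewrite hornerMXaddC (le_trans (cabsD _ _)) // cabsM.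
have : cabs p.[z] * cabs z <= K * `|B|.
  by rewrite ler_pM ?cabs_ge0 ?pK // (le_trans zB) // ler_norm.
lra.
Qed.

Lemma poly_lipschitz P B : exists2 K : R, 0 < K &
  forall z w, cabs z <= B -> cabs w <= B -> cabs (P.[z] - P.[w]) <= K * cabs (z - w).
Proof.
elim/poly_ind: P => [|p c [K K0 pK]].
  by exists 1 => // z w _ _; rewrite !horner0 subrr cabs0 mul1r cabs_ge0.
have [M M0 pM] := poly_bounded p B.
exists (K * `|B| + M); first by rewrite ltr_wpDl // mulr_ge0 // ltW.
move=> z w zB wB; rewrite !hornerMXaddC.
have -> : p.[z] * z + c - (p.[w] * w + c) = (p.[z] - p.[w]) * z + p.[w] * (z - w) by ring.
rewrite (le_trans (cabsD _ _)) // !cabsM mulrDl lerD //; last by rewrite ler_wpM2r ?cabs_ge0 ?pM.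
rewrite mulrAC ler_pM ?cabs_ge0 ?pK //.
by rewrite (le_trans zB) // ler_norm.
Qed.

(** Plays the role of the notion of entire function: it is stable under sums, products and
    determinants, contains the exponential, and reduces the search for zeros to polynomials. *)
Definition papprox F : Prop := forall B e, 0 < e ->
  exists P : {poly R[i]}, forall z, cabs z <= B -> cabs (F z - P.[z]) <= e.

Lemma papprox_eq F G : F =1 G -> papprox F -> papprox G.
Proof. by move=> /funext ->. Qed.

Lemma papprox_poly P : papprox (fun z => P.[z]).
Proof. by move=> B e e0; exists P => z _; rewrite subrr cabs0 ltW. Qed.

Lemma papprox_cst k : papprox (fun=> k).
Proof. by apply: papprox_eq (papprox_poly k%:P) => z; rewrite hornerC. Qed.

Lemma papproxD F G : papprox F -> papprox G -> papprox (fun z => F z + G z).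
Proof.
move=> aF aG B e e0; have e2 : 0 < e / 2 by rewrite divr_gt0.
have [P hP] := aF B _ e2; have [Q hQ] := aG B _ e2.
exists (P + Q) => z zB; rewrite hornerD.
have -> : F z + G z - (P.[z] + Q.[z]) = (F z - P.[z]) + (G z - Q.[z]) by ring.
apply: le_trans (cabsD _ _) _; have := hP z zB; have := hQ z zB; lra.
Qed.

Lemma papprox_bounded F B : papprox F -> exists2 K : R, 0 < K & forall z, cabs z <= B -> cabs (F z) <= K.
Proof.
move=> aF; have [P hP] := aF B _ ltr01; have [K K0 hK] := poly_bounded P B.
exists (1 + K) => [|z zB]; first by rewrite addr_gt0.
rewrite -[F z](subrK P.[z]) (le_trans (cabsD _ _)) //; have := hP z zB; have := hK z zB; lra.
Qed.

Lemma papproxM F G : papprox F -> papprox G -> papprox (fun z => F z * G z).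
Proof.
move=> aF aG B e e0.
have [K K0 FK] := papprox_bounded B aF.
have [Q hQ] := aG B (e / (2 * K)) (divr_gt0 e0 (mulr_gt0 (ltr0Sn _ _) K0)).
have [M M0 QM] := poly_bounded Q B.
have [P hP] := aF B (e / (2 * M)) (divr_gt0 e0 (mulr_gt0 (ltr0Sn _ _) M0)).
exists (P * Q) => z zB; rewrite hornerM.
have -> : F z * G z - P.[z] * Q.[z] = F z * (G z - Q.[z]) + (F z - P.[z]) * Q.[z] by ring.
apply: le_trans (cabsD _ _) _; rewrite !cabsM.
have h1 : cabs (F z) * cabs (G z - Q.[z]) <= K * (e / (2 * K)).
  by rewrite ler_pM ?cabs_ge0 ?FK ?hQ.
have h2 : cabs (F z - P.[z]) * cabs Q.[z] <= (e / (2 * M)) * M.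
  by rewrite ler_pM ?cabs_ge0 ?QM ?hP.
have E1 : K * (e / (2 * K)) = e / 2 by field; rewrite gt_eqF.
have E2 : (e / (2 * M)) * M = e / 2 by field; rewrite gt_eqF.
lra.
Qed.

Lemma papprox_sum (I : Type) (r : seq I) (Q : pred I) (F : I -> R[i] -> R[i]) :
  (forall i, papprox (F i)) -> papprox (fun z => \sum_(i <- r | Q i) F i z).
Proof.
move=> aF; elim: r => [|i r IH].
  by apply: papprox_eq (papprox_cst 0) => z; rewrite big_nil.
apply: papprox_eq (papproxD (_ : papprox (fun z => if Q i then F i z else 0)) IH).
  by move=> z; rewrite big_cons; case: ifP => // _; rewrite add0r.
by case: (Q i) => //; exact: papprox_cst.
Qed.

Lemma papprox_prod (I : Type) (r : seq I) (Q : pred I) (F : I -> R[i] -> R[i]) :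
  (forall i, papprox (F i)) -> papprox (fun z => \prod_(i <- r | Q i) F i z).
Proof.
move=> aF; elim: r => [|i r IH].
  by apply: papprox_eq (papprox_cst 1) => z; rewrite big_nil.
apply: papprox_eq (papproxM (_ : papprox (fun z => if Q i then F i z else 1)) IH).
  by move=> z; rewrite big_cons; case: ifP => // _; rewrite mul1r.
by case: (Q i) => //; exact: papprox_cst.
Qed.

Lemma papprox_det n (M : R[i] -> 'M[R[i]]_n) :
  (forall i j, papprox (fun z => M z i j)) -> papprox (fun z => \det (M z)).
Proof.
move=> aM; apply: papprox_sum => s; apply: papproxM; first exact: papprox_cst.
by apply: papprox_prod => i; exact: aM.
Qed.

Lemma papprox_scale F k : papprox F -> papprox (fun z => F (k * z)).
Proof.
move=> aF B e e0; have [P hP] := aF (cabs k * B) e e0.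
exists (P \Po (k *: 'X)) => z zB; rewrite horner_comp hornerZ hornerX hP //.
by rewrite cabsM ler_wpM2l ?cabs_ge0.
Qed.

Lemma cabs_subX_le z w (M : R) N : cabs z <= M -> cabs w <= M ->
  cabs (z ^+ N - w ^+ N) <= N%:R * cabs (z - w) * M ^+ N.-1.
Proof.
move=> zM wM; have M0 := le_trans (cabs_ge0 _) zM.
case: N => [|N] /=; first by rewrite !expr0 subrr cabs0 !mul0r.
elim: N => [|N IH]; first by rewrite !expr1 expr0 mulr1 mul1r.
rewrite exprS [w ^+ N.+2]exprS.
have -> : z * z ^+ N.+1 - w * w ^+ N.+1 = z * (z ^+ N.+1 - w ^+ N.+1) + (z - w) * w ^+ N.+1 by ring.
rewrite (le_trans (cabsD _ _)) // !cabsM cabsX.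
have h1 : cabs z * cabs (z ^+ N.+1 - w ^+ N.+1) <= M * (N.+1%:R * cabs (z - w) * M ^+ N).
  by rewrite ler_pM ?cabs_ge0.
have h2 : cabs (z - w) * cabs w ^+ N.+1 <= cabs (z - w) * M ^+ N.+1.
  by rewrite ler_wpM2l ?cabs_ge0 // lerXn2r ?nnegrE ?cabs_ge0.
have -> : N.+2%:R * cabs (z - w) * M ^+ N.+1 =
  M * (N.+1%:R * cabs (z - w) * M ^+ N) + cabs (z - w) * M ^+ N.+1.
  by rewrite -natr1 exprS; ring.
exact: lerD.
Qed.

(** The approximants are (1 + z/N)^N. As e^z = (e^(z/N))^N, the difference of the two N-th powers is
    at most N times the quadratic remainder at z/N times e^B, which is O(1/N) on the disc of radius
    B. *)
Lemma papprox_cexp : papprox cexp.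
Proof.
move=> B0 e e0; pose B : R := `|B0| + 1.
have B1 : 1 <= B by rewrite /B lerDr.
have Bp : 0 < B by lra.
(* The first summand makes the final error 4 e B^2 e^B / N at most the tolerance; the summand B
   gives |z/N| <= 1, the range of the quadratic remainder. *)
pose K : R := 4 * expR 1 * B ^+ 2 * expR B / e + B.
pose N := (Num.bound K).+1.
have KN : K <= N%:R.
  have /archi_boundP h : 0 <= K.
    rewrite addr_ge0 ?(ltW Bp) // divr_ge0 ?(ltW e0) //.
    by rewrite !mulr_ge0 ?expR_ge0 ?exprn_ge0 // ltW.
  by rewrite (le_trans (ltW h)) // ler_nat.
have N0 : 0 < N%:R :> R by rewrite ltr0n.
have BN : B <= N%:R.
  apply: le_trans KN; rewrite /K lerDr divr_ge0 ?(ltW e0) //.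
  by rewrite !mulr_ge0 ?expR_ge0 ?exprn_ge0 // ltW.
exists (((cR N%:R^-1) *: 'X + 1) ^+ N) => z zB0.
have zB : cabs z <= B by rewrite (le_trans zB0) // /B (le_trans (ler_norm _)) // lerDl.
rewrite horner_exp !hornerE.
pose u := cR N%:R^-1 * z.
have zE : z = N%:R * u.
  by rewrite /u mulrA -cRMn -cRM divff ?mul1r // gt_eqF.
have uE : cabs u = cabs z / N%:R.
  by rewrite /u cabsM cabs_cR ger0_norm ?invr_ge0 1?mulrC // ltW.
have uB : cabs u <= B / N%:R by rewrite uE ler_wpM2r // invr_ge0 ltW.
have u1 : cabs u <= 1 by rewrite uE ler_pdivrMr // mul1r (le_trans zB).
rewrite -/u {1}zE cexpMn.
apply: le_trans (@cabs_subX_le _ _ (expR (B / N%:R)) N _ _) _.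
- rewrite cabs_cexp ler_expR (le_trans _ uB) // (le_trans (ler_norm _)) //.
  exact: le_Rec_cabs.
- apply: le_trans (expR_ge1Dx _); rewrite (le_trans (cabsD _ _)) // cabs1; lra.
have -> : cexp u - (u + 1) = cexp u - 1 - u by ring.
have h1 : cabs (cexp u - 1 - u) <= 4 * expR 1 * (B / N%:R) ^+ 2.
  rewrite (le_trans (cabs_cexpB1B u1)) // ler_wpM2l ?mulr_ge0 ?expR_ge0 //.
  by rewrite lerXn2r ?nnegrE ?cabs_ge0 // divr_ge0 // ltW.
have h2 : expR (B / N%:R) ^+ N.-1 <= expR B.
  rewrite -expRM_natl ler_expR.
  rewrite -[leRHS](divfK (lt0r_neq0 N0)) [leLHS]mulrC.
  by rewrite ler_wpM2l ?ler_nat ?leq_pred // divr_ge0 // ltW.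
apply: (@le_trans _ _ (N%:R * (4 * expR 1 * (B / N%:R) ^+ 2) * expR B)).
  by rewrite ler_pM ?exprn_ge0 ?expR_ge0 ?mulr_ge0 ?cabs_ge0 ?ler_wpM2l // ltW.
have -> : N%:R * (4 * expR 1 * (B / N%:R) ^+ 2) * expR B = (4 * expR 1 * B ^+ 2 * expR B) / N%:R.
  by field; rewrite gt_eqF.
rewrite ler_pdivrMr // [leRHS]mulrC -ler_pdivrMr //.
by apply: le_trans KN; rewrite /K lerDl ltW.
Qed.

Lemma papprox_cexp_scale k : papprox (fun z => cexp (k * z)).
Proof. exact: papprox_scale papprox_cexp. Qed.

Lemma bernoulli_expr (q : R) N : 0 <= q -> 1 + N%:R * q <= (1 + q) ^+ N.
Proof.
move=> q0; elim: N => [|N IH]; first by rewrite expr0 mul0r addr0.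
rewrite exprS -natr1; have : (1 + q) * (1 + N%:R * q) <= (1 + q) * (1 + q) ^+ N.
  by rewrite ler_wpM2l // addr_ge0.
have : 0 <= N%:R * q * q by rewrite !mulr_ge0.
lra.
Qed.

Lemma prodr_const_size (I : Type) (s : seq I) (x : R) : \prod_(i <- s) x = x ^+ size s.
Proof. by elim: s => [|i s IH]; rewrite ?big_nil // big_cons IH exprS. Qed.

(* Jensen's formula in discrete form: the product of |P| over the scaled N-th roots of unity is
   at most 2^deg P |P(z0)|^N when P has no zero in the open disc. *)
Lemma poly_zero_in_disc P z0 d c : 0 < d ->
  (forall z, cabs (z - z0) = d -> c <= cabs P.[z]) -> cabs P.[z0] < c ->
  exists2 z, cabs (z - z0) < d & P.[z] = 0.
Proof.
move=> d0 cP P0c; apply: contrapT => noz.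
have nz z : P.[z] = 0 -> d <= cabs (z - z0).
  by move=> Pz; rewrite leNgt; apply/negP => zd; apply: noz; exists z.
have Pz0 : P.[z0] != 0.
  by apply/eqP => /nz; rewrite subrr cabs0 leNgt d0.
have Pn0 : P != 0 by apply: contraNneq Pz0 => ->; rewrite horner0.
have c0 : 0 < c by apply: le_lt_trans P0c; exact: cabs_ge0.
have [r Pr] := closed_field_poly_normal P; set l := lead_coef P in Pr.
have PE z : cabs P.[z] = cabs l * \prod_(u <- r) cabs (z - u).
  rewrite Pr hornerZ cabsM horner_prod cabs_prod; congr (_ * _).
  by apply: eq_bigr => u _; rewrite hornerXsubC.
have rz u : u \in r -> d <= cabs (u - z0).
  move=> ur; apply: nz; rewrite Pr hornerZ horner_prod.
  by apply/eqP; rewrite mulf_eq0; apply/orP; right; rewrite prodf_seq_eq0; apply/hasP; exists u; rewrite // hornerXsubC subrr eqxx.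
have key N : (0 < N)%N -> c ^+ N <= 2 ^+ size r * cabs P.[z0] ^+ N.
  move=> N0; have [s Xs] := closed_field_poly_normal ('X^N - 1 : {poly R[i]}).
  have lead1 : lead_coef ('X^N - 1 : {poly R[i]}) = 1.
    by apply/monicP; rewrite -polyC1 monicXnsubC.
  rewrite lead1 scale1r in Xs.
  have ss : size s = N.
    by have := congr1 (fun p : {poly _} => size p) Xs; rewrite size_XnsubC // size_prod_XsubC => -[].
  have s1 w : w \in s -> cabs w = 1.
    move=> ws; have : root ('X^N - 1) w by rewrite Xs root_prod_XsubC.
    rewrite /root !hornerE subr_eq0 => /eqP w1.
    have /eqP := congr1 cabs w1; rewrite cabsX cabs1 pexpr_eq1 ?cabs_ge0 //.
    by move=> /eqP.
  (* With w running through the N-th roots of unity, the product of the dw - v has modulus |v^N -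
     d^N|, and this is at most 2|v|^N since d <= |v|. One factor 2 per root of P results. *)
  have sv v : d <= cabs v -> \prod_(w <- s) cabs (cR d * w - v) <= 2 * cabs v ^+ N.
    move=> dv.
    have -> : \prod_(w <- s) cabs (cR d * w - v) = d ^+ N * cabs ((v / cR d) ^+ N - 1).
      have -> : (v / cR d) ^+ N - 1 = \prod_(w <- s) (v / cR d - w).
        have := congr1 (fun p : {poly R[i]} => p.[v / cR d]) Xs.
        rewrite !hornerE horner_prod => ->.
        by apply: eq_bigr => w _; rewrite hornerXsubC.
      rewrite cabs_prod -ss -prodr_const_size -big_split /=.
      apply: eq_bigr => w _; rewrite -[d in X in _ = X * _](ger0_norm (ltW d0)) -cabs_cR -cabsM.
      rewrite -cabsN opprB mulrBr mulrCA divff ?mulr1 //.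
      by rewrite cR_eq0 gt_eqF.
    have -> : d ^+ N * cabs ((v / cR d) ^+ N - 1) = cabs (cR d ^+ N * ((v / cR d) ^+ N - 1)).
      by rewrite cabsM cabsX cabs_cR ger0_norm // ltW.
    rewrite mulrBr mulr1 -exprMn mulrCA divff ?cR_eq0 ?gt_eqF // mulr1 (le_trans (cabsB _ _)) // !cabsX.
    rewrite cabs_cR ger0_norm ?(ltW d0) // mulr_natl mulr2n lerD2l.
    by rewrite lerXn2r // nnegrE ?cabs_ge0 // ltW.
  have le1 : c ^+ N <= \prod_(w <- s) cabs P.[z0 + cR d * w].
    rewrite -ss -prodr_const_size big_seq [X in _ <= X]big_seq.
    apply: ler_prod => w ws; rewrite (ltW c0) /= cP //.
    by rewrite addrAC subrr add0r cabsM (s1 w ws) mulr1 cabs_cR ger0_norm // ltW.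
  apply: (le_trans le1).
  under eq_bigr do rewrite PE.
  rewrite big_split /= prodr_const_size ss exchange_big /=.
  rewrite PE exprMn mulrCA ler_wpM2l ?exprn_ge0 ?cabs_ge0 //.
  rewrite -prodrXl -prodr_const_size -big_split /= big_seq [X in _ <= X]big_seq.
  apply: ler_prod => u ur; rewrite prodr_ge0 /=; last by move=> *; exact: cabs_ge0.
  rewrite cabs_distC -(cabsN (u - z0)) opprB cabs_distC.
  apply: le_trans (sv (u - z0) (rz u ur)) => //.
  rewrite le_eqVlt; apply/orP; left; apply/eqP; apply: eq_bigr => w _; congr cabs; ring.
have p0 : 0 < cabs P.[z0] by rewrite cabs_gt0.
(* The bound just proved reads (1 + q)^N <= 2^(deg P) for all N >= 1, while Bernoulli's inequality
   makes the left side at least 1 + Nq. *)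
pose q := c / cabs P.[z0] - 1.
have q0 : 0 < q by rewrite subr_gt0 ltr_pdivlMr // mul1r.
have qN N : (0 < N)%N -> N%:R * q <= 2 ^+ size r.
  move=> N0; have := bernoulli_expr N (ltW q0).
  have -> : 1 + q = c / cabs P.[z0] by rewrite /q; ring.
  rewrite exprMn exprVn => h; have := key N N0.
  rewrite -ler_pdivrMr ?exprn_gt0 //; lra.
have [N hN] : exists N : nat, 2 ^+ size r / q < N%:R.
  by exists (Num.bound (2 ^+ size r / q)); apply: archi_boundP; rewrite divr_ge0 ?exprn_ge0 // ltW.
have := qN N.+1 isT; rewrite -ler_pdivlMr // => h.
by have := le_lt_trans h hN; rewrite ltr_nat ltnNge leqnSn.
Qed.

Lemma papprox_continuous F z e : papprox F -> 0 < e ->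
  exists2 d, 0 < d & forall w, cabs (z - w) <= d -> cabs (F z - F w) <= e.
Proof.
move=> aF e0; have [P hP] := aF (cabs z + 1) (e / 3) (divr_gt0 e0 (ltr0Sn _ _)).
have [K K0 PK] := poly_lipschitz P (cabs z + 1).
exists (Num.min 1 (e / 3 / K)); first by rewrite lt_min ltr01 !divr_gt0.
move=> w; rewrite le_min => /andP[zw1 zwe].
have zB : cabs z <= cabs z + 1 by rewrite lerDl.
have wB : cabs w <= cabs z + 1.
  have := cabs_ge_sub w (- z); rewrite cabsN (cabs_distC w z); lra.
have -> : F z - F w = (F z - P.[z]) + (P.[z] - P.[w]) - (F w - P.[w]) by ring.
have := cabsB ((F z - P.[z]) + (P.[z] - P.[w])) (F w - P.[w]).
have := cabsD (F z - P.[z]) (P.[z] - P.[w]).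
have := hP z zB; have := hP w wB; have := PK z w zB wB.
have : K * cabs (z - w) <= e / 3 by rewrite mulrC -ler_pdivlMr.
lra.
Qed.

(** Without a zero nearby, |F| has a positive minimum m on a compact neighbourhood of z0. A
    polynomial close enough to F still satisfies the hypotheses of the polynomial case, and its zero
    is a point where |F| < m, a contradiction. *)
Lemma papprox_zero_in_disc F z0 d c : papprox F -> 0 < d ->
  (forall z, cabs (z - z0) = d -> c <= cabs (F z)) -> cabs (F z0) < c ->
  exists2 z, cabs (z - z0) <= 2 * d & F z = 0.
Proof.
move=> aF d0 Fc F0c; apply: contrapT => noz.
pose phi (p : R * R) : R := cabs (F (p.1 +i* p.2)%C).
have cphi : continuous phi.
  move=> p; apply/cvgrPdist_le => e e0.
  have [t t0 ht] := papprox_continuous (p.1 +i* p.2)%C aF e0.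
  have t2 : 0 < t / 2 by rewrite divr_gt0.
  exists (ball p.1 (t / 2), ball p.2 (t / 2)); first by split; exact: nbhsx_ballx.
  move=> q [/= h1 h2].
  rewrite (le_trans (cabs_dist_dist _ _)) // ht //.
  apply: le_trans (cabs_le_RecImc _) _; rewrite RecD ImcD RecN ImcN /=.
  move: h1 h2; rewrite -!ball_normE /= => h1 h2; lra.
(* A square instead of a disc, as a product of segments is compact. Its points satisfy |Re| + |Im|
   <= 2d relative to z0, whence the radius 2d in the conclusion. *)
pose A := (`[Rec z0 - d, Rec z0 + d] : set R) `*` (`[Imc z0 - d, Imc z0 + d] : set R).
have A0 : A (Rec z0, Imc z0) by split; rewrite /= in_itv /=; apply/andP; split; lra.
have [p pA pmin] : exists2 p, p \in A & forall q, q \in A -> phi p <= phi q.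
  apply: compact_EVT_min; first by exists (Rec z0, Imc z0).
    by apply: compact_setX; exact: segment_compact.
  exact: continuous_subspaceT.
have inA z : cabs (z - z0) <= d -> (Rec z, Imc z) \in A.
  move=> zd; have := le_trans (le_Rec_cabs _) zd; have := le_trans (le_Imc_cabs _) zd.
  rewrite RecD ImcD RecN ImcN !ler_norml => /andP[h1 h2] /andP[h3 h4].
  by rewrite inE; split; rewrite /= in_itv /=; apply/andP; split; lra.
have m0 : 0 < phi p.
  rewrite /phi cabs_gt0; apply/eqP => Fp; apply: noz; exists (p.1 +i* p.2)%C => //.
  apply: le_trans (cabs_le_RecImc _) _; rewrite RecD ImcD RecN ImcN /=.
  move: pA; rewrite inE => -[/=]; rewrite !in_itv /= => h1 h2.
  rewrite mulr_natl mulr2n; apply: lerD; rewrite ler_norml; apply/andP; split; lra.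
set m := phi p in m0 pmin.
(* A third of the gap keeps |P(z0)| <= |F(z0)| + e below c - e, which bounds |P| from below on the
   circle; m/2 excludes that a zero of P be a point with |F| >= m. *)
pose e := Num.min (m / 2) ((c - cabs (F z0)) / 3).
have e0 : 0 < e by rewrite lt_min !divr_gt0 // subr_gt0.
have em : e <= m / 2 by rewrite ge_min lexx.
have ec : e <= (c - cabs (F z0)) / 3 by rewrite ge_min lexx orbT.
have [P hP] := aF (cabs z0 + d) e e0.
have inB z : cabs (z - z0) <= d -> cabs z <= cabs z0 + d.
  by move=> zd; have := cabsD (z - z0) z0; rewrite subrK; lra.
have [u ud Pu] : exists2 u, cabs (u - z0) < d & P.[u] = 0.
  apply: (@poly_zero_in_disc P z0 d (c - e)) => // [z zd|].
    have := hP z (inB z _); rewrite zd lexx => /(_ isT).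
    have := Fc z zd; have := cabs_ge_sub (F z) (- (F z - P.[z])).
    rewrite cabsN (_ : F z - (F z - P.[z]) = P.[z]); last by ring.
    lra.
  have := hP z0 (inB z0 _); rewrite subrr cabs0 ltW // => /(_ isT).
  have := cabsB (F z0) (F z0 - P.[z0]).
  rewrite (_ : F z0 - (F z0 - P.[z0]) = P.[z0]); last by ring.
  lra.
have := hP u (inB u (ltW ud)); rewrite Pu subr0 => h.
have := pmin _ (inA u (ltW ud)); rewrite /phi /=.
have -> : (Rec u +i* Imc u)%C = u by case: (u).
lra.
Qed.

End PolynomialApproximation.

(** * Birkhoff regularity in terms of arcs of roots of unity *)

Section BirkhoffArcs.
Context {R : realType}.
Variables (n : nat) (Pa Pb : nat -> {poly R[i]}).
Implicit Types (A : 'I_n -> bool) (v : 'I_n -> R[i]).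

Definition zeta : R[i] := expi (cperiod n).

Definition theta_mx A v : 'M[R[i]]_n :=
  \matrix_(j < n, m < n) ((if A m then balpha Pa Pb j else bbeta Pa Pb j) * v m ^+ border Pa Pb j).

(** Permuting the points permutes columns, and multiplying all points by k multiplies row j by
    [k ^+ border Pa Pb j]; neither operation affects whether the determinant vanishes. *)
Lemma theta_det_reindex A A' v v' (s : 'I_n -> 'I_n) (k : R[i]) :
  injective s -> k != 0 -> (forall m, A' m = A (s m)) -> (forall m, v' m = k * v (s m)) ->
  (\det (theta_mx A' v') != 0) = (\det (theta_mx A v) != 0).
Proof.
move=> s_inj k0 As vs; pose D : 'rV[R[i]]_n := \row_j k ^+ border Pa Pb j.
have -> : theta_mx A' v' = diag_mx D *m col_perm (perm s_inj) (theta_mx A v).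
  apply/matrixP => i m; rewrite mul_diag_mx !mxE permE As vs exprMn.
  by case: (A _); ring.
rewrite det_mulmx det_diag col_permE det_mulmx det_perm !mulf_eq0 !negb_or.
have -> : \prod_i D 0 i != 0 by apply/prodf_neq0 => i _; rewrite mxE expf_neq0.
by rewrite signr_eq0 /= andbT.
Qed.

Hypothesis n_gt0 : (0 < n)%N.

Let n0 : n%:R != 0 :> R.
Proof. by rewrite pnatr_eq0 -lt0n. Qed.

Lemma zetaX k : zeta ^+ k = expi (k%:R * (2 * pi) / n%:R).
Proof. by rewrite -expiMn /cperiod mulrA. Qed.

Lemma zetaXn : zeta ^+ n = 1.
Proof. by rewrite zetaX mulrAC divff // mul1r expi_2pi. Qed.

Lemma cabs_zeta k : cabs (zeta ^+ k) = 1.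
Proof. by rewrite cabsX cabs_expi expr1n. Qed.

Lemma zeta_neq0 : zeta != 0. Proof. exact: expi_neq0. Qed.

Lemma zetaX_neq1 k : (0 < k < n)%N -> zeta ^+ k != 1.
Proof.
move=> /andP[k0 kn]; apply/eqP => /(congr1 Rec); rewrite zetaX /= => c1.
pose x : R := k%:R * pi / n%:R.
have xE : k%:R * (2 * pi) / n%:R = x + x by rewrite /x; field.
have : 0 < sin x.
  apply: sin_gt0_pi; rewrite ?in_itv /= divr_gt0 ?mulr_gt0 ?pi_gt0 ?ltr0n //=.
  by rewrite ltr_pdivrMr ?ltr0n // mulrC ltr_pM2l ?pi_gt0 ?ltr_nat.
move: c1; rewrite xE cosD -!expr2 => c1 s0.
have := cos2Dsin2 x; have : 0 < sin x ^+ 2 by rewrite exprn_gt0.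
lra.
Qed.

Lemma zeta_prim : n.-primitive_root zeta.
Proof.
rewrite /primitive_root_of_unity n_gt0; apply/forallP => i; rewrite unity_rootE.
case: (altP (i.+1 =P n)) => [->|ne]; first by rewrite zetaXn eqxx.
by rewrite (negbTE (zetaX_neq1 _)) // ltnS leq0n /= ltn_neqAle ne ltn_ord.
Qed.

Definition rootv (m : 'I_n) : R[i] := zeta ^+ m.

(** The cyclic interval of c consecutive exponents modulo n starting at s. The added n keeps the
    truncated subtraction exact for s <= n. *)
Definition arc s c (m : 'I_n) : bool := ((m + n - s) %% n < c)%N.

Lemma theta_arc_shift s c : (s <= n)%N ->
  (\det (theta_mx (arc s c) rootv) != 0) = (\det (theta_mx (arc 0 c) rootv) != 0).
Proof.
move=> sn.
pose f (m : 'I_n) : 'I_n := Ordinal (ltn_pmod (m + n - s) n_gt0).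
have f_val (m : 'I_n) : zeta ^+ m = zeta ^+ s * zeta ^+ (f m).
  rewrite /= prim_expr_mod ?zeta_prim // -exprD addnC subnK; last by rewrite (leq_trans sn) // leq_addl.
  by rewrite exprD zetaXn mulr1.
apply: (@theta_det_reindex _ _ _ _ f (zeta ^+ s)).
- move=> m1 m2 fm; have := f_val m1; rewrite fm -f_val => /eqP.
  rewrite (eq_prim_root_expr zeta_prim) !modn_small // => /eqP h.
  exact: val_inj.
- by rewrite expf_neq0 // zeta_neq0.
- by move=> m; rewrite /arc /= subn0 modnDr modn_mod.
exact: f_val.
Qed.

Hypothesis n_odd : odd n.

(** Explicit form of the sorted roots of -1 for odd n. After the rotation by pi/(2n) the m-th phase
    is (2m+1) pi/(2n) up to sign, so the real parts are minus the cosines of increasing angles in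
    [0, pi]. *)
Definition naimark_phase (m : nat) : R :=
  if odd m then - (m.+1%:R * pi / n%:R) else m%:R * pi / n%:R.

Definition naimark_root (m : nat) : R[i] := - expi (naimark_phase m).

Lemma naimark_rootRe m :
  Rec (expi (pi / (2 * n%:R)) * naimark_root m) = - cos ((2 * m + 1)%:R * pi / (2 * n%:R)).
Proof.
rewrite /naimark_root mulrN RecN -expiD /= /naimark_phase; congr (- _); case: ifP => _.
  rewrite -cosN; congr cos; rewrite natrD natrM -natr1; field; exact: n0.
by congr cos; rewrite natrD natrM; field; exact: n0.
Qed.

Lemma naimark_rootRe_lt m1 m2 : (m1 < m2)%N -> (m2 < n)%N ->
  Rec (expi (pi / (2 * n%:R)) * naimark_root m1) < Rec (expi (pi / (2 * n%:R)) * naimark_root m2).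
Proof.
move=> m12 m2n; rewrite !naimark_rootRe ltrN2.
have nn : 0 < 2 * n%:R :> R by rewrite mulr_gt0 ?ltr0n.
have inI m : (m < n)%N -> (2 * m + 1)%:R * pi / (2 * n%:R) \in `[0, (pi : R)]%R.
  move=> mn; rewrite in_itv /= divr_ge0 ?mulr_ge0 ?pi_ge0 ?(ltW nn) //=.
  rewrite ler_pdivrMr // mulrC ler_pM2l ?pi_gt0 // -natrM ler_nat; lia.
have /= -> := @ltr_cos R; rewrite ?inI ?(ltn_trans m12) //.
by rewrite ltr_pM2r ?invr_gt0 // ltr_pM2r ?pi_gt0 // ltr_nat; lia.
Qed.

Lemma naimark_rootXn m : naimark_root m ^+ n = -1.
Proof.
rewrite /naimark_root exprNn -signr_odd n_odd expr1 mulN1r -expiMn; congr (- _).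
have even_pi k : ~~ odd k -> expi (k%:R * pi : R) = 1.
  move=> kev; rewrite -(odd_double_half k) (negbTE kev) add0n -muln2 natrM -mulrA.
  by rewrite expiMn expi_2pi expr1n.
rewrite /naimark_phase; case: ifP => om.
  rewrite mulrN mulrCA divff // mulr1; have e := even_pi m.+1; move: e; rewrite /= om => /(_ isT) e.
  by apply: (mulIf (expi_neq0 (m.+1%:R * pi))); rewrite expiN_mul e mul1r.
by rewrite mulrCA divff // mulr1 even_pi // om.
Qed.

Lemma naimark_roots_explicit : naimark_roots n naimark_root.
Proof.
split; first by move=> m _; exact: naimark_rootXn.
split => [m1 m2 m1n m2n e|m mn]; last exact: naimark_rootRe_lt.
have [lt12|lt21|//] := ltngtP m1 m2.
  by have := naimark_rootRe_lt lt12 m2n; rewrite e ltxx.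
by have := naimark_rootRe_lt lt21 m1n; rewrite e ltxx.
Qed.

(* The exponents of the sorted roots are 0, -1, 1, -2, 2, ..., so the first c of them fill an arc
   starting at -(c./2). *)
Definition naimark_index c (m : nat) : nat :=
  if odd m then (if (m.+1)./2 <= c./2 then c./2 - (m.+1)./2 else n + c./2 - (m.+1)./2)%N
  else (m./2 + c./2)%N.

(** Every sorted root is -(zeta^(c/2))^(-1), with c/2 rounded down, times the power of zeta given by
    [naimark_index]. This common factor and the reindexing carry the columns m < c to the arc of
    length c starting at 0. *)
Lemma theta_arc_naimark c : (c <= n.+1./2)%N ->
  (btheta n Pa Pb naimark_root c != 0) = (\det (theta_mx (arc 0 c) rootv) != 0).
Proof.
move=> cn.
have ltI (m : 'I_n) : (naimark_index c m < n)%N.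
  by have := ltn_ord m; rewrite /naimark_index; case: ifP => om; [case: ifP => h|]; lia.
pose f m : 'I_n := Ordinal (ltI m).
pose k : R[i] := - (zeta ^+ c./2)^-1.
have z0 : zeta ^+ c./2 != 0 by rewrite expf_neq0 // zeta_neq0.
have phaseE m : (m < n)%N -> zeta ^+ c./2 * expi (naimark_phase m) = zeta ^+ naimark_index c m.
  move=> mn; rewrite /naimark_index /naimark_phase; case: ifP => om; last first.
    rewrite exprD mulrC; congr (_ * _); rewrite zetaX; congr expi.
    rewrite -{1}(odd_double_half m) om add0n -muln2 natrM; field; exact: n0.
  have zj : zeta ^+ (m.+1)./2 * expi (- (m.+1%:R * pi / n%:R)) = 1.
    rewrite mulrC zetaX (_ : _ * (2 * pi) / _ = m.+1%:R * pi / n%:R) ?expiN_mul //.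
    rewrite -[in RHS](odd_double_half m.+1) /= om add0n -muln2 natrM; field; exact: n0.
  have zj0 : zeta ^+ (m.+1)./2 != 0 by rewrite expf_neq0 // zeta_neq0.
  apply: (mulfI zj0); rewrite mulrCA zj mulr1 -exprD.
  case: ifP => h; first by rewrite subnKC.
  rewrite subnKC ?exprD ?zetaXn ?mul1r //; lia.
rewrite /btheta -/(theta_mx (fun m : 'I_n => (m < c)%N) (fun m : 'I_n => naimark_root m)).
apply: (@theta_det_reindex _ _ _ _ f k).
- move=> m1 m2 /(congr1 val) /= e; apply: val_inj => /=.
  have := ltn_ord m1; have := ltn_ord m2; move: e; rewrite /naimark_index.
  by case: ifP => o1; case: ifP => o2; try case: ifP => h1; try case: ifP => h2; lia.
- by rewrite oppr_eq0 invr_eq0.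
- move=> m; rewrite /arc subn0 modnDr modn_small //= /naimark_index; have := ltn_ord m.
  by case: ifP => o1; try case: ifP => h1; lia.
by move=> m; rewrite /rootv /= -phaseE // /k mulNr mulrA mulVf // mul1r.
Qed.

(** Regularity speaks of sorted roots for one sector only; rotation extends it to every arc of
    (n-1)/2 or (n+1)/2 consecutive exponents, so each position of u on the contour is covered. *)
Lemma theta_arc_neq0 s c : birkhoff_regular_odd n Pa Pb ->
  (s <= n)%N -> c = n.+1./2 \/ c = n./2 -> \det (theta_mx (arc s c) rootv) != 0.
Proof.
move=> reg sn cE; have [h1 h2] := reg _ naimark_roots_explicit.
rewrite theta_arc_shift // -theta_arc_naimark; first by case: cE => ->.
by case: cE => -> //; exact: half_leq.
Qed.

End BirkhoffArcs.

(** * Bounds for determinants, inverses and scaled polynomials *)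

Section DeterminantEstimates.
Context {R : realType}.
Implicit Types (K e : R).

Lemma cabs_prod_le (I : Type) (r : seq I) (x : I -> R[i]) K : 0 <= K ->
  (forall i, cabs (x i) <= K) -> cabs (\prod_(i <- r) x i) <= K ^+ size r.
Proof.
move=> K0 xK; rewrite cabs_prod -prodr_const_size.
by apply: ler_prod => i _; rewrite cabs_ge0 xK.
Qed.

Lemma cabs_prodB_le (I : Type) (r : seq I) (x y : I -> R[i]) K e : 1 <= K -> 0 <= e ->
  (forall i, cabs (x i) <= K) -> (forall i, cabs (y i) <= K) ->
  (forall i, cabs (x i - y i) <= e) ->
  cabs (\prod_(i <- r) x i - \prod_(i <- r) y i) <= (size r)%:R * K ^+ size r * e.
Proof.
move=> K1 e0 xK yK xy; have K0 : 0 <= K by lra.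
elim: r => [|i r IH]; first by rewrite !big_nil subrr cabs0 !mul0r.
rewrite !big_cons /=; set X := \prod_(j <- r) x j; set Y := \prod_(j <- r) y j.
have -> : x i * X - y i * Y = x i * (X - Y) + (x i - y i) * Y by ring.
rewrite (le_trans (cabsD _ _)) // !cabsM.
have h1 : cabs (x i) * cabs (X - Y) <= K * ((size r)%:R * K ^+ size r * e) by rewrite ler_pM ?cabs_ge0.
have h2 : cabs (x i - y i) * cabs Y <= e * (K ^+ size r).
  by rewrite ler_pM ?cabs_ge0 // cabs_prod_le.
have h3 : e * (K ^+ size r) <= e * (K ^+ (size r).+1).
  by rewrite ler_wpM2l // exprS ler_peMl // exprn_ge0.
rewrite -natr1 mulrDl mul1r mulrDl.
have -> : (size r)%:R * K ^+ (size r).+1 * e = K * ((size r)%:R * K ^+ size r * e) by rewrite exprS; ring.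
by rewrite lerD // (le_trans h2) // (le_trans h3) // mulrC.
Qed.

Lemma cabs_det_le n (X : 'M[R[i]]_n) K : 0 <= K ->
  (forall i j, cabs (X i j) <= K) -> cabs (\det X) <= #|'S_n|%:R * K ^+ n.
Proof.
move=> K0 XK; rewrite /determinant (le_trans (cabs_sum _ _ _)) //.
rewrite mulr_natl -sumr_const; apply: ler_sum => s _.
rewrite cabsM cabsX cabsN cabs1 expr1n mul1r.
have := @cabs_prod_le _ (enum 'I_n) (fun i => X i (s i)) K K0 (fun i => XK _ _).
by rewrite size_enum_ord big_enum.
Qed.

Lemma cabs_detB_le n (X Y : 'M[R[i]]_n) K e : 1 <= K -> 0 <= e ->
  (forall i j, cabs (X i j) <= K) -> (forall i j, cabs (Y i j) <= K) ->
  (forall i j, cabs (X i j - Y i j) <= e) ->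
  cabs (\det X - \det Y) <= #|'S_n|%:R * (n%:R * K ^+ n) * e.
Proof.
move=> K1 e0 XK YK XY; rewrite /determinant -sumrB (le_trans (cabs_sum _ _ _)) //.
rewrite -mulrA mulr_natl -sumr_const; apply: ler_sum => s _.
rewrite -mulrBr cabsM cabsX cabsN cabs1 expr1n mul1r.
have := @cabs_prodB_le _ (enum 'I_n) (fun i => X i (s i)) (fun i => Y i (s i)) K e K1 e0
  (fun i => XK _ _) (fun i => YK _ _) (fun i => XY _ _).
by rewrite size_enum_ord !big_enum.
Qed.

(** Each entry of the inverse is a cofactor divided by the determinant; the exponent n in place of n
    - 1 is harmless since K >= 1. *)
Lemma cabs_invmx_le n (X : 'M[R[i]]_n) K e : 1 <= K -> 0 < e ->
  (forall i j, cabs (X i j) <= K) -> e <= cabs (\det X) ->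
  forall i j, cabs (invmx X i j) <= #|'S_n.-1|%:R * K ^+ n / e.
Proof.
move=> K1 e0 XK eX i j; have K0 : 0 <= K by lra.
have dX : \det X != 0 by rewrite -cabs_gt0 (lt_le_trans e0).
have XU : X \in unitmx by rewrite unitmxE unitfE.
rewrite /invmx XU !mxE cabsM cabsV mulrC /cofactor cabsM cabsX cabsN cabs1 expr1n mul1r.
rewrite ler_pM ?cabs_ge0 ?invr_ge0 ?cabs_ge0 //; last by rewrite lef_pV2 // posrE // cabs_gt0.
apply: le_trans (cabs_det_le K0 _) _; first by move=> k l; rewrite !mxE.
by rewrite ler_wpM2l // ler_weXn2l // leq_pred.
Qed.

Definition cnorm1 n (P : {poly R[i]}) : R := \sum_(k < n) cabs P`_k.

Lemma cnorm1_ge0 n P : 0 <= cnorm1 n P.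
Proof. by apply: sumr_ge0 => k _; exact: cabs_ge0. Qed.

(** After division by u^d every coefficient below d carries a factor of modulus at most 1/|u|, so
    only the leading term survives. *)
Lemma poly_leading_estimate n (P : {poly R[i]}) d (u x : R[i]) :
  (size P <= d.+1)%N -> (d < n)%N -> 1 <= cabs u -> cabs x = 1 ->
  cabs (P.[u * x] / u ^+ d) <= cnorm1 n P /\
  cabs (P.[u * x] / u ^+ d - P`_d * x ^+ d) <= cnorm1 n P / cabs u.
Proof.
move=> sP dn u1 x1.
have u0 : 0 < cabs u by lra.
have un0 : u != 0 by rewrite -cabs_gt0.
have sumE : cnorm1 n P = cnorm1 d P + cabs P`_d + \sum_(d.+1 <= k < n) cabs P`_k.
  rewrite /cnorm1 -!(big_mkord xpredT (fun k => cabs P`_k)) (big_cat_nat (n := d.+1)) //=.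
  by rewrite big_nat_recr.
have s0 : 0 <= \sum_(d.+1 <= k < n) cabs P`_k by apply: sumr_ge0 => k _; exact: cabs_ge0.
have E : P.[u * x] / u ^+ d = \sum_(k < d) P`_k * x ^+ k * (u ^+ k / u ^+ d) + P`_d * x ^+ d.
  rewrite (horner_coef_wide _ sP) big_ord_recr /= mulrDl mulr_suml; congr (_ + _).
    by apply: eq_bigr => k _; rewrite exprMn; ring.
  by rewrite exprMn mulrA mulrAC mulfK ?expf_neq0 // mulrC.
have low : cabs (\sum_(k < d) P`_k * x ^+ k * (u ^+ k / u ^+ d)) <= cnorm1 d P / cabs u.
  rewrite (le_trans (cabs_sum _ _ _)) // mulr_suml; apply: ler_sum => k _.
  rewrite !cabsM !cabsX x1 expr1n mulr1 ler_wpM2l ?cabs_ge0 //.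
  have d0 : (0 < d)%N by exact: leq_ltn_trans (ltn_ord k).
  rewrite cabsV cabsX ler_pdivrMr ?exprn_gt0 //.
  rewrite (_ : cabs u ^+ d = cabs u * cabs u ^+ d.-1); last by rewrite -exprS prednK.
  by rewrite mulKf ?gt_eqF // ler_weXn2l // -ltnS prednK.
have iu : (cabs u)^-1 <= 1 by rewrite invf_le1.
have c0 := cnorm1_ge0 d P; have pd := cabs_ge0 P`_d.
have low1 : cnorm1 d P / cabs u <= cnorm1 d P by rewrite ler_piMr.
split.
  rewrite E (le_trans (cabsD _ _)) // [cabs (_ * _)]cabsM cabsX x1 expr1n mulr1; lra.
rewrite E addrK (le_trans low) // ler_wpM2r ?invr_ge0 ?(ltW u0) //; lra.
Qed.

End DeterminantEstimates.

(** * The characteristic matrix and its limit *)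

Section CharacteristicMatrix.
Context {R : realType}.
Variables (n : nat) (a b : R) (Pa Pb : nat -> {poly R[i]}).
Hypotheses (n_gt0 : (0 < n)%N) (ab : a < b).
Hypothesis sizeP : forall j, (j < n)%N -> (size (Pa j) <= n)%N /\ (size (Pb j) <= n)%N.
Implicit Types (u v : R[i]) (neg : 'I_n -> bool) (m : 'I_n).

Local Notation zeta := (@zeta R n).
Local Notation bd := (border Pa Pb).

Definition kap u m : R[i] := u * zeta ^+ m.

(* Each exponential is normalized at the endpoint where it is largest, so that |mode| <= 1. *)
Definition anchor neg m : R := if neg m then a else b.

Definition mode neg u m (x : R) : R[i] := cexp (kap u m * cR (x - anchor neg m)).

(** The endpoint values of the exponentials are free arguments, so that one column can be changed
    independently of the exponentials; dividing row i by u^(order) makes the matrix converge as |u|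
    grows. *)
Definition bvmx (ea eb : 'I_n -> R[i]) u : 'M[R[i]]_n :=
  \matrix_(i < n, m < n) (((Pa i).[kap u m] * ea m + (Pb i).[kap u m] * eb m) / u ^+ bd i).

Definition charmx neg u : 'M[R[i]]_n := bvmx (fun m => mode neg u m a) (fun m => mode neg u m b) u.

(** Without the division by powers of u the determinant is an entire function of u, hence within
    reach of polynomial approximation; its zeros away from 0 are those of the scaled determinant. *)
Definition charmx_raw neg u : 'M[R[i]]_n :=
  \matrix_(i < n, m < n) ((Pa i).[kap u m] * mode neg u m a + (Pb i).[kap u m] * mode neg u m b).

Lemma border_ltn (i : 'I_n) : (bd i < n)%N.
Proof.
have [h1 h2] := sizeP (ltn_ord i); rewrite /border.
by apply: leq_ltn_trans (_ : (n.-1 < n)%N); [rewrite -!subn1 leq_sub2r // geq_max h1|rewrite prednK].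
Qed.

Lemma size_border (i : nat) : (size (Pa i) <= (bd i).+1)%N /\ (size (Pb i) <= (bd i).+1)%N.
Proof. by rewrite /border; clear; split; lia. Qed.

Lemma det_charmx_raw neg u : u != 0 ->
  \det (charmx_raw neg u) = u ^+ (\sum_(i < n) bd i) * \det (charmx neg u).
Proof.
move=> u0; pose D : 'rV[R[i]]_n := \row_i u ^+ bd i.
have -> : charmx_raw neg u = diag_mx D *m charmx neg u.
  by apply/matrixP => i m; rewrite mul_diag_mx !mxE [RHS]mulrC divfK // expf_neq0.
rewrite det_mulmx det_diag; congr (_ * _).
by under eq_bigr do rewrite mxE; rewrite prodrXr.
Qed.

(** Linearity in one column separates the contributions of the two endpoints; it is applied to the
    column whose exponential may be neither small nor large. *)
Lemma det_bvmx_column (ea eb : 'I_n -> R[i]) u (m0 : 'I_n) :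
  \det (bvmx ea eb u) =
    ea m0 * \det (bvmx [eta ea with m0 |-> 1] [eta eb with m0 |-> 0] u) +
    eb m0 * \det (bvmx [eta ea with m0 |-> 0] [eta eb with m0 |-> 1] u).
Proof.
rewrite -[in LHS]det_tr -[X in _ * X + _]det_tr -[X in _ + _ * X]det_tr.
apply: (@determinant_multilinear _ _ _ _ _ m0).
- by apply/rowP => i; rewrite !mxE /= eqxx; ring.
- by apply/matrixP => k i; rewrite !mxE /= eq_sym (negbTE (neq_lift _ _)).
by apply/matrixP => k i; rewrite !mxE /= eq_sym (negbTE (neq_lift _ _)).
Qed.

Definition bvnorm : R := 1 + \sum_(i < n) (cnorm1 n (Pa i) + cnorm1 n (Pb i)).

Lemma bvnorm_le (i : 'I_n) : cnorm1 n (Pa i) + cnorm1 n (Pb i) + 1 <= bvnorm.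
Proof.
rewrite /bvnorm addrC lerD2l (bigD1 i) //= lerDl sumr_ge0 // => j _.
by rewrite addr_ge0 // cnorm1_ge0.
Qed.

Lemma bvnorm_ge1 : 1 <= bvnorm.
Proof. by rewrite lerDl sumr_ge0 // => j _; rewrite addr_ge0 // cnorm1_ge0. Qed.

Lemma cabs_bvmx_le ea eb u : 1 <= cabs u ->
  (forall m, cabs (ea m) <= 1) -> (forall m, cabs (eb m) <= 1) ->
  forall i m, cabs (bvmx ea eb u i m) <= bvnorm.
Proof.
move=> u1 ea1 eb1 i m; rewrite mxE mulrDl mulrAC [X in _ + X]mulrAC.
have [s1 s2] := size_border i; have bn := border_ltn i; have z1 := @cabs_zeta R n m.
have [p1 _] := poly_leading_estimate s1 bn u1 z1; have [q1 _] := poly_leading_estimate s2 bn u1 z1.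
have := bvnorm_le i; apply: le_trans; apply: le_trans (cabsD _ _) _.
rewrite [X in X + _]cabsM [X in _ + X]cabsM.
have h1 : cabs ((Pa i).[kap u m] / u ^+ bd i) * cabs (ea m) <= cnorm1 n (Pa i) * 1.
  by rewrite ler_pM ?cabs_ge0.
have h2 : cabs ((Pb i).[kap u m] / u ^+ bd i) * cabs (eb m) <= cnorm1 n (Pb i) * 1.
  by rewrite ler_pM ?cabs_ge0.
lra.
Qed.

(** [A m] means that exponential m is 1 at a and small at b; its column then tends to the leading
    coefficients at a, otherwise to those at b. The term 1/|u| comes from the lower-order
    coefficients. *)
Lemma bvmx_theta_estimate ea eb (A : 'I_n -> bool) u (e : R) : 1 <= cabs u -> 0 <= e ->
  (forall m, if A m then ea m = 1 /\ cabs (eb m) <= e else eb m = 1 /\ cabs (ea m) <= e) ->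
  forall i m, cabs (bvmx ea eb u i m - theta_mx Pa Pb A (@rootv R n) i m) <= bvnorm * ((cabs u)^-1 + e).
Proof.
move=> u1 e0 hA i m; rewrite !mxE mulrDl mulrAC [X in _ + X - _]mulrAC.
have [s1 s2] := size_border i; have bn := border_ltn i; have z1 := @cabs_zeta R n m.
have [p1 p2] := poly_leading_estimate s1 bn u1 z1; have [q1 q2] := poly_leading_estimate s2 bn u1 z1.
have := bvnorm_le i; have ca := cnorm1_ge0 n (Pa i); have cb := cnorm1_ge0 n (Pb i) => hK.
have iu : 0 <= (cabs u)^-1 by rewrite invr_ge0 cabs_ge0.
rewrite /rootv /balpha /bbeta /kap.
move: (hA m); case: (A m) => -[-> he]; rewrite mulr1.
  set X := (Pa i).[_] / _ in p1 p2 *; set Y := (Pb i).[_] / _ in q1 q2 *.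
  have -> : X + Y * eb m - (Pa i)`_(bd i) * (zeta ^+ m) ^+ bd i =
    (X - (Pa i)`_(bd i) * (zeta ^+ m) ^+ bd i) + Y * eb m by ring.
  rewrite (le_trans (cabsD _ _)) // mulrDr lerD //.
    by rewrite (le_trans p2) // ler_wpM2r //; lra.
  by rewrite cabsM ler_pM ?cabs_ge0 //; lra.
set X := (Pa i).[_] / _ in p1 p2 *; set Y := (Pb i).[_] / _ in q1 q2 *.
have -> : X * ea m + Y - (Pb i)`_(bd i) * (zeta ^+ m) ^+ bd i =
  (Y - (Pb i)`_(bd i) * (zeta ^+ m) ^+ bd i) + X * ea m by ring.
rewrite (le_trans (cabsD _ _)) // mulrDr lerD //.
  by rewrite (le_trans q2) // ler_wpM2r //; lra.
by rewrite cabsM ler_pM ?cabs_ge0 //; lra.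
Qed.

Lemma cabs_theta_le A i m : cabs (theta_mx Pa Pb A (@rootv R n) i m) <= bvnorm.
Proof.
rewrite mxE cabsM cabsX cabs_zeta expr1n mulr1.
have bn := border_ltn i; have := bvnorm_le i.
have hP (P : {poly R[i]}) : cabs P`_(bd i) <= cnorm1 n P.
  rewrite /cnorm1 (bigD1 (Ordinal bn)) //= lerDl.
  by apply: sumr_ge0 => k _; exact: cabs_ge0.
have := hP (Pa i); have := hP (Pb i).
have ca := cnorm1_ge0 n (Pa i); have cb := cnorm1_ge0 n (Pb i).
by case: (A m); rewrite /balpha /bbeta; lra.
Qed.

Lemma det_bvmx_theta_estimate ea eb (A : 'I_n -> bool) u (e : R) : 1 <= cabs u -> 0 <= e <= 1 ->
  (forall m, if A m then ea m = 1 /\ cabs (eb m) <= e else eb m = 1 /\ cabs (ea m) <= e) ->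
  cabs (\det (bvmx ea eb u) - \det (theta_mx Pa Pb A (@rootv R n))) <=
  #|'S_n|%:R * (n%:R * bvnorm ^+ n) * bvnorm * ((cabs u)^-1 + e).
Proof.
move=> u1 /andP[e0 e1] hA; rewrite -[leRHS]mulrA.
have iu : 0 <= (cabs u)^-1 by rewrite invr_ge0 cabs_ge0.
apply: cabs_detB_le; [exact: bvnorm_ge1| | | |exact: bvmx_theta_estimate].
- by apply: mulr_ge0; [exact: le_trans ler01 bvnorm_ge1|exact: addr_ge0].
- apply: cabs_bvmx_le => // m; move: (hA m); case: (A m) => -[e2 h]; rewrite ?e2 ?cabs1 //; lra.
exact: cabs_theta_le.
Qed.

Lemma papprox_det_charmx_raw neg : papprox (fun u => \det (charmx_raw neg u)).
Proof.
apply: papprox_det => i m.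
have pP (P : {poly R[i]}) : papprox (fun u => P.[kap u m]).
  apply: papprox_eq (papprox_scale (zeta ^+ m) (papprox_poly P)) => u.
  by rewrite /kap mulrC.
have pm x : papprox (fun u => mode neg u m x).
  apply: papprox_eq (papprox_cexp_scale (zeta ^+ m * cR (x - anchor neg m))) => u.
  by rewrite /mode /kap; congr cexp; ring.
apply: papprox_eq (papproxD (papproxM (pP (Pa i)) (pm a)) (papproxM (pP (Pb i)) (pm b))) => u.
by rewrite mxE.
Qed.

End CharacteristicMatrix.

(** * Exponential solutions and eigenvalues of the unperturbed operator *)

Section Modes.
Context {R : realType}.
Variables (n : nat) (a b : R) (Pa Pb : nat -> {poly R[i]}).
Hypotheses (n_gt0 : (0 < n)%N) (ab : a < b).
Hypothesis sizeP : forall j, (j < n)%N -> (size (Pa j) <= n)%N /\ (size (Pb j) <= n)%N.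
Implicit Types (u v : R[i]) (neg : 'I_n -> bool) (m : 'I_n).

Local Notation zeta := (@zeta R n).
Local Notation mode := (@mode R n a b).
Local Notation kap := (@kap R n).

Lemma ode_sol_cdrv lam f (Y : nat -> R -> R[i]) : ccont `[a, b] f ->
  (forall k, (k.+1 < n)%N -> forall x, a <= x <= b -> cdrv (Y k) x (Y k.+1 x)) ->
  (forall x, a <= x <= b -> cdrv (Y n.-1) x (ci ^+ n * (f x + lam * Y 0%N x))) ->
  ode_sol n a b zero_pot lam f Y.
Proof.
move=> cf YY YL.
have rhsE : (fun t => ci ^+ n * (f t + lam * Y 0%N t - \sum_(k < n.-1) zero_pot k t * Y k t)) =
            (fun t => ci ^+ n * (f t + lam * Y 0%N t)).
  by apply/funext => t; rewrite big1 ?subr0 // => k _; rewrite /zero_pot mul0r.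
have cY k : (k < n)%N -> ccont `[a, b] (Y k).
  move=> kn; have [kn1|kn1] := ltnP k.+1 n; first by apply: cdrv_ccont; exact: YY.
  by have -> : k = n.-1 by [lia]; apply: cdrv_ccont; exact: YL.
have crhs : ccont `[a, b] (fun t => ci ^+ n * (f t + lam * Y 0%N t)).
  apply: ccontM; first exact: ccont_cst.
  by apply: ccontD => //; apply: ccontM; [exact: ccont_cst|exact: cY].
rewrite /ode_sol rhsE; split => //; split.
  move=> k kn x; rewrite in_seg => hx.
  by apply: (@cint_derivative _ a b) => //; [exact: YY|exact: cY].
split; first exact: ccont_cintegrable.
move=> x; rewrite in_seg => hx.
exact: (@cint_derivative _ a b).
Qed.

Lemma kapXn u m : kap u m ^+ n = u ^+ n.
Proof. by rewrite /kap exprMn -exprM mulnC exprM zetaXn // expr1n mulr1. Qed.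

Lemma cdrv_mode neg u m x : cdrv (mode neg u m) x (kap u m * mode neg u m x).
Proof. exact: cdrv_cexp. Qed.

Definition modes (C : 'I_n -> R[i]) neg u (k : nat) (x : R) : R[i] :=
  \sum_m C m * kap u m ^+ k * mode neg u m x.

Lemma cdrv_modes C neg u k x : cdrv (modes C neg u k) x (modes C neg u k.+1 x).
Proof.
apply: cdrv_sum => m _.
apply: cdrv_eq (cdrvZ (C m * kap u m ^+ k) (cdrv_mode neg u m x)) => //.
by rewrite exprSr; ring.
Qed.

Lemma modes_top C neg u lam x : u ^+ n = ci ^+ n * lam ->
  modes C neg u n x = ci ^+ n * (lam * modes C neg u 0 x).
Proof.
move=> ulam; rewrite /modes mulrA -ulam mulr_sumr; apply: eq_bigr => m _.
by rewrite kapXn expr0; ring.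
Qed.

Lemma bform_modes C neg u (j : 'I_n) :
  bform n Pa Pb a b (modes C neg u) j = \sum_m charmx_raw a b Pa Pb neg u j m * C m.
Proof.
rewrite /bform /modes.
under eq_bigr do rewrite !mulr_sumr -big_split /=.
rewrite exchange_big /=; apply: eq_bigr => m _.
have [s1 s2] := sizeP (ltn_ord j).
rewrite mxE (horner_coef_wide _ s1) (horner_coef_wide _ s2) !mulr_suml -big_split /= mulr_suml.
by apply: eq_bigr => k _; ring.
Qed.

Lemma kap_inj u : u != 0 -> injective (kap u).
Proof.
move=> u0 m1 m2 /(mulfI u0) /eqP.
by rewrite (eq_prim_root_expr (zeta_prim n_gt0)) !modn_small // => /eqP/val_inj.
Qed.

(** Testing the n moment identities on the polynomial of degree n - 1 that vanishes at all exponents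
    except number m0 isolates the coefficient with index m0. *)
Lemma vandermonde_kap_eq0 u (c : 'I_n -> R[i]) : u != 0 ->
  (forall k, (k < n)%N -> \sum_m c m * kap u m ^+ k = 0) -> forall m, c m = 0.
Proof.
move=> u0 ck m0.
pose P : {poly R[i]} := \prod_(m in predC1 m0) ('X - (kap u m)%:P).
have sP : size P = n.
  by rewrite /P -big_enum size_prod_XsubC -cardE cardC1 card_ord prednK.
have : \sum_m c m * P.[kap u m] = 0.
  under eq_bigr do rewrite horner_coef mulr_sumr.
  rewrite exchange_big /= big1 // => k _.
  under eq_bigr do rewrite mulrCA.
  by rewrite -mulr_sumr ck ?mulr0 // -[X in (_ < X)%N]sP.
rewrite (bigD1 m0) //= big1 => [|m mm0]; last first.
  rewrite /P horner_prod (bigD1 m) //= hornerXsubC subrr mul0r mulr0 //.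
rewrite addr0 => /eqP; rewrite mulf_eq0 => /orP[/eqP//|].
rewrite /P horner_prod => /prodf_eq0[m mm0].
by rewrite hornerXsubC subr_eq0 => /eqP/(kap_inj u0) e; rewrite e inE eqxx in mm0.
Qed.

(** A kernel vector of the characteristic matrix gives a combination of exponentials satisfying the
    boundary conditions. Were it zero on [a,b], all its derivatives would vanish inside, and the
    Vandermonde argument at the midpoint would make all coefficients zero. *)
Lemma eigenvalue_of_det0 neg u lam : u != 0 -> u ^+ n = ci ^+ n * lam ->
  \det (charmx_raw a b Pa Pb neg u) = 0 -> Defs.eigenvalue n a b zero_pot Pa Pb lam.
Proof.
move=> u0 ulam; rewrite -det_tr => /eqP/det0P[c c0 cM].
exists (modes (fun m => c 0 m) neg u); split; [|split].
- apply: ode_sol_cdrv; first exact: ccont_cst.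
    by move=> k _ x _; exact: cdrv_modes.
  move=> x _; rewrite add0r -(modes_top _ _ _ ulam).
  by have := cdrv_modes (fun m => c 0 m) neg u n.-1 x; rewrite prednK.
- move=> j jn; rewrite (bform_modes _ _ _ (Ordinal jn)).
  have /matrixP/(_ 0 (Ordinal jn)) := cM; rewrite !mxE => e; rewrite -[RHS]e.
  by apply: eq_bigr => m _; rewrite [X in _ = _ * X]mxE mulrC.
apply: contrapT => noY.
have Y0 x : a <= x <= b -> modes (fun m => c 0 m) neg u 0 x = 0.
  move=> hx; apply/eqP; apply: contrapT => /negP nz; apply: noY; exists x; split => //.
  by rewrite in_seg.
have Yk k x : a < x < b -> modes (fun m => c 0 m) neg u k x = 0.
  elim: k x => [|k IH] x /andP[ax xb]; first by apply: Y0; rewrite !ltW.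
  have [D1 D2] := cdrv_modes (fun m => c 0 m) neg u k x.
  have near0 : \forall t \near x, modes (fun m => c 0 m) neg u k t = 0.
    near=> t; apply: IH; apply/andP; split; near: t.
      exact: lt_nbhsr.
    exact: lt_nbhsl.
  have der0 (f : R -> R) d : (\forall t \near x, f t = 0) -> is_derive x 1 f d -> d = 0.
    move=> f0 [_ <-]; rewrite (near_eq_derive _ _ (g := cst 0)) ?derive_cst ?oner_neq0 //.
  apply: ceqP.
    by apply: der0 D1; near=> t; rewrite (near near0).
  by apply: der0 D2; near=> t; rewrite (near near0).
pose x0 := (a + b) / 2.
have x0ab : a < x0 < b by rewrite /x0 !midf_lt.
have cm m : c 0 m * mode neg u m x0 = 0.
  apply: (@vandermonde_kap_eq0 u (fun m => c 0 m * mode neg u m x0)) => // k kn.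
  by rewrite -[RHS](Yk k x0 x0ab); apply: eq_bigr => i _; ring.
case/negP: c0; apply/eqP/rowP => m; rewrite mxE; apply/eqP.
by have /eqP := cm m; rewrite mulf_eq0 (negbTE (cexp_neq0 _)) orbF.
Unshelve. all: by end_near.
Qed.

End Modes.

(** * Lower bound for the characteristic determinant *)

Section CharacteristicBound.
Context {R : realType}.
Variables (n : nat) (a b : R) (Pa Pb : nat -> {poly R[i]}).
Hypotheses (n_gt0 : (0 < n)%N) (n_odd : odd n) (ab : a < b).
Hypothesis sizeP : forall j, (j < n)%N -> (size (Pa j) <= n)%N /\ (size (Pb j) <= n)%N.
Hypothesis reg : birkhoff_regular_odd n Pa Pb.
Implicit Types (u v : R[i]) (sg : bool) (m : 'I_n) (c d : R).

Local Notation zeta := (@zeta R n).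
Local Notation mode := (@mode R n a b).
Local Notation kap := (@kap R n).
Local Notation charmx := (@charmx R n a b Pa Pb).
Local Notation bvmx := (@bvmx R n Pa Pb).
Local Notation L := (b - a).

(** [sg] is true when u is close to the positive imaginary direction and false when it is close to
    the negative one; it determines which of the exponents with nonzero index have negative real
    part. *)
Definition decaying sg m : bool := if sg then (0 < m <= n./2)%N else (n./2 < m)%N.
Definition decaying0 sg m : bool := (val m == 0%N) || decaying sg m.

Definition sector c sg u : Prop := forall m, val m != 0%N ->
  if decaying sg m then Rec (kap u m) <= - (c * cabs u) else c * cabs u <= Rec (kap u m).

Lemma arcE s k m : (s <= n)%N -> arc s k m = if (s <= m)%N then (m - s < k)%N else (m + n - s < k)%N.
Proof.
move=> sn; rewrite /arc; have mn := ltn_ord m; case: ifP => sm.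
  by rewrite -addnBAC // modnDr modn_small //; lia.
by rewrite modn_small //; lia.
Qed.

(** The decaying indices form a cyclic arc of (n-1)/2 exponents, and with index 0 adjoined one of
    (n+1)/2: exactly the two lengths covered by regularity. *)
Lemma theta_decaying sg : \det (theta_mx Pa Pb (decaying sg) (@rootv R n)) != 0.
Proof.
have -> : decaying sg = arc (if sg then 1%N else (n./2).+1) n./2.
  apply/funext => m; rewrite arcE; last by case: sg; lia.
  by have := ltn_ord m; rewrite /decaying; case: sg; case: ifP => h; lia.
by apply: theta_arc_neq0 => //; [case: sg; lia|right].
Qed.

Lemma theta_decaying0 sg : \det (theta_mx Pa Pb (decaying0 sg) (@rootv R n)) != 0.
Proof.
have -> : decaying0 sg = arc (if sg then 0%N else (n./2).+1) n.+1./2.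
  apply/funext => m; rewrite arcE; last by case: sg; lia.
  by have := ltn_ord m; rewrite /decaying0 /decaying; case: sg => /=; [|case: ifP => h]; lia.
by apply: theta_arc_neq0 => //; [case: sg; lia|left].
Qed.

Let m0 : 'I_n := Ordinal n_gt0.

(** The ratio of the values at b and at a of the exponential with index 0, the only one allowed to
    be nearly oscillating. *)
Definition osc u : R[i] := cexp (u * cR L).

Lemma kap0 u : kap u m0 = u.
Proof. by rewrite /kap expr0 mulr1. Qed.

Definition dcol (x y : R[i]) sg u : R[i] :=
  \det (bvmx [eta (fun m => mode (decaying0 sg) u m a) with m0 |-> x]
             [eta (fun m => mode (decaying0 sg) u m b) with m0 |-> y] u).

Lemma det_charmx0 sg u : \det (charmx (decaying0 sg) u) = dcol 1 0 sg u + osc u * dcol 0 1 sg u.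
Proof.
have e1 : mode (decaying0 sg) u m0 a = 1.
  by rewrite /mode /anchor /decaying0 eqxx /= subrr cR0 mulr0 cexp0.
have e2 : mode (decaying0 sg) u m0 b = osc u.
  by rewrite /mode /anchor /decaying0 eqxx /= kap0.
by rewrite (det_bvmx_column _ _ _ _ _ m0) e1 e2 mul1r.
Qed.

Lemma decaying_m0 sg : decaying sg m0 = false.
Proof. by rewrite /decaying; case: sg. Qed.

(** Anchoring index 0 at b instead of a divides a single column by [osc u], so bounds for one
    normalization carry over to the other. *)
Lemma det_charmx1 sg u : \det (charmx (decaying sg) u) = (osc u)^-1 * \det (charmx (decaying0 sg) u).
Proof.
rewrite det_charmx0 mulrDr mulKf ?cexp_neq0 //.
have e x (y : R[i]) : [eta (fun m => mode (decaying sg) u m x) with m0 |-> y] =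
                      [eta (fun m => mode (decaying0 sg) u m x) with m0 |-> y] :> ('I_n -> R[i]).
  apply/funext => m /=; case: (altP (m =P m0)) => // mm0.
  rewrite /mode /anchor /decaying0; case: eqP => // m00.
  by case/eqP: mm0; exact: val_inj.
have e1 : mode (decaying sg) u m0 a = (osc u)^-1.
  by rewrite /mode /anchor decaying_m0 kap0 -cexpN -mulrN -cRN opprB.
have e2 : mode (decaying sg) u m0 b = 1.
  by rewrite /mode /anchor decaying_m0 subrr cR0 mulr0 cexp0.
by rewrite (det_bvmx_column _ _ _ _ _ m0) e1 e2 mul1r (e a 1) (e a 0) (e b 1) (e b 0).
Qed.

Lemma expRN_le_inv (x : R) : 0 < x -> expR (- x) <= x^-1.
Proof.
move=> x0; rewrite expRN lef_pV2 ?posrE ?expR_gt0 //.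
by have := expR_ge1Dx x; lra.
Qed.

Lemma mode_small sg c u m : 0 < c -> 0 < cabs u -> sector c sg u -> val m != 0%N ->
  if decaying0 sg m
  then mode (decaying0 sg) u m a = 1 /\ cabs (mode (decaying0 sg) u m b) <= (c * L * cabs u)^-1
  else mode (decaying0 sg) u m b = 1 /\ cabs (mode (decaying0 sg) u m a) <= (c * L * cabs u)^-1.
Proof.
move=> c0 u0 su mn0; have := su m mn0; rewrite /decaying0 (negbTE mn0) /=.
have L0 : 0 < L by rewrite subr_gt0.
have clu : 0 < c * L * cabs u by rewrite !mulr_gt0.
case: ifP => dm h; split.
- by rewrite /mode /anchor (negbTE mn0) /= dm subrr cR0 mulr0 cexp0.
- apply: le_trans (expRN_le_inv clu).
  rewrite /mode /anchor (negbTE mn0) /= dm cabs_cexp ler_expR RecM /= mulr0 subr0.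
  have -> : - (c * L * cabs u) = - (c * cabs u) * L by ring.
  by rewrite ler_wpM2r // ltW.
- by rewrite /mode /anchor (negbTE mn0) /= dm subrr cR0 mulr0 cexp0.
apply: le_trans (expRN_le_inv clu).
rewrite /mode /anchor (negbTE mn0) /= dm cabs_cexp ler_expR RecM /= mulr0 subr0.
have -> : - (c * L * cabs u) = - (c * cabs u * L) by ring.
have -> : Rec (kap u m) * (a - b) = - (Rec (kap u m) * L) by ring.
by rewrite lerN2 ler_wpM2r // ltW.
Qed.

(** In both parts of the column decomposition the other exponentials are 1 at one endpoint and
    exponentially small at the other; the crude bound e^(-x) <= 1/x turns this into O(1/|u|), the
    order of the lower coefficients. The part multiplied by [osc u] gives the second summand of 1 +
    |osc u|. *)
Lemma det_charmx_estimate sg c : 0 < c ->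
  exists C r : R, [/\ 0 < C, 1 <= r & forall u, sector c sg u -> r <= cabs u ->
    cabs (\det (charmx (decaying0 sg) u) -
          (\det (theta_mx Pa Pb (decaying0 sg) (@rootv R n)) +
           osc u * \det (theta_mx Pa Pb (decaying sg) (@rootv R n))))
    <= C / cabs u * (1 + cabs (osc u))].
Proof.
move=> c0; have L0 : 0 < L by rewrite subr_gt0.
have cL0 : 0 < c * L by rewrite mulr_gt0.
pose C0 : R := #|'S_n|%:R * (n%:R * bvnorm n Pa Pb ^+ n) * bvnorm n Pa Pb.
have bv1 : 1 <= bvnorm n Pa Pb by exact: bvnorm_ge1.
have C00 : 0 <= C0.
  by rewrite /C0 !mulr_ge0 ?exprn_ge0 // (le_trans ler01 bv1).
exists (C0 * (1 + (c * L)^-1) + 1), (1 + (c * L)^-1).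
have icL : 0 < (c * L)^-1 by rewrite invr_gt0.
split; [by rewrite ltr_wpDl // mulr_ge0 // addr_ge0 // ltW|lra|].
move=> u su ru; have u1 : 1 <= cabs u by lra.
have u0 : 0 < cabs u by lra.
pose e := (c * L * cabs u)^-1.
have eE : e = (c * L)^-1 / cabs u by rewrite /e invfM.
have e0 : 0 <= e by rewrite invr_ge0 mulr_ge0 // ltW.
have e1 : e <= 1 by rewrite eE ler_pdivrMr // mul1r; lra.
have e01 : 0 <= e <= 1 by rewrite e0.
rewrite det_charmx0.
set A := dcol 1 0 sg u; set B := dcol 0 1 sg u.
set tA := \det _; set tB := \det _.
have h1 : cabs (A - tA) <= C0 * ((cabs u)^-1 + e).
  apply: det_bvmx_theta_estimate => // m /=; case: (altP (m =P m0)) => [->|mm0].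
    by rewrite /decaying0 eqxx /=; split => //; rewrite cabs0.
  by apply: mode_small => //; apply: contra mm0 => /eqP h; apply/eqP; exact: val_inj.
have h2 : cabs (B - tB) <= C0 * ((cabs u)^-1 + e).
  apply: det_bvmx_theta_estimate => // m /=; case: (altP (m =P m0)) => [->|mm0].
    by rewrite decaying_m0; split => //; rewrite cabs0.
  have mn0 : val m != 0%N by apply: contra mm0 => /eqP h; apply/eqP; exact: val_inj.
  by have := mode_small c0 u0 su mn0; rewrite {1}/decaying0 (negbTE mn0).
have -> : A + osc u * B - (tA + osc u * tB) = (A - tA) + osc u * (B - tB) by ring.
rewrite (le_trans (cabsD _ _)) // cabsM.
have o0 := cabs_ge0 (osc u).
have h3 : cabs (osc u) * cabs (B - tB) <= cabs (osc u) * (C0 * ((cabs u)^-1 + e)) by rewrite ler_wpM2l.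
have h4 : C0 * ((cabs u)^-1 + e) <= (C0 * (1 + (c * L)^-1) + 1) / cabs u.
  have -> : C0 * ((cabs u)^-1 + e) = C0 * (1 + (c * L)^-1) / cabs u by rewrite eE; ring.
  by rewrite ler_wpM2r ?invr_ge0 ?(ltW u0) // lerDl.
have h5 := ler_wpM2l o0 h4.
rewrite mulrDr mulr1 [X in _ <= _ + X]mulrC.
by apply: lerD; [exact: le_trans h4|exact: le_trans h5].
Qed.

(** A shift of u by at most d moves each real part by at most d and c|u| by at most cd; halving the
    aperture from 2c to c absorbs both once |u| is large. *)
Lemma sector_perturb c sg u v d : 0 < c -> sector (2 * c) sg u -> cabs (v - u) <= d ->
  (1 + c) * d <= c * cabs u -> sector c sg v.
Proof.
move=> c0 su vu du m mn0; have := su m mn0.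
have vuR : `|Rec (kap v m) - Rec (kap u m)| <= d.
  apply: le_trans vu; rewrite -RecN -RecD (_ : kap v m - kap u m = (v - u) * zeta ^+ m); last first.
    by rewrite /kap; ring.
  by rewrite (le_trans (le_Rec_cabs _)) // cabsM cabs_zeta mulr1.
have vle : c * cabs v <= c * cabs u + c * d.
  rewrite -mulrDr ler_wpM2l ?(ltW c0) //.
  by have := cabsD u (v - u); rewrite addrC subrK; lra.
by move: vuR; rewrite ler_norml => /andP[h1 h2]; case: ifP => _; lra.
Qed.

Lemma cabs_cexpB1_ge (z : R[i]) : cabs z <= (8 * expR 1)^-1 -> cabs z / 2 <= cabs (cexp z - 1).
Proof.
move=> zs; have e1 : 1 <= expR 1 :> R by have := @expR_ge1Dx R 1; lra.
have e0 : 0 < 8 * expR 1 :> R by lra.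
have z0 := cabs_ge0 z.
have zs1 : cabs z * (8 * expR 1) <= 1 by rewrite -ler_pdivlMr // mul1r.
have z1 : cabs z <= 1.
  have : cabs z * 1 <= cabs z * (8 * expR 1) by rewrite ler_wpM2l //; lra.
  lra.
have h := cabs_cexpB1B z1.
have hz : 4 * expR 1 * cabs z ^+ 2 <= cabs z / 2.
  have -> : 4 * expR 1 * cabs z ^+ 2 = (cabs z * (8 * expR 1)) * (cabs z / 2) by field.
  by rewrite ler_piMl // divr_ge0.
have := cabs_ge_sub z (cexp z - 1 - z).
have -> : z + (cexp z - 1 - z) = cexp z - 1 by ring.
lra.
Qed.

(* If the determinant were small at u, it would have a zero nearby by the approximation argument,
   since its main term tA + osc tB cannot be small on a whole circle around u. *)
Lemma det_charmx_lower_bound sg c d : 0 < c -> 0 < d ->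
  exists eta r : R, [/\ 0 < eta, 1 <= r & forall u, sector (2 * c) sg u -> r <= cabs u ->
    (forall v, cabs (v - u) <= d -> \det (charmx_raw a b Pa Pb (decaying0 sg) v) != 0) ->
    eta * (1 + cabs (osc u)) <= cabs (\det (charmx (decaying0 sg) u))].
Proof.
move=> c0 d0; have L0 : 0 < L by rewrite subr_gt0.
have [C [r0 [C0 r01 est]]] := det_charmx_estimate sg c0.
set tA := \det (theta_mx Pa Pb (decaying0 sg) _) in est.
set tB := \det (theta_mx Pa Pb (decaying sg) _) in est.
have al0 : 0 < cabs tA by rewrite cabs_gt0 theta_decaying0.
have be0 : 0 < cabs tB by rewrite cabs_gt0 theta_decaying.
clearbody tA tB.
have [al alE] : exists al, al = cabs tA by exists (cabs tA).
have [be beE] : exists be, be = cabs tB by exists (cabs tB).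
rewrite -alE in al0; rewrite -beE in be0.
have [e eE] : exists e : R, e = expR 1 by exists (expR 1).
have e1 : 1 <= e by have := @expR_ge1Dx R 1; rewrite eE; lra.
have e0 : 0 < e by lra.
(* The zero will be found within 2d', hence 2d' <= d; the bound on d'L puts the circle of radius d'
   where |e^z - 1| >= |z|/2. *)
have [d' [d'0 d'd d'L]] : exists d' : R, [/\ 0 < d', 2 * d' <= d & d' * L <= (8 * e)^-1].
  have p0 : 0 < (8 * e)^-1 by rewrite invr_gt0 mulr_gt0.
  exists (Num.min (d / 2) ((8 * e)^-1 / L)); rewrite lt_min !divr_gt0 //.
  split => //; first by rewrite mulrC -ler_pdivlMr // ge_min lexx.
  by rewrite -ler_pdivlMr // ge_min lexx orbT.
(* A nearly vanishing tA + osc tB forces |osc| be - al <= (be/2)(1 + |osc|), that is |osc| <= K. *)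
have [K K0 KE] : exists2 K : R, 0 < K & 2 * al + be = K * be.
  exists ((2 * al + be) / be); last by rewrite divfK ?gt_eqF.
  by apply: divr_gt0 => //; lra.
pose B := (\sum_(i < n) border Pa Pb i)%N.
have [w w0 wE] : exists2 w : R, 0 < w & w = al * (d' * L).
  by exists (al * (d' * L)) => //; apply: mulr_gt0 => //; exact: mulr_gt0.
have hB : 0 < 2^-1 ^+ B :> R by apply: exprn_gt0; rewrite invr_gt0.
(* On the circle, w/2 is the lower bound for |tA (s - 1)|. The first condition keeps the residual
   main term below w/8 there; the factor 2^(-B) in the second pays for |v|^B falling to (|u|/2)^B in
   the unscaled determinant. *)
have [q [q0 q1 q2]] : exists q : R, [/\ 0 < q, 2 * q * e <= w / 8 & q <= 2^-1 ^+ B * w / 8].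
  have p1 : 0 < w / (16 * e) by apply: divr_gt0 => //; lra.
  have p2 : 0 < 2^-1 ^+ B * w / 8 by apply: divr_gt0 => //; exact: mulr_gt0.
  exists (Num.min (w / (16 * e)) (2^-1 ^+ B * w / 8)).
  split; [by rewrite lt_min p1 p2| |by rewrite ge_min lexx orbT].
  have : Num.min (w / (16 * e)) (2^-1 ^+ B * w / 8) <= w / (16 * e) by rewrite ge_min lexx.
  set mn := Num.min _ _; rewrite ler_pdivlMr; lra.
have K10 : 0 < 1 + K by lra.
have [eta [eta0 eta_be eta_q]] : exists eta : R, [/\ 0 < eta, eta <= be / 4 & eta * (1 + K) <= q].
  exists (Num.min (be / 4) (q / (1 + K))); rewrite lt_min !divr_gt0 //.
  split => //; first by rewrite ge_min lexx.
  by rewrite -ler_pdivlMr // ge_min lexx orbT.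
have eK : 0 < 1 + e * K by apply: addr_gt0 => //; exact: mulr_gt0.
have [r [r1 [rr0 rd reta] [rw rc]]] : exists r : R, [/\ 1 <= r,
    [/\ r0 * 2 <= r, 2 * d' + 2 <= r & C / eta <= r] &
    C * (1 + e * K) * 16 / w <= r /\ (1 + c) * d' / c <= r].
  have t1 : 0 < C / eta by exact: divr_gt0.
  have t2 : 0 < C * (1 + e * K) * 16 / w.
    by apply: divr_gt0 => //; apply: mulr_gt0 => //; exact: mulr_gt0.
  have t3 : 0 < (1 + c) * d' / c by apply: divr_gt0 => //; apply: mulr_gt0 => //; lra.
  exists (2 * d' + 2 + C / eta + C * (1 + e * K) * 16 / w + (1 + c) * d' / c + r0 * 2).
  move: (C / eta) (C * (1 + e * K) * 16 / w) ((1 + c) * d' / c) t1 t2 t3 => x y z t1 t2 t3.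
  by do !split; lra.
exists eta, r; split => //.
move=> u su ru nz; rewrite leNgt; apply/negP => small.
have u0 : 0 < cabs u by lra.
have suc v : cabs (v - u) <= d' -> sector c sg v.
  move=> vu; apply: sector_perturb su vu _ => //.
  rewrite mulrC [leRHS]mulrC -ler_pdivrMr // mulrC; lra.
have suu : sector c sg u by apply: suc; rewrite subrr cabs0 ltW.
have vlow v : cabs (v - u) <= d' -> cabs u / 2 <= cabs v.
  move=> vu; have := cabs_ge_sub u (v - u); rewrite (addrC u) subrK.
  lra.
have o0 := cabs_ge0 (osc u).
have Du : cabs (tA + osc u * tB) <= 2 * eta * (1 + cabs (osc u)).
  move: small (est u suu); set D := \det _; clearbody D => small.
  have -> : r0 <= cabs u by lra.
  move=> /(_ isT) h; have := cabs_ge_sub (tA + osc u * tB) (D - (tA + osc u * tB)).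
  rewrite (_ : _ + (D - _) = D); last by ring.
  have : C / cabs u * (1 + cabs (osc u)) <= eta * (1 + cabs (osc u)).
    rewrite ler_wpM2r ?addr_ge0 // ler_pdivrMr // mulrC -ler_pdivrMr //; lra.
  lra.
have oK : cabs (osc u) <= K.
  rewrite -(ler_pM2r be0) -KE.
  have := cabs_ge_sub (osc u * tB) tA; rewrite (addrC (osc u * tB)) cabsM -beE -alE.
  have : 2 * eta * (1 + cabs (osc u)) <= be / 2 * (1 + cabs (osc u)).
    by rewrite ler_wpM2r ?addr_ge0 //; lra.
  lra.
have Du' : cabs (tA + osc u * tB) <= 2 * q.
  apply: (le_trans Du); rewrite -mulrA ler_pM2l // (le_trans _ eta_q) //.
  by rewrite ler_wpM2l ?(ltW eta0) //; lra.
have circ v : cabs (v - u) = d' -> w / 4 <= cabs (\det (charmx (decaying0 sg) v)).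
  move=> vu; have vu' : cabs (v - u) <= d' by rewrite vu.
  have uv := vlow v vu'.
  pose s := cexp ((v - u) * cR L).
  have ov : osc v = osc u * s by rewrite /osc /s -cexpD -mulrDl (addrC u) subrK.
  have ds : cabs ((v - u) * cR L) = d' * L by rewrite cabsM vu cabs_cR ger0_norm // ltW.
  have s1 : cabs s <= e.
    rewrite /s cabs_cexp eE ler_expR (le_trans (ler_norm _)) // (le_trans (le_Rec_cabs _)) // ds.
    by rewrite (le_trans d'L) // invf_le1; lra.
  have s2 : d' * L / 2 <= cabs (s - 1) by rewrite -ds; apply: cabs_cexpB1_ge; rewrite ds -eE.
  clearbody s.
  (* The main term at v is the small one at u times s, minus tA (s - 1); since s stays away from 1
     on the circle and tA is nonzero, it cannot be small there. *)
  have DvE : tA + osc v * tB = (tA + osc u * tB) * s - tA * (s - 1) by rewrite ov; ring.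
  have Dv : w / 2 - w / 8 <= cabs (tA + osc v * tB).
    rewrite DvE -cabsN opprB; apply: le_trans (cabs_ge_sub _ _); rewrite cabsN (cabsM tA) (cabsM (tA + _)) -alE.
    have h1 : al * (d' * L / 2) <= al * cabs (s - 1) by apply: ler_wpM2l => //; exact: ltW.
    have h2 : cabs (tA + osc u * tB) * cabs s <= 2 * q * e by rewrite ler_pM ?cabs_ge0.
    have hw : w / 2 = al * (d' * L / 2) by rewrite wE; field.
    lra.
  have := est v (suc v vu'); set D := \det _; clearbody D.
  have -> : r0 <= cabs v by lra.
  move=> /(_ isT) h; have := cabs_ge_sub (tA + osc v * tB) (D - (tA + osc v * tB)).
  rewrite (_ : _ + (D - _) = D); last by ring.
  have v0 : 0 < cabs v by lra.
  have oV : cabs (osc v) <= e * K.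
    by rewrite ov cabsM mulrC ler_pM ?cabs_ge0.
  have h2 : C / cabs v * (1 + cabs (osc v)) <= C / cabs v * (1 + e * K).
    by apply: ler_wpM2l; [apply: divr_ge0; exact: ltW|lra].
  have h3 : C / cabs v * (1 + e * K) <= w / 8.
    rewrite mulrAC ler_pdivrMr // mulrAC ler_pdivlMr //.
    have : C * (1 + e * K) * 16 / w <= cabs u by lra.
    rewrite ler_pdivrMr // => h4.
    have : w * (cabs u / 2) <= w * cabs v by rewrite ler_wpM2l // ltW.
    lra.
  move: h Dv h2 h3; set x1 := C / cabs v * _; set x2 := C / cabs v * _; clearbody x1 x2; lra.
have un0 : u != 0 by rewrite -cabs_gt0.
have [z zu /eqP zz] : exists2 z, cabs (z - u) <= 2 * d' & \det (charmx_raw a b Pa Pb (decaying0 sg) z) = 0.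
  (* On the circle the unscaled determinant is at least (|u|/2)^B w/4; at the centre it is below
     |u|^B q, which is at most half of that. *)
  apply: (@papprox_zero_in_disc _ _ u d' ((cabs u / 2) ^+ B * (w / 4))) => //.
  - exact: papprox_det_charmx_raw.
  - move=> v vu; have vu' : cabs (v - u) <= d' by rewrite vu.
    have uv := vlow v vu'; have v0 : 0 < cabs v by lra.
    have vn0 : v != 0 by rewrite -cabs_gt0.
    have u20 : 0 <= cabs u / 2 by apply: divr_ge0 => //; exact: ltW.
    rewrite (det_charmx_raw _ _ _ _ _ vn0) cabsM cabsX; apply: ler_pM; [exact: exprn_ge0|lra| |exact: circ].
    by apply: lerXn2r; rewrite ?nnegrE //; exact: ltW.
  rewrite det_charmx_raw // cabsM cabsX -/B exprMn -mulrA ltr_pM2l ?exprn_gt0 //.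
  apply: (lt_le_trans small).
  have : eta * (1 + cabs (osc u)) <= q.
    by apply: le_trans eta_q; apply: ler_wpM2l; [exact: ltW|lra].
  have p0 : 0 <= 2^-1 ^+ B * w by apply: mulr_ge0; exact: ltW.
  lra.
by move: zz; apply/negP; apply: nz; lra.
Qed.

(** Index 0 is anchored at a when Re u <= 0 and at b otherwise, so all exponentials are at most 1 in
    modulus on the segment. The factor 1 + |osc u| in the lower bound serves both choices: its first
    summand for the anchor a, its second after division by |osc u| for the anchor b. *)
Lemma charmx_inverse_bound sg c d : 0 < c -> 0 < d ->
  exists K r : R, [/\ 0 < K, 1 <= r & forall u, sector (2 * c) sg u -> r <= cabs u ->
    (forall v, cabs (v - u) <= d -> \det (charmx_raw a b Pa Pb (decaying0 sg) v) != 0) ->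
    exists neg : 'I_n -> bool,
      [/\ forall m, if neg m then Rec (kap u m) <= 0 else 0 <= Rec (kap u m),
          charmx neg u \in unitmx &
          forall i j, cabs (invmx (charmx neg u) i j) <= K]].
Proof.
move=> c0 d0; have L0 : 0 < L by rewrite subr_gt0.
have [eta [r [eta0 r1 low]]] := det_charmx_lower_bound sg c0 d0.
pose bv := bvnorm n Pa Pb.
have bv1 : 1 <= bv by exact: bvnorm_ge1.
exists (#|'S_n.-1|%:R * bv ^+ n / eta + 1), r.
have K0 : 0 <= #|'S_n.-1|%:R * bv ^+ n / eta.
  by rewrite divr_ge0 ?(ltW eta0) // mulr_ge0 // exprn_ge0 // (le_trans ler01).
split => //; first by lra.
move=> u su ru nz; have u1 : 1 <= cabs u by lra.
have o0 : 0 < cabs (osc u) by rewrite cabs_gt0 cexp_neq0.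
have {}low := low u su ru nz.
have oE : cabs (osc u) = expR (Rec u * L) by rewrite /osc cabs_cexp RecM /= mulr0 subr0.
have main neg : (forall m, if neg m then Rec (kap u m) <= 0 else 0 <= Rec (kap u m)) ->
    eta <= cabs (\det (charmx neg u)) ->
    exists neg : 'I_n -> bool,
      [/\ forall m, if neg m then Rec (kap u m) <= 0 else 0 <= Rec (kap u m),
          charmx neg u \in unitmx &
          forall i j, cabs (invmx (charmx neg u) i j) <= #|'S_n.-1|%:R * bv ^+ n / eta + 1].
  move=> hneg hdet; exists neg; split => //.
    by rewrite unitmxE unitfE -cabs_gt0 (lt_le_trans eta0).
  have mode1 m x : a <= x <= b -> cabs (mode neg u m x) <= 1.
    move=> /andP[ax xb]; rewrite /mode cabs_cexp RecM /= mulr0 subr0 -expR0 ler_expR /anchor.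
    by have := hneg m; case: ifP => _ h; [rewrite mulr_le0_ge0|rewrite mulr_ge0_le0] => //; lra.
  have ent i j : cabs (charmx neg u i j) <= bv.
    by apply: cabs_bvmx_le => // m; apply: mode1; rewrite lexx (ltW ab).
  by move=> i j; apply: (le_trans (cabs_invmx_le bv1 eta0 ent hdet i j)); rewrite lerDl.
have sg0 m : val m != 0%N -> if decaying sg m then Rec (kap u m) <= 0 else 0 <= Rec (kap u m).
  move=> mn0; have cu : 0 <= c * cabs u by rewrite mulr_ge0 // ltW // (lt_le_trans ltr01).
  by have := su m mn0; case: ifP => _; lra.
have m0E m : val m = 0%N -> m = m0 by move=> h; exact: val_inj.
have [u_le|u_gt] := leP (Rec u) 0.
  apply: (main (decaying0 sg)).
    move=> m; rewrite /decaying0; case: (altP (val m =P 0%N)) => [/m0E ->|mn0] /=; first by rewrite kap0.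
    exact: sg0.
  by apply: le_trans low; rewrite ler_peMr ?(ltW eta0) // lerDl ltW.
apply: (main (decaying sg)).
  move=> m; case: (altP (val m =P 0%N)) => [/m0E ->|mn0]; last exact: sg0.
  by rewrite decaying_m0 kap0 ltW.
rewrite det_charmx1 cabsM cabsV mulrC ler_pdivlMr // (le_trans _ low) //.
by rewrite ler_wpM2l ?(ltW eta0) // lerDr.
Qed.

End CharacteristicBound.

(** * Integrals over a segment and vanishing criteria *)

Section SegmentIntegrals.
Context {R : realType}.
Implicit Types (a b x s t : R) (F G : R -> R[i]).

Lemma cint_split a b x F : a <= x <= b -> ccont `[a, b] F -> cint a b F = cint a x F + cint x b F.
Proof.
move=> /andP[ax xb] cF; have ab := le_trans ax xb.
have [Phi hPhi] := ccont_primitive ab cF.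
have [_ <-] := hPhi x (introT andP (conj ax xb)).
have [_ <-] := hPhi b (introT andP (conj ab (lexx b))).
apply: (@cint_derivative _ x b) => [t /andP[h1 h2]||]; last by rewrite xb lexx.
  by have [] := hPhi t (introT andP (conj (le_trans ax h1) h2)).
exact: ccont_sub cF.
Qed.

Lemma ccont_comp (A : set R) F (F' : R -> R[i]) (h : R -> R) :
  (forall t, cdrv F t (F' t)) -> continuous h -> ccont A (fun s => F (h s)).
Proof.
move=> FF' ch; split; apply: continuous_subspaceT => s.
  apply: (@continuous_comp _ _ _ h (fun t => Rec (F t))); first exact: ch.
  by apply: derivable1_continuous; case: (FF' (h s)) => -[].
apply: (@continuous_comp _ _ _ h (fun t => Imc (F t))); first exact: ch.
by apply: derivable1_continuous; case: (FF' (h s)) => _ [].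
Qed.

(** The derivative exists as a two-sided limit, so even at an endpoint it can be computed from
    increments pointing into the segment, where f is zero. *)
Lemma derive_zero_on_segment (f : R -> R) a b x d : a < b -> a <= x <= b ->
  (forall t, a <= t <= b -> f t = 0) -> is_derive x 1 f d -> d = 0.
Proof.
move=> ab /andP[ax xb] f0 [df dE]; apply/eqP; rewrite -normr_eq0 eq_le normr_ge0 andbT.
apply/ler_addgt0Pr => e e0; rewrite add0r.
move: df; rewrite /derivable => /cvg_ex[l hl].
have dl : d = l by rewrite -dE; exact: cvg_lim hl.
move/cvgrPdist_le : hl => /(_ e e0) [del /= del0 hdel].
pose t := if x < b then Num.min (del / 2) (b - x) else - Num.min (del / 2) (x - a).
have [t0 tdel xt] : [/\ t != 0, `|t| < del & a <= x + t <= b].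
  rewrite /t; case: ifP => [xb'|/negbT]; last first.
    rewrite -leNgt => bx; have xa : a < x by lra.
    set s := Num.min _ _.
    have s0 : 0 < s by rewrite lt_min divr_gt0 //= subr_gt0.
    have s1 : s <= del / 2 by rewrite ge_min lexx.
    have s2 : s <= x - a by rewrite ge_min lexx orbT.
    split; [by rewrite oppr_eq0 gt_eqF|by rewrite normrN ger0_norm; lra|by apply/andP; split; lra].
  set s := Num.min _ _.
  have s0 : 0 < s by rewrite lt_min divr_gt0 //= subr_gt0.
  have s1 : s <= del / 2 by rewrite ge_min lexx.
  have s2 : s <= b - x by rewrite ge_min lexx orbT.
  split; [by rewrite gt_eqF|by rewrite ger0_norm; lra|by apply/andP; split; lra].
have := hdel t; rewrite /ball_ /= sub0r normrN => /(_ tdel t0).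
rewrite (f0 x) ?ax // (_ : t *: 1 + x = x + t); last by rewrite /GRing.scale /= mulr1 addrC.
by rewrite f0 // subrr scaler0 subr0 dl.
Qed.

(** The primitive of h is nondecreasing and is 0 at both ends, hence identically 0, and h is its
    derivative. *)
Lemma Rintegral_continuous_eq0 (h : R -> R) a b : a < b -> {within `[a, b], continuous h} ->
  (forall t, a <= t <= b -> 0 <= h t) -> \int[lebesgue_measure]_(t in `[a, b]) h t = 0 ->
  forall t, a <= t <= b -> h t = 0.
Proof.
move=> ab ch h0 Ih t tab; have [Phi hPhi] := continuous_primitive (ltW ab) ch.
have mono x y : a <= x -> x <= y -> y <= b -> Phi x <= Phi y.
  move=> ax xy yb; rewrite -subr_ge0.
  have dP z : x <= z <= y -> is_derive z 1 Phi (h z).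
    by move=> /andP[h1 h2]; have [] := hPhi z (introT andP (conj (le_trans ax h1) (le_trans h2 yb))).
  have cxy : {within `[x, y], continuous h}.
    apply: continuous_subspaceW ch => z /=; rewrite !in_itv /= => /andP[h1 h2].
    by rewrite (le_trans ax h1) (le_trans h2 yb).
  rewrite -(Rintegral_derivative xy dP cxy); apply: Rintegral_ge0 => z /=; rewrite in_itv /= => /andP[h1 h2].
  by apply: h0; rewrite (le_trans ax h1) (le_trans h2 yb).
have [D _] := hPhi t tab.
apply: (derive_zero_on_segment ab tab _ D) => s /andP[as_ sb].
have [_ Pa0] := hPhi a (introT andP (conj (lexx a) (ltW ab))).
have [_ Pb0] := hPhi b (introT andP (conj (ltW ab) (lexx b))).
have := mono a s (lexx a) as_ sb; have := mono s b as_ sb (lexx b).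
rewrite Pa0 Pb0 Ih Rintegral_point => h1 h2.
by apply/eqP; rewrite eq_le h1 h2.
Qed.

Lemma within_continuous_slice (g : R * R -> R) a b x : a <= x <= b ->
  {within `[a, b] `*` `[a, b], continuous g} -> {within `[a, b], continuous (fun s => g (x, s))}.
Proof.
move=> xab cg; apply/subspace_continuousP => s sab.
have /subspace_continuousP/(_ (x, s)) := cg.
have xs : (`[a, b] `*` `[a, b]) (x, s) by split => //=; rewrite in_itv.
move=> /(_ xs); apply: cvg_trans; apply: cvg_comp; last exact: cvg_id.
move=> U /= [[A B] /= [nA nB] AB].
apply: filterS nB => t Bt tab.
have Ax : A x by exact: nbhs_singleton.
by apply: (AB (x, t)); split => //=; rewrite in_itv.
Qed.

End SegmentIntegrals.

(** * Construction and uniqueness of the Green function *)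

Section GreenFunction.
Context {R : realType}.
Variables (n : nat) (a b : R) (Pa Pb : nat -> {poly R[i]}).
Hypotheses (n_gt1 : (1 < n)%N) (ab : a < b).
Hypothesis sizeP : forall j, (j < n)%N -> (size (Pa j) <= n)%N /\ (size (Pb j) <= n)%N.
Implicit Types (m j : 'I_n) (x s t : R) (f : R -> R[i]).

Local Notation zeta := (@zeta R n).
Local Notation mode := (@mode R n a b).
Local Notation kap := (@kap R n).
Local Notation charmx := (@charmx R n a b Pa Pb).

Let n_gt0 : (0 < n)%N. Proof. exact: ltnW. Qed.

Lemma ode_sol_sub lam f Y Y' : ccont `[a, b] f ->
  ode_sol n a b zero_pot lam f Y -> ode_sol n a b zero_pot lam f Y' ->
  ode_sol n a b zero_pot lam (fun=> 0) (fun k x => Y k x - Y' k x).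
Proof.
move=> cf [cY [iY [_ tY]]] [cY' [iY' [_ tY']]].
have rhsE (g : R -> R[i]) (Z : nat -> R -> R[i]) :
    (fun t => ci ^+ n * (g t + lam * Z 0%N t - \sum_(k < n.-1) zero_pot k t * Z k t)) =
    (fun t => ci ^+ n * (g t + lam * Z 0%N t)).
  by apply/funext => t; rewrite big1 ?subr0 // => k _; rewrite /zero_pot mul0r.
rewrite rhsE in tY; rewrite rhsE in tY'.
have ccN F : ccont `[a, b] F -> ccont `[a, b] (fun t => - F t).
  move=> cF; apply: ccont_eq (ccontM (ccont_cst _ (-1)) cF) => t; by rewrite mulN1r.
have crhs Z : (forall k, (k < n)%N -> ccont `[a, b] (Z k)) ->
    forall g, ccont `[a, b] g -> ccont `[a, b] (fun t => ci ^+ n * (g t + lam * Z 0%N t)).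
  move=> cZ g cg; apply: ccontM; first exact: ccont_cst.
  by apply: ccontD => //; apply: ccontM; [exact: ccont_cst|exact: cZ].
have cintB x F H : x <= b -> ccont `[a, b] F -> ccont `[a, b] H ->
    cint a x (fun t => F t - H t) = cint a x F - cint a x H.
  move=> xb cF cH.
  rewrite cintD; [|exact: ccont_sub cF|by apply: ccont_sub (ccN _ cH)].
  congr (_ + _); rewrite -[RHS]mulN1r -cintZ; last exact: ccont_sub cH.
  by apply: eq_cint => t _; rewrite mulN1r.
have cYY k : (k < n)%N -> ccont `[a, b] (fun t => Y k t - Y' k t).
  by move=> kn; apply: ccontD; [exact: cY|apply: ccN; exact: cY'].
rewrite /ode_sol (rhsE (fun=> 0) (fun k x => Y k x - Y' k x)); split => //; split.
  move=> k kn x xab; rewrite cintB; [|by move: xab; rewrite in_seg => /andP[]|exact: cY|exact: cY'].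
  by rewrite iY // iY' //; ring.
split; first by apply: ccont_cintegrable; exact: (crhs _ cYY _ (ccont_cst _ 0)).
move=> x xab; rewrite (tY x xab) (tY' x xab).
have -> : (fun t => ci ^+ n * (0 + lam * (Y 0%N t - Y' 0%N t))) =
          (fun t => ci ^+ n * (f t + lam * Y 0%N t) - ci ^+ n * (f t + lam * Y' 0%N t)).
  by apply/funext => t; ring.
rewrite cintB; [by ring|by move: xab; rewrite in_seg => /andP[]|exact: crhs|exact: crhs].
Qed.

Lemma bform_sub Y Y' j : bform n Pa Pb a b (fun k x => Y k x - Y' k x) j =
  bform n Pa Pb a b Y j - bform n Pa Pb a b Y' j.
Proof. by rewrite /bform -sumrB; apply: eq_bigr => k _; ring. Qed.

Lemma ode_bvp_unique lam f Y Y' : ccont `[a, b] f -> ~ Defs.eigenvalue n a b zero_pot Pa Pb lam ->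
  ode_sol n a b zero_pot lam f Y -> bc_hold n Pa Pb a b Y ->
  ode_sol n a b zero_pot lam f Y' -> bc_hold n Pa Pb a b Y' ->
  forall x, a <= x <= b -> Y 0%N x = Y' 0%N x.
Proof.
move=> cf nev sY bY sY' bY' x xab; apply/eqP; rewrite -subr_eq0; apply: contrapT => /negP nz.
apply: nev; exists (fun k x => Y k x - Y' k x); split; first exact: ode_sol_sub sY sY'.
split; last by exists x; rewrite in_seg.
move=> j jn; have := bform_sub Y Y' (Ordinal jn) => /= ->.
by rewrite bY // bY' // subrr.
Qed.

Variables (u lam : R[i]) (neg : 'I_n -> bool).
Hypotheses (u0 : u != 0) (ulam : u ^+ n = ci ^+ n * lam).

Definition danchor m : R := if neg m then b else a.
(** Exponential in the second variable of the kernel, with the sign reversed and measured from the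
    endpoint opposite to [anchor], so that it too is at most 1 in modulus when [neg] follows the
    sign of the real parts. *)
Definition dmode m x : R[i] := cexp (kap u m * cR (danchor m - x)).
(** This is i^n / (n kap^(n-1)), the residue of i^n / (z^n - u^n) at the m-th exponent, written with
    kap^n = u^n. *)
Definition vcoef m : R[i] := ci ^+ n * kap u m / (n%:R * u ^+ n).

Definition dualmx : 'M[R[i]]_n :=
  \matrix_(i < n, m < n) ((if neg m then (Pb i).[kap u m] else - (Pa i).[kap u m]) / u ^+ border Pa Pb i).

Definition gcoef j m : R[i] := - (invmx (charmx neg u) *m dualmx) j m * vcoef m.

Definition volterra x : R[i] := \sum_m vcoef m * cexp (kap u m * cR (x - 0)).

(* The Volterra kernel of variation of constants with the growing exponentials moved to the other
   side of the diagonal, plus the correction that restores the boundary conditions. *)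
Definition greenk x s : R[i] :=
  volterra (Num.max (x - s) 0) - \sum_(m | ~~ neg m) vcoef m * cexp (kap u m * cR (x - s)) +
  \sum_j \sum_m gcoef j m * mode neg u j x * dmode m s.

Lemma zeta_power_sum k : (0 < k < n)%N -> \sum_(m < n) (zeta ^+ m) ^+ k = 0.
Proof.
move=> kn; have z1 : zeta ^+ k != 1 by exact: zetaX_neq1.
under eq_bigr do rewrite -exprM mulnC exprM.
apply: (@mulfI _ (zeta ^+ k - 1)); first by rewrite subr_eq0.
by rewrite mulr0 -subrX1 -exprM mulnC exprM zetaXn // expr1n subrr.
Qed.

(** Power sums of the n-th roots of unity vanish unless n divides the exponent. In terms of
    [volterra]: at 0 its derivatives up to order n - 2 vanish and the one of order n - 1 is i^n, so
    it is the fundamental solution. *)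
Lemma vcoef_sum k : (k < n)%N -> \sum_m vcoef m * kap u m ^+ k = if k == n.-1 then ci ^+ n else 0.
Proof.
move=> kn.
have E m : vcoef m * kap u m ^+ k = ci ^+ n * u ^+ k.+1 / (n%:R * u ^+ n) * (zeta ^+ m) ^+ k.+1.
  rewrite /vcoef -[X in _ = _ * X]mul1r; have -> : ci ^+ n * u ^+ k.+1 / (n%:R * u ^+ n) * (1 * (zeta ^+ m) ^+ k.+1) =
    ci ^+ n / (n%:R * u ^+ n) * (kap u m) ^+ k.+1 by rewrite /kap exprMn; ring.
  by rewrite [in RHS]exprS; ring.
under eq_bigr do rewrite E.
rewrite -mulr_sumr; case: eqP => [->|/eqP kn1].
  rewrite prednK //; under eq_bigr do rewrite -exprM mulnC exprM zetaXn // expr1n.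
  rewrite sumr_const card_ord -[1 *+ n]/(n%:R); field.
  by rewrite expf_neq0 // pnatr_eq0 -lt0n n_gt0.
by rewrite zeta_power_sum ?mulr0 //; clear -kn kn1; lia.
Qed.

Lemma volterra0 : volterra 0 = 0.
Proof.
have := vcoef_sum n_gt0; rewrite (_ : (0%N == n.-1) = false); last by clear -n_gt1; lia.
by move=> E; rewrite -[RHS]E; apply: eq_bigr => m _; rewrite subrr cR0 mulr0 cexp0 expr0.
Qed.

Lemma ccont_cexp_affine (k : R[i]) (x : R) : ccont `[a, b] (fun s => cexp (k * cR (x - s))).
Proof.
apply: ccont_eq (_ : ccont _ (fun s => cexp (- k * cR (s - x)))).
  by move=> s; rewrite -[in RHS](opprB s x) cRN mulrN mulNr.
by apply: (@cdrv_ccont _ a b _ (fun s => - k * cexp (- k * cR (s - x)))) => s _; exact: cdrv_cexp.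
Qed.

Lemma ccont_volterra x : ccont `[a, b] (fun s => volterra (Num.max (x - s) 0)).
Proof.
have D t : cdrv volterra t (\sum_m vcoef m * (kap u m * cexp (kap u m * cR (t - 0)))).
  by apply: cdrv_sum => m _; apply: cdrvZ; exact: cdrv_cexp.
apply: (ccont_comp (h := fun s => Num.max (x - s) 0) _ D) => s.
apply: (@continuous_max _ _ (fun s => x - s) (fun=> 0)); last exact: cvg_cst.
by apply: cvgB; [exact: cvg_cst|exact: cvg_id].
Qed.

Lemma ccont_dmode m : ccont `[a, b] (dmode m).
Proof. exact: ccont_cexp_affine. Qed.

Lemma ccont_greenk x : ccont `[a, b] (greenk x).
Proof.
apply: ccontD; last first.
  apply: ccont_sum => j _; apply: ccont_sum => m _.
  by apply: ccontM; [exact: ccont_cst|exact: ccont_dmode].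
apply: ccontD; first exact: ccont_volterra.
apply: ccont_eq (_ : ccont _ (fun s => \sum_(m | ~~ neg m) - vcoef m * cexp (kap u m * cR (x - s)))).
  by move=> s; rewrite -sumrN; apply: eq_bigr => m _; rewrite mulNr.
by apply: ccont_sum => m _; apply: ccontM; [exact: ccont_cst|exact: ccont_cexp_affine].
Qed.

Hypothesis charU : charmx neg u \in unitmx.

(** Variation of constants splits over the exponents into first-order equations, each integrated
    from its own anchor; a combination of exponentials, obtained by inverting the characteristic
    matrix, then restores the boundary conditions. *)
Lemma greenk_solves f : ccont `[a, b] f -> exists Y : nat -> R -> R[i],
  [/\ ode_sol n a b zero_pot lam f Y, bc_hold n Pa Pb a b Y &
      forall x, a <= x <= b -> Y 0%N x = cint a b (fun s => greenk x s * f s)].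
Proof.
move=> cf.
pose em m t := cexp (kap u m * cR (a - t)).
have cem m : ccont `[a, b] (fun t => em m t * f t).
  by apply: ccontM => //; exact: ccont_cexp_affine.
have /choice[Phi hPhi] : forall m, exists Phi : R -> R[i], forall x, a <= x <= b ->
    cdrv Phi x (em m x * f x) /\ Phi x = cint a x (fun t => em m t * f t).
  by move=> m; exact: (ccont_primitive (ltW ab) (cem m)).
have aab : a <= a <= b by rewrite lexx ltW.
have bab : a <= b <= b by rewrite lexx ltW.
have Phia m : Phi m a = 0 by have [_ ->] := hPhi m a aab; rewrite cint_point.
(* Solution of v' = kap v + f vanishing at the anchor: integration from a for [neg m], from b
   otherwise. At the opposite endpoint it equals D m or -D m, which explains the sign in
   [dualmx]. *)
pose v m x := cexp (kap u m * cR (x - a)) * (Phi m x - (if neg m then 0 else Phi m b)).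
have dv m x : a <= x <= b -> cdrv (v m) x (kap u m * v m x + f x).
  move=> xab; have [dP _] := hPhi m x xab.
  apply: cdrv_eq (cdrvM (cdrv_cexp (kap u m) a x) (cdrvD dP (cdrv_cst (- (if neg m then 0 else Phi m b)) x))) => //.
  rewrite addr0 -mulrA; congr (_ + _); rewrite mulrA -cexpD -mulrDr -cRD.
  by rewrite addrA subrK subrr cR0 mulr0 cexp0 mul1r.
pose D m := cint a b (fun t => dmode m t * f t).
have vb m : v m b = if neg m then D m else 0.
  rewrite /v; case: ifP => nm; last by rewrite subrr mulr0.
  rewrite subr0; have [_ ->] := hPhi m b bab; rewrite -cintZ //.
  apply: eq_cint => t _; rewrite mulrA -cexpD -mulrDr -cRD /dmode /danchor nm.
  by rewrite addrA subrK.
have va m : v m a = if neg m then 0 else - D m.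
  rewrite /v Phia subrr cR0 mulr0 cexp0 mul1r; case: ifP => nm; first by rewrite subrr.
  rewrite sub0r; have [_ ->] := hPhi m b bab; congr (- _).
  by apply: eq_cint => t _; rewrite /dmode /danchor nm.
(* Chosen so that [charmx] applied to C is minus the vector of scaled boundary forms of the
   particular solution [Yp]. *)
pose C j := \sum_m gcoef j m * D m.
pose Yp k x := \sum_m vcoef m * kap u m ^+ k * v m x.
pose Y k x := Yp k x + modes a b C neg u k x.
have dYp k x : (k < n)%N -> a <= x <= b ->
    cdrv (Yp k) x (Yp k.+1 x + (if k == n.-1 then ci ^+ n else 0) * f x).
  move=> kn xab.
  apply: cdrv_eq (cdrv_sum _ (fun m _ => cdrvZ (vcoef m * kap u m ^+ k) (dv m x xab))) => //.
  rewrite -vcoef_sum // mulr_suml -big_split /=; apply: eq_bigr => m _.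
  by rewrite exprSr; ring.
exists Y; split.
- apply: ode_sol_cdrv => // [k kn x xab|x xab].
    apply: cdrv_eq (cdrvD (dYp k x (ltnW kn) xab) (cdrv_modes a b C neg u k x)) => //.
    by rewrite (_ : (k == n.-1) = false) ?mul0r ?addr0 //; lia.
  have pn : (n.-1 < n)%N by rewrite prednK.
  apply: cdrv_eq (cdrvD (dYp n.-1 x pn xab) (cdrv_modes a b C neg u n.-1 x)) => //.
  have mt : modes a b C neg u n x = ci ^+ n * (lam * modes a b C neg u 0 x) by exact: modes_top.
  rewrite eqxx prednK // mt /Y.
  have -> : Yp n x = ci ^+ n * (lam * Yp 0%N x).
    rewrite mulrA -ulam /Yp mulr_sumr; apply: eq_bigr => m _.
    by rewrite kapXn // expr0; ring.
  by ring.
- move=> j jn; have -> : bform n Pa Pb a b Y j =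
      bform n Pa Pb a b Yp j + bform n Pa Pb a b (modes a b C neg u) (Ordinal jn).
    by rewrite /bform -big_split /=; apply: eq_bigr => k _; rewrite /Y; ring.
  set i := Ordinal jn.
  have -> : bform n Pa Pb a b Yp j = u ^+ border Pa Pb j * \sum_m dualmx i m * vcoef m * D m.
    have [s1 s2] := sizeP jn.
    rewrite /bform /Yp; under eq_bigr do rewrite !mulr_sumr -big_split /=.
    rewrite exchange_big /= mulr_sumr; apply: eq_bigr => m _.
    have ub0 : u ^+ border Pa Pb j != 0 by rewrite expf_neq0.
    have -> : u ^+ border Pa Pb j * (dualmx i m * vcoef m * D m) =
        vcoef m * ((Pa j).[kap u m] * v m a + (Pb j).[kap u m] * v m b).
      rewrite mxE va vb /=; case: (neg m); field; exact: ub0.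
    rewrite (horner_coef_wide _ s1) (horner_coef_wide _ s2) !mulr_suml -big_split /= mulr_sumr.
    by apply: eq_bigr => k _; ring.
  rewrite bform_modes //.
  have -> : \sum_m charmx_raw a b Pa Pb neg u i m * C m =
      u ^+ border Pa Pb j * \sum_m charmx neg u i m * C m.
    rewrite mulr_sumr; apply: eq_bigr => m _; rewrite !mxE /=.
    by rewrite mulrA [u ^+ _ * _]mulrC divfK // expf_neq0.
  rewrite -mulrDr.
  have -> : \sum_m charmx neg u i m * C m = - \sum_m dualmx i m * vcoef m * D m.
    rewrite /C; under eq_bigr do rewrite mulr_sumr.
    rewrite exchange_big /= -sumrN; apply: eq_bigr => l _.
    have E : dualmx i l = \sum_m charmx neg u i m * (invmx (charmx neg u) *m dualmx) m l.
      by rewrite -{1}(mulKVmx charU dualmx) mxE.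
    rewrite E !mulr_suml -sumrN; apply: eq_bigr => m _; rewrite /gcoef; ring.
  by rewrite subrr mulr0.
move=> x xab; have /andP[ax xb] := xab.
have -> : (fun s => greenk x s * f s) = (fun s => (volterra (Num.max (x - s) 0) * f s
    + \sum_(m | ~~ neg m) - vcoef m * (cexp (kap u m * cR (x - s)) * f s))
    + \sum_j \sum_m (gcoef j m * mode neg u j x) * (dmode m s * f s)).
  apply/funext => s; rewrite /greenk !mulrDl mulNr; congr (_ + _ + _).
    by rewrite mulr_suml -sumrN; apply: eq_bigr => m _; ring.
  rewrite mulr_suml; apply: eq_bigr => j _; rewrite mulr_suml.
  by apply: eq_bigr => m _; ring.
have cvol : ccont `[a, b] (fun s => volterra (Num.max (x - s) 0) * f s).
  by apply: ccontM => //; exact: ccont_volterra.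
have cexpf m : ccont `[a, b] (fun s => cexp (kap u m * cR (x - s)) * f s).
  by apply: ccontM => //; exact: ccont_cexp_affine.
have cdf m : ccont `[a, b] (fun s => dmode m s * f s).
  by apply: ccontM => //; exact: ccont_dmode.
have cpos : ccont `[a, b] (fun s => \sum_(m | ~~ neg m) - vcoef m * (cexp (kap u m * cR (x - s)) * f s)).
  by apply: ccont_sum => m _; apply: ccontM; [exact: ccont_cst|exact: cexpf].
have cgg : ccont `[a, b] (fun s => \sum_j \sum_m (gcoef j m * mode neg u j x) * (dmode m s * f s)).
  apply: ccont_sum => j _; apply: ccont_sum => m _.
  by apply: ccontM; [exact: ccont_cst|exact: cdf].
rewrite (cintD (ccontD cvol cpos) cgg) (cintD cvol cpos).
have -> : cint a b (fun s => \sum_j \sum_m (gcoef j m * mode neg u j x) * (dmode m s * f s)) =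
    modes a b C neg u 0 x.
  rewrite cint_sum; last first.
    by move=> j _; apply: ccont_sum => m _; apply: ccontM; [exact: ccont_cst|exact: cdf].
  apply: eq_bigr => j _; rewrite cint_sum; last first.
    by move=> m _; apply: ccontM; [exact: ccont_cst|exact: cdf].
  rewrite /C expr0 mulr1 mulr_suml; apply: eq_bigr => m _.
  by rewrite cintZ // /D; ring.
rewrite /Y; congr (_ + _).
have shift m t : cexp (kap u m * cR (x - t)) = cexp (kap u m * cR (x - a)) * em m t.
  by rewrite /em -cexpD -mulrDr -cRD addrA subrK.
have -> : cint a b (fun s => \sum_(m | ~~ neg m) - vcoef m * (cexp (kap u m * cR (x - s)) * f s)) =
    \sum_(m | ~~ neg m) - vcoef m * cexp (kap u m * cR (x - a)) * Phi m b.
  rewrite cint_sum; last by move=> m _; apply: ccontM; [exact: ccont_cst|exact: cexpf].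
  apply: eq_bigr => m _; rewrite cintZ // -mulrA; congr (_ * _).
  have [_ ->] := hPhi m b bab; rewrite -cintZ //.
  by apply: eq_cint => t _; rewrite shift mulrA.
have -> : cint a b (fun s => volterra (Num.max (x - s) 0) * f s) =
    \sum_m vcoef m * cexp (kap u m * cR (x - a)) * Phi m x.
  rewrite (cint_split xab cvol).
  have -> : cint x b (fun s => volterra (Num.max (x - s) 0) * f s) = 0.
    rewrite -[RHS](cint0 x b); apply: eq_cint => s /andP[xs sb].
    by rewrite max_r ?volterra0 ?mul0r // subr_le0.
  rewrite addr0.
  have cemx m : ccont `[a, x] (fun t => em m t * f t) by exact: ccont_sub (cem m).
  transitivity (cint a x (fun s => \sum_m vcoef m * cexp (kap u m * cR (x - a)) * (em m s * f s))).
    apply: eq_cint => s /andP[as_ sx]; rewrite max_l ?subr_ge0 // /volterra mulr_suml.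
    by apply: eq_bigr => m _; rewrite subr0 shift; ring.
  rewrite cint_sum; last by move=> m _; apply: ccontM; [exact: ccont_cst|exact: cemx].
  by apply: eq_bigr => m _; rewrite cintZ //; have [_ ->] := hPhi m x xab.
rewrite /Yp [X in _ + X]big_mkcond /= -big_split /=; apply: eq_bigr => m _.
by rewrite /v expr0 mulr1; case: (neg m) => /=; ring.
Qed.

(** Both kernels represent the unique solution for every continuous f. Taking for f the complex
    conjugate of their difference in the second variable makes the integral of its squared modulus
    zero, and continuity finishes. *)
Lemma green0_unique (G : R -> R -> R[i] -> R[i]) : green0 n a b Pa Pb G ->
  ~ Defs.eigenvalue n a b zero_pot Pa Pb lam ->
  forall x s, a <= x <= b -> a <= s <= b -> G x s lam = greenk x s.
Proof.
move=> gG nev x s xab sab; have [[cG1 cG2] gs] := gG lam nev.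
have cGx : ccont `[a, b] (fun t => G x t lam).
  split; first exact: (within_continuous_slice xab cG1).
  exact: (within_continuous_slice xab cG2).
pose H t := G x t lam - greenk x t.
have cH : ccont `[a, b] H.
  apply: ccontD => //; apply: ccont_eq (ccontM (ccont_cst _ (-1)) (ccont_greenk x)) => t.
  by rewrite mulN1r.
pose f t : R[i] := (Rec (H t) +i* - Imc (H t))%C.
have cf : ccont `[a, b] f.
  by case: cH => h1 h2; split => //=; exact: within_continuousN.
have [Y [sY [bY Y0]]] := gs f cf.
have [Z [sZ bZ Z0]] := greenk_solves cf.
have := ode_bvp_unique cf nev sY bY sZ bZ xab.
rewrite Y0 ?in_seg // Z0 // => E.
have HfE t : H t * f t = cR (Rec (H t) ^+ 2 + Imc (H t) ^+ 2).
  by apply: ceqP; rewrite ?RecM ?ImcM /= ?expr2; ring.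
have I0 : cint a b (fun t => H t * f t) = 0.
  transitivity (cint a b (fun t => G x t lam * f t) + cint a b (fun t => - 1 * (greenk x t * f t))).
    rewrite -cintD; first by apply: eq_cint => t _; rewrite /H; ring.
      exact: ccontM.
    by apply: ccontM; [exact: ccont_cst|apply: ccontM => //; exact: ccont_greenk].
  rewrite cintZ; last by apply: ccontM => //; exact: ccont_greenk.
  by rewrite E mulN1r subrr.
have := congr1 Rec I0; rewrite /cint /=.
under eq_Rintegral do rewrite HfE Rec_cR.
case: cH => cH1 cH2 Ir.
have cH22 : {within `[a, b], continuous (fun t => Rec (H t) ^+ 2 + Imc (H t) ^+ 2)}.
  by apply: within_continuousD; under [X in {within _, continuous X}]eq_fun do rewrite expr2; exact: within_continuousM.
have /eqP := Rintegral_continuous_eq0 ab cH22 (fun _ _ => addr_ge0 (sqr_ge0 _) (sqr_ge0 _)) Ir sab.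
rewrite paddr_eq0 ?sqr_ge0 // !sqrf_eq0 => /andP[/eqP h1 /eqP h2].
by apply/eqP; rewrite -subr_eq0; apply/eqP; apply: ceqP.
Qed.

End GreenFunction.

(** * The Green function on the diagonal *)

Section GreenDiagonal.
Context {R : realType}.
Variables (n : nat) (a b : R) (Pa Pb : nat -> {poly R[i]}).
Hypotheses (n_gt1 : (1 < n)%N) (ab : a < b).
Hypothesis sizeP : forall j, (j < n)%N -> (size (Pa j) <= n)%N /\ (size (Pb j) <= n)%N.
Implicit Types (m j : 'I_n) (x s t : R).

Local Notation mode := (@mode R n a b).
Local Notation kap := (@kap R n).
Local Notation charmx := (@charmx R n a b Pa Pb).
Local Notation dmode := (@dmode R n a b).
Local Notation gcoef := (@gcoef R n a b Pa Pb).

Let n_gt0 : (0 < n)%N. Proof. exact: ltnW. Qed.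

Definition edge_decay (k x : R) : R := expR (- (k * (x - a))) + expR (- (k * (b - x))).

Lemma cdrv_dmode u neg m x : cdrv (dmode u neg m) x (- kap u m * dmode u neg m x).
Proof.
have E t : cexp (- kap u m * cR (t - danchor a b neg m)) = dmode u neg m t.
  by rewrite /dmode -(opprB t) cRN mulrN mulNr.
by apply: cdrv_eq (cdrv_cexp (- kap u m) (danchor a b neg m) x); rewrite ?E.
Qed.

(** Of two distinct indices at least one is nonzero, and the factor with that index decays at rate
    c|u| from one of the endpoints; the other factor is at most 1. *)
Lemma mode_dmode_decay u neg j m x (c : R) : 0 < c ->
  (forall l, if neg l then Rec (kap u l) <= 0 else 0 <= Rec (kap u l)) ->
  (forall l, val l != 0%N -> c * cabs u <= `|Rec (kap u l)|) ->
  j != m -> a <= x <= b ->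
  cabs (mode neg u j x * dmode u neg m x) <= edge_decay (c * cabs u) x.
Proof.
move=> c0 sgn big jm /andP[ax xb].
have modeE l : cabs (mode neg u l x) = expR (- (`|Rec (kap u l)| * (if neg l then x - a else b - x))).
  rewrite /mode cabs_cexp RecM /= mulr0 subr0 /anchor; congr expR.
  by have := sgn l; case: ifP => _ h; [rewrite ler0_norm|rewrite ger0_norm] => //; ring.
have dmodeE l : cabs (dmode u neg l x) = expR (- (`|Rec (kap u l)| * (if neg l then b - x else x - a))).
  rewrite /dmode cabs_cexp RecM /= mulr0 subr0 /danchor; congr expR.
  by have := sgn l; case: ifP => _ h; [rewrite ler0_norm|rewrite ger0_norm] => //; ring.
have le1 (k y : R) : 0 <= k -> 0 <= y -> expR (- (k * y)) <= 1.
  by move=> k0 y0; rewrite -expR0 ler_expR oppr_le0 mulr_ge0.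
have xa0 : 0 <= x - a by rewrite subr_ge0.
have bx0 : 0 <= b - x by rewrite subr_ge0.
have dec (k : R) (p : bool) : c * cabs u <= k ->
    expR (- (k * (if p then x - a else b - x))) <= edge_decay (c * cabs u) x.
  move=> ck; rewrite /edge_decay; case: p.
    by apply: ler_wpDr; rewrite ?expR_ge0 // ler_expR lerN2 ler_wpM2r.
  by apply: ler_wpDl; rewrite ?expR_ge0 // ler_expR lerN2 ler_wpM2r.
rewrite cabsM modeE dmodeE.
have [j0|j0] := eqVneq (val j) 0%N.
  have m0 : val m != 0%N by apply: contra jm => /eqP m0; apply/eqP/val_inj; rewrite j0 m0.
  apply: le_trans (_ : _ <= 1 * _) _.
    by apply: ler_wpM2r; rewrite ?expR_ge0 //; apply: le1 => //; case: ifP.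
  by rewrite mul1r -if_neg; apply: dec; exact: big.
apply: le_trans (_ : _ <= _ * 1) _.
  by apply: ler_wpM2l; rewrite ?expR_ge0 //; apply: le1 => //; case: ifP.
by rewrite mulr1; apply: dec; exact: big.
Qed.

(** On the diagonal the Volterra part is [volterra 0], which is 0, and the sum over growing
    exponentials is constant in x. In the double sum the terms with j = m are constant too, so only
    products with two distinct indices contribute to the derivative. Multiplying by |u|^n avoids a
    negative power. *)
Lemma green_diagonal_bound (K c : R) : 0 < K -> 0 < c -> exists2 C : R, 0 < C &
  forall (G : R -> R -> R[i] -> R[i]) (u lam : R[i]) (neg : 'I_n -> bool),
    green0 n a b Pa Pb G -> ~ Defs.eigenvalue n a b zero_pot Pa Pb lam ->
    1 <= cabs u -> u ^+ n = ci ^+ n * lam -> charmx neg u \in unitmx ->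
    (forall i j, cabs (invmx (charmx neg u) i j) <= K) ->
    (forall m, if neg m then Rec (kap u m) <= 0 else 0 <= Rec (kap u m)) ->
    (forall m, val m != 0%N -> c * cabs u <= `|Rec (kap u m)|) ->
    exists H H' : R -> R[i],
      [/\ forall x, a <= x <= b -> G x x lam = H x, forall x, cdrv H x (H' x), ccont `[a, b] H' &
          forall x, a <= x <= b ->
            cabs (H' x) * cabs u ^+ n <= C * cabs u ^+ 2 * edge_decay (c * cabs u) x].
Proof.
move=> K0 c0; pose bv := bvnorm n Pa Pb.
have bv1 : 1 <= bv by exact: bvnorm_ge1.
have bv0 : 0 < bv by lra.
have nR : 0 < n%:R :> R by rewrite ltr0n.
(* Bounds an entry of the inverse matrix times [dualmx]; [vcoef] then contributes |u|^(1-n),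
   differentiation a factor at most 2|u|, and the sum has n^2 terms. *)
pose C1 : R := n%:R * (K * bv).
have C10 : 0 < C1 by rewrite /C1 mulr_gt0 // mulr_gt0.
exists (n%:R * (n%:R * (2 * C1))); first by rewrite !mulr_gt0.
move=> G u lam neg gG nev u1 ulam charU invK sgn big.
have u0 : 0 < cabs u by lra.
have un0 : u != 0 by rewrite -cabs_gt0.
pose gc j m : R[i] := gcoef u neg j m.
pose h j m x : R[i] := mode neg u j x * dmode u neg m x.
pose kd j m : R[i] := kap u j - kap u m.
exists (fun x => - (\sum_(m | ~~ neg m) vcoef u m) + \sum_j \sum_m gc j m * h j m x).
exists (fun x => \sum_j \sum_m gc j m * (kd j m * h j m x)).
have dh j m x : cdrv (h j m) x (kd j m * h j m x).
  apply: cdrv_eq (cdrvM (cdrv_mode a b neg u j x) (cdrv_dmode u neg m x)) => //.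
  by rewrite /kd /h; ring.
split.
- move=> x xab; rewrite (green0_unique n_gt1 ab sizeP un0 ulam charU gG nev xab xab) /greenk subrr.
  rewrite maxxx volterra0 // add0r; congr (- _ + _).
    by apply: eq_bigr => m _; rewrite cR0 mulr0 cexp0 mulr1.
  by apply: eq_bigr => j _; apply: eq_bigr => m _; rewrite /gc /h mulrA.
- move=> x; have S := cdrv_sum (index_enum _) (fun j (_ : true) => cdrv_sum (index_enum _)
      (fun m (_ : true) => cdrvZ (gc j m) (dh j m x))).
  by apply: cdrv_eq (cdrvD (cdrv_cst (- (\sum_(m | ~~ neg m) vcoef u m)) x) S) => //; rewrite add0r.
- apply: ccont_sum => j _; apply: ccont_sum => m _; apply: ccontM; first exact: ccont_cst.
  apply: ccontM; first exact: ccont_cst.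
  by apply: (@cdrv_ccont _ a b _ (fun x => kd j m * h j m x)) => x _; exact: dh.
move=> x xab.
have dual_le i m : cabs (dualmx Pa Pb u neg i m) <= bv.
  rewrite mxE; have [s1 s2] := size_border Pa Pb i; have bn := border_ltn n_gt0 sizeP i.
  have z1 := @cabs_zeta R n m.
  have [p1 _] := poly_leading_estimate s1 bn u1 z1; have [q1 _] := poly_leading_estimate s2 bn u1 z1.
  have := bvnorm_le Pa Pb i; have ca := cnorm1_ge0 n (Pa i); have cb := cnorm1_ge0 n (Pb i).
  rewrite -/bv => hb; rewrite /kap; case: ifP => _; first by lra.
  by rewrite mulNr cabsN; lra.
have gc_le j m : cabs (gc j m) * cabs u ^+ n <= C1 * cabs u.
  rewrite /gc /gcoef cabsM cabsN -mulrA; apply: ler_pM; rewrite ?mulr_ge0 ?exprn_ge0 ?cabs_ge0 //.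
    rewrite mxE; apply: le_trans (cabs_sum _ _ _) _.
    rewrite /C1 mulr_natl -[X in _ *+ X](card_ord n) -sumr_const; apply: ler_sum => l _.
    by rewrite cabsM; apply: ler_pM; rewrite ?cabs_ge0.
  rewrite /vcoef !cabsM cabsX cabs_ci expr1n mul1r cabs_zeta mulr1 cabsV cabsM cabsX -cRMn cabs_cR.
  rewrite ger0_norm ?(ltW nR) // invfM -!mulrA mulVf ?mulr1 ?expf_neq0 ?gt_eqF //.
  by rewrite ler_piMr ?(ltW u0) // invf_le1 // ler1n.
have E0 : 0 <= edge_decay (c * cabs u) x by rewrite addr_ge0 // expR_ge0.
have term j m : cabs (gc j m * (kd j m * h j m x)) * cabs u ^+ n <=
    2 * C1 * (cabs u ^+ 2 * edge_decay (c * cabs u) x).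
  have [->|jm] := eqVneq j m.
    by rewrite /kd subrr mul0r mulr0 cabs0 mul0r !mulr_ge0 // ?exprn_ge0 // ltW.
  rewrite cabsM mulrAC cabsM.
  have k1 : cabs (kd j m) <= 2 * cabs u.
    apply: le_trans (cabsB _ _) _; rewrite /kap !cabsM !cabs_zeta; lra.
  have k2 := mode_dmode_decay c0 sgn big jm xab.
  have -> : 2 * C1 * (cabs u ^+ 2 * edge_decay (c * cabs u) x) =
    C1 * cabs u * (2 * cabs u * edge_decay (c * cabs u) x) by ring.
  apply: ler_pM => //; rewrite ?mulr_ge0 ?exprn_ge0 ?cabs_ge0 //.
  by apply: ler_pM => //; rewrite cabs_ge0.
apply: le_trans (_ : (\sum_(j < n) \sum_(m < n) cabs (gc j m * (kd j m * h j m x))) * cabs u ^+ n <= _).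
  apply: ler_wpM2r; first by rewrite exprn_ge0 // cabs_ge0.
  apply: le_trans (cabs_sum _ _ _) _; apply: ler_sum => j _; exact: cabs_sum.
rewrite -!mulrA mulr_natl -[X in _ *+ X](card_ord n) -sumr_const mulr_suml; apply: ler_sum => j _.
rewrite mulr_natl -[X in _ *+ X](card_ord n) -sumr_const mulr_suml; apply: ler_sum => m _.
by apply: (le_trans (term j m)); rewrite /C1 !mulrA.
Qed.

End GreenDiagonal.

(** * Integration by parts against a finite measure *)

Section MeasureByParts.
Context {R : realType}.
Implicit Types (a b x s t : R) (m : {finite_measure set R -> \bar R}).

Lemma fin_measure m (A : set R) : measurable A -> (fine (m A))%:E = m A.
Proof. by move=> mA; rewrite fineK // fin_num_measure. Qed.

Definition cdist m a s : R := fine (m `[a, s]).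

Lemma lebesgue_measure_segment a b : a <= b -> (@lebesgue_measure R `[a, b] = (b - a)%:E)%E.
Proof.
move=> ab; rewrite (lebesgue_measure_itv `[a, b]%R) /= lte_fin; case: ltP => h; first by rewrite EFinB.
by have -> : b - a = 0 by lra.
Qed.

Lemma EFin_Rintegral (d : measure_display) (T : measurableType d) (mu : {measure set T -> \bar R})
    (D : set T) (f : T -> R) : measurable D -> mu.-integrable D (EFin \o f) ->
  (\int[mu]_(x in D) f x)%:E = (\int[mu]_(x in D) (f x)%:E)%E.
Proof. by move=> mD fi; rewrite /Rintegral fineK //; exact: integrable_fin_num. Qed.

Lemma within_continuous_bounded (f : R -> R) a b : a <= b -> {within `[a, b], continuous f} ->
  exists2 M : R, 0 < M & forall x, a <= x <= b -> `|f x| <= M.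
Proof.
move=> ab cf; have [c _ hc] := EVT_max ab cf; have [d _ hd] := EVT_min ab cf.
exists (`|f c| + `|f d| + 1); first by rewrite ltr_wpDl // addr_ge0.
move=> x xab; have xI : x \in `[a, b]%R by rewrite in_itv.
have h1 := hc x xI; have h2 := hd x xI.
rewrite ler_norml; have := ler_norm (f c); have := ler_norm (- f d); rewrite normrN.
have := normr_ge0 (f c); have := normr_ge0 (f d) => ? ? ? ?.
by apply/andP; split; lra.
Qed.

Lemma continuous_measure_integrable m (f : R -> R) a b : a <= b -> {within `[a, b], continuous f} ->
  m.-integrable `[a, b] (EFin \o f).
Proof.
move=> ab cf; have [M M0 fM] := within_continuous_bounded ab cf.
apply: measurable_bounded_integrable => //.
- by rewrite ltey_eq fin_num_measure.
- exact: measurable_realfun.subspace_continuous_measurable_fun.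
exists M; split; first exact: num_real.
by move=> y My x /=; rewrite in_itv /= => /fM h; apply: le_trans h _; exact: ltW.
Qed.

(** Fubini's theorem for h'(s) on the triangle a <= x <= s <= b: integrating first in x gives h'(s)
    m([a,s]), first in s gives h(b) - h(x). *)
Lemma measure_by_parts m (h h' : R -> R) a b : a < b ->
  (forall x, a <= x <= b -> is_derive x 1 h (h' x)) -> {within `[a, b], continuous h'} ->
  lebesgue_measure.-integrable `[a, b] (EFin \o (fun s => h' s * cdist m a s)) /\
  \int[m]_(x in `[a, b]) h x =
    h b * fine (m `[a, b]) - \int[lebesgue_measure]_(s in `[a, b]) (h' s * cdist m a s).
Proof.
move=> ab hh' ch'; have ab' := ltW ab.
have ch : {within `[a, b], continuous h}.
  apply: continuous_in_subspaceT => x; rewrite in_seg => /hh'[dh _].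
  exact: derivable1_continuous.
have [M M0 hM] := within_continuous_bounded ab' ch'.
pose g t := h' (clamp a b t).
have cg : continuous g by exact: continuous_comp_clamp.
have gM t : `|g t| <= M by rewrite hM // clamp_in.
pose D : set (R * R) := `[a, b] `*` `[a, b].
have mD : measurable D by exact: measurableX.
(* The first coordinate is the Lebesgue variable s, the second the variable x of m; the clamped
   derivative makes the function measurable on the whole plane. *)
pose F0 (p : R * R) : R := if p.2 <= p.1 then g p.1 else 0.
have mg : measurable_fun setT g by exact: measurable_realfun.continuous_measurable_fun.
have mF0 : measurable_fun [set: R * R] F0.
  apply: measurable_fun_ifT.
  - exact: measurable_realfun.measurable_fun_ler measurable_snd measurable_fst.
  - exact: measurableT_comp mg measurable_fst.
  exact: measurable_cst.
pose mu := (@lebesgue_measure R \x m)%E.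
have muD : (mu D < +oo)%E.
  rewrite /mu /D product_measure1E //.
  rewrite [X in (X * _)%E](_ : _ = (b - a)%:E); last exact: lebesgue_measure_segment.
  rewrite [X in (_ * X)%E](_ : _ = (cdist m a b)%:E); last by rewrite /cdist fin_measure.
  by rewrite -EFinM ltry.
have F0D : mu.-integrable D (EFin \o F0).
  apply: measurable_bounded_integrable => //; first exact: measurable_funS mF0.
  exists M; split; first exact: num_real.
  move=> y My p _ /=; rewrite /F0; case: ifP => _; last by rewrite normr0 (le_trans (ltW M0)) // ltW.
  by apply: le_trans (gM _) _; exact: ltW.
pose F : R * R -> \bar R := (EFin \o F0) \_ D.
have FI : mu.-integrable setT F := proj1 (@integrable_mkcond _ _ _ mu D (EFin \o F0) mD) F0D.
have FE s x : F (s, x) = if (a <= s <= b) && (a <= x <= s) then (h' s)%:E else 0%E.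
  rewrite /F patchE; case: ifPn => [|].
    rewrite inE => -[/=]; rewrite !in_itv /= => sab /andP[ax xb].
    rewrite sab ax /= /F0 /=; case: ifP => // xs.
    by rewrite /g clamp_id.
  rewrite notin_setE => nD; case: ifP => // /andP[/andP[as_ sb] /andP[ax xs]]; case: nD.
  by split; rewrite /= in_itv /= ?as_ ?ax //= (le_trans xs).
pose q s := h' s * cdist m a s.
have innerx s : (\int[m]_x F (s, x))%E = ((EFin \o q) \_ `[a, b]) s.
  rewrite patchE; case: ifPn => [|]; rewrite ?notin_setE ?inE /= in_itv /= => sab.
    rewrite /q /cdist EFinM fin_measure // -integral_cst // [in RHS]integral_mkcond.
    apply: eq_integral => x _; rewrite FE sab /= patchE mem_setE in_itv /=.
    by case: ifP.
  transitivity (\int[m]_x (0 : \bar R))%E; last by rewrite integral0.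
  by apply: eq_integral => x _; rewrite FE; case: ifP => // /andP[].
have inners x : (\int[lebesgue_measure]_s F (s, x))%E = ((EFin \o (fun x => h b - h x)) \_ `[a, b]) x.
  rewrite patchE; case: ifPn => [|]; rewrite ?notin_setE ?inE /= in_itv /= => xab.
    have /andP[ax xb] := xab.
    have cx : {within `[x, b], continuous h'}.
      by apply: continuous_subspaceW ch' => t /=; rewrite !in_itv /= => /andP[h1 ->]; rewrite (le_trans ax).
    have dx t : x <= t <= b -> is_derive t 1 h (h' t).
      by move=> /andP[h1 h2]; apply: hh'; rewrite (le_trans ax).
    rewrite -(Rintegral_derivative xb dx cx).
    rewrite EFin_Rintegral //; last by apply: continuous_compact_integrable => //; exact: segment_compact.
    rewrite [in RHS]integral_mkcond; apply: eq_integral => s _.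
    rewrite FE patchE mem_setE in_itv /= ax /=.
    by case: (leP x s) => xs; rewrite ?andbF //= andbT (le_trans ax xs).
  transitivity (\int[lebesgue_measure]_s (0 : \bar R))%E; last by rewrite integral0.
  apply: eq_integral => s _; rewrite FE; case: ifP => // /andP[/andP[_ sb] /andP[ax xs]].
  by case: xab; rewrite ax (le_trans xs).
have qI : lebesgue_measure.-integrable `[a, b] (EFin \o q).
  have mI : measurable (`[a, b] : set R) by exact: measurable_itv.
  apply: (proj2 (@integrable_mkcond _ _ _ (@lebesgue_measure R) `[a, b] (EFin \o q) mI)).
  have := integrable_fubini_F FI; apply: eq_integrable => // s _.
  by rewrite /fubini_F innerx.
split => //.
have := Fubini FI.
under eq_integral do rewrite innerx.
under [in RHS]eq_integral do rewrite inners.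
rewrite -!integral_mkcond => E.
have hI := continuous_measure_integrable m ab' ch.
have cI : m.-integrable `[a, b] (EFin \o cst (h b)).
  by apply: continuous_measure_integrable => // x; exact: cvg_cst.
have : \int[lebesgue_measure]_(s in `[a, b]) q s = \int[m]_(x in `[a, b]) (h b - h x).
  by rewrite /Rintegral E.
rewrite RintegralB // Rintegral_cst // => ->; ring.
Qed.

(** Equal total masses cancel the boundary terms at b, and only h' times the difference of the
    distribution functions is left. *)
Lemma rmint_le (m1 m2 : {finite_measure set R -> \bar R}) (h h' B : R -> R) a b : a < b ->
  (forall x, a <= x <= b -> is_derive x 1 h (h' x)) -> {within `[a, b], continuous h'} ->
  fine (m1 `[a, b]) = fine (m2 `[a, b]) -> {within `[a, b], continuous B} ->
  (forall s, a <= s <= b -> `|h' s| * `|cdist m1 a s - cdist m2 a s| <= B s) ->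
  `|rmint m1 m2 `[a, b] h| <= \int[lebesgue_measure]_(s in `[a, b]) B s.
Proof.
move=> ab hh' ch' m12 cB hB.
have [I1 E1] := measure_by_parts m1 ab hh' ch'.
have [I2 E2] := measure_by_parts m2 ab hh' ch'.
rewrite /rmint E1 E2 m12.
set X1 := \int[lebesgue_measure]_(s in _) _; set X2 := \int[lebesgue_measure]_(s in _) _.
have -> : h b * fine (m2 `[a, b]) - X1 - (h b * fine (m2 `[a, b]) - X2) = - (X1 - X2) by ring.
rewrite normrN /X1 /X2 -RintegralB //.
have I12 : lebesgue_measure.-integrable `[a, b]
    (EFin \o (fun s => h' s * cdist m1 a s - h' s * cdist m2 a s)).
  by apply: eq_integrable (integrableB _ I1 I2) => // s _; rewrite /= EFinB.
apply: le_trans (le_normr_Rintegral _ I12) _ => //.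
apply: le_Rintegral => //.
- by apply: eq_integrable (integrable_abse I12).
- by apply: continuous_compact_integrable => //; exact: segment_compact.
by move=> s /=; rewrite in_itv /= => /hB; rewrite -mulrBr normrM.
Qed.

End MeasureByParts.

(** * Exponential decay from the endpoints *)

Section EdgeEstimate.
Context {R : realType}.
Implicit Types (a b x s t k : R).

(** Half of the decay rate is spent on absorbing the factor t through e^y >= 1 + y. For t^2 the same
    is done with y = kt/4, squared, whence the constant 16. *)
Lemma mulr_expRN_le (k t : R) : 0 < k -> 0 <= t -> t * expR (- (k * t)) <= 2 / k * expR (- (k / 2 * t)).
Proof.
move=> k0 t0; have -> : - (k * t) = - (k / 2 * t) - k / 2 * t by field.
rewrite expRD mulrCA [leRHS]mulrC ler_wpM2l ?expR_ge0 //.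
rewrite expRN ler_pdivrMr ?expR_gt0 //.
have k20 : 0 <= 2 / k by apply: divr_ge0 => //; exact: ltW.
have := ler_wpM2l k20 (expR_ge1Dx (k / 2 * t)).
have -> : 2 / k * (1 + k / 2 * t) = 2 / k + t by field; rewrite gt_eqF.
lra.
Qed.

Lemma sqr_expRN_le (k t : R) : 0 < k -> 0 <= t -> t ^+ 2 * expR (- (k * t)) <= 16 / k ^+ 2 * expR (- (k / 2 * t)).
Proof.
move=> k0 t0; have -> : - (k * t) = - (k / 2 * t) - k / 2 * t by field.
rewrite expRD mulrCA [leRHS]mulrC ler_wpM2l ?expR_ge0 //.
rewrite expRN ler_pdivrMr ?expR_gt0 //.
have -> : k / 2 * t = 2%:R * (k / 4 * t) by field.
rewrite expRM_natl.
have -> : 16 / k ^+ 2 * expR (k / 4 * t) ^+ 2 = (4 / k * expR (k / 4 * t)) ^+ 2 by field; rewrite gt_eqF.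
have k40 : 0 <= 4 / k by apply: divr_ge0 => //; exact: ltW.
apply: lerXn2r; rewrite ?nnegrE //; first by apply: mulr_ge0 => //; exact: expR_ge0.
have := ler_wpM2l k40 (expR_ge1Dx (k / 4 * t)).
have -> : 4 / k * (1 + k / 4 * t) = 4 / k + t by field; rewrite gt_eqF.
lra.
Qed.

Lemma edge_decay_integral a b k : a < b -> 0 < k ->
  {within `[a, b], continuous (edge_decay a b k)} /\
  \int[lebesgue_measure]_(s in `[a, b]) edge_decay a b k s <= 2 / k.
Proof.
move=> ab k0; pose P s : R := - (expR (- (k * (s - a))) / k) + expR (- (k * (b - s))) / k.
have D1 s : is_derive s 1 (fun s => expR (- (k * (s - a)))) (- k * expR (- (k * (s - a)))).
  apply: is_derive_congr (is_derive1_comp (is_derive_expR _) (is_derive_affine (- k) a s)).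
    by move=> t /=; rewrite mulNr.
  by rewrite /GRing.scale /= mulNr mulrC.
have D2 s : is_derive s 1 (fun s => expR (- (k * (b - s)))) (k * expR (- (k * (b - s)))).
  apply: is_derive_congr (is_derive1_comp (is_derive_expR _) (is_derive_affine k b s)).
    by move=> t /=; congr expR; ring.
  by rewrite /GRing.scale /= mulrC; congr (_ * expR _); ring.
have DP s : a <= s <= b -> is_derive s 1 P (edge_decay a b k s).
  move=> _; apply: is_derive_congr (is_deriveD (is_deriveM (is_derive_cst (- k^-1) s 1) (D1 s))
                                     (is_deriveM (is_derive_cst k^-1 s 1) (D2 s))).
    move=> t; transitivity (- k^-1 * expR (- (k * (t - a))) + k^-1 * expR (- (k * (b - t)))) => //.
    by rewrite /P; field; rewrite gt_eqF.
  by rewrite /= /GRing.scale /= /edge_decay; field; rewrite gt_eqF.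
have cE : {within `[a, b], continuous (edge_decay a b k)}.
  apply: continuous_subspaceT => s.
  have c1 : {for s, continuous (fun s => expR (- (k * (s - a))))}.
    by apply: derivable1_continuous; case: (D1 s).
  have c2 : {for s, continuous (fun s => expR (- (k * (b - s))))}.
    by apply: derivable1_continuous; case: (D2 s).
  exact: cvgD c1 c2.
split => //; rewrite (Rintegral_derivative (ltW ab) DP cE) /P !subrr !mulr0 !oppr0 expR0.
have := expR_ge0 (- (k * (b - a))); set e := expR _ => e0.
have ek : 0 <= e / k by rewrite divr_ge0 // ltW.
have -> : 2 / k = 1 / k + 1 / k by field; rewrite gt_eqF.
lra.
Qed.

(** Both majorants hold on the whole segment, so each summand of [edge_decay] can be paired with the
    majorant measured from its own endpoint. The factors 2/k and 16/k^2 absorb the polynomials, and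
    integrating the remaining decay of rate k/2 gives 4/k. *)
Lemma rmint_edge_estimate (m1 m2 : {finite_measure set R -> \bar R}) (h h' : R -> R) a b (P e K k : R) :
  a < b -> 0 <= P -> 0 <= e -> 0 <= K -> 0 < k ->
  (forall x, a <= x <= b -> is_derive x 1 h (h' x)) -> {within `[a, b], continuous h'} ->
  (forall s, a <= s <= b -> `|h' s| <= P * edge_decay a b k s) ->
  fine (m1 `[a, b]) = fine (m2 `[a, b]) ->
  (forall s, a <= s <= b -> `|cdist m1 a s - cdist m2 a s| <= e * (s - a) + K * (s - a) ^+ 2) ->
  (forall s, a <= s <= b -> `|cdist m1 a s - cdist m2 a s| <= e * (b - s) + K * (b - s) ^+ 2) ->
  `|rmint m1 m2 `[a, b] h| <= P * (e * (2 / k) + K * (16 / k ^+ 2)) * (4 / k).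
Proof.
move=> ab P0 e0 K0 k0 hh' ch' hP m12 Qa Qb.
have k20 : 0 < k / 2 by rewrite divr_gt0.
have [cE IE] := edge_decay_integral ab k20.
pose W := P * (e * (2 / k) + K * (16 / k ^+ 2)).
have W0 : 0 <= W.
  by apply: mulr_ge0 => //; apply: addr_ge0; apply: mulr_ge0 => //; apply: divr_ge0 => //; [exact: ltW|exact: sqr_ge0].
have cWE : {within `[a, b], continuous (fun s => W * edge_decay a b (k / 2) s)}.
  by apply: within_continuousM => // s; exact: cvg_cst.
have edge t : 0 <= t -> expR (- (k * t)) * (e * t + K * t ^+ 2) <=
    (e * (2 / k) + K * (16 / k ^+ 2)) * expR (- (k / 2 * t)).
  move=> t0; have h1 := ler_wpM2l e0 (mulr_expRN_le k0 t0); have h2 := ler_wpM2l K0 (sqr_expRN_le k0 t0).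
  have := lerD h1 h2.
  rewrite [X in X <= _ -> _](_ : _ = expR (- (k * t)) * (e * t + K * t ^+ 2)); last by ring.
  by rewrite [X in _ <= X -> _](_ : _ = (e * (2 / k) + K * (16 / k ^+ 2)) * expR (- (k / 2 * t))); last by ring.
apply: le_trans (rmint_le ab hh' ch' m12 cWE _) _.
  move=> s sab; have /andP[as_ sb] := sab.
  have sa0 : 0 <= s - a by rewrite subr_ge0.
  have bs0 : 0 <= b - s by rewrite subr_ge0.
  set Q := `|_ - _|; have Q0 : 0 <= Q by exact: normr_ge0.
  apply: (@le_trans _ _ (P * edge_decay a b k s * Q)); first by apply: ler_wpM2r => //; exact: hP.
  rewrite -mulrA /W -[leRHS]mulrA; apply: ler_wpM2l => //; rewrite /edge_decay [leLHS]mulrDl [leRHS]mulrDr; apply: lerD.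
    by apply: le_trans (edge _ sa0); apply: ler_wpM2l; [exact: expR_ge0|exact: Qa].
  by apply: le_trans (edge _ bs0); apply: ler_wpM2l; [exact: expR_ge0|exact: Qb].
rewrite RintegralZl //; last by apply: continuous_compact_integrable => //; exact: segment_compact.
apply: ler_wpM2l => //; apply: le_trans IE _.
by have -> : 2 / (k / 2) = 4 / k by field; rewrite gt_eqF.
Qed.

(** Stated for arbitrary f, so that no regularity of the contour integrand in the parameter has to
    be established. The integral of a nonnegative function is a supremum over simple functions below
    it, hence monotone in any case; positive and negative parts are compared with the constant e
    separately. *)
Lemma Rintegral_abs_le (f : R -> R) a b (e : R) : a <= b -> 0 <= e ->
  (forall x, a <= x <= b -> `|f x| <= e) ->
  `|\int[lebesgue_measure]_(x in `[a, b]) f x| <= e * (b - a).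
Proof.
move=> ab e0 fe.
have bound (g : R -> \bar R) : (forall x, (a <= x <= b)%R -> 0 <= g x <= e%:E)%E ->
    (0 <= \int[lebesgue_measure]_(x in `[a, b]) g x <= (e * (b - a))%:E)%E.
  move=> hg; have gD x : (0 <= (g \_ `[a, b]) x <= (cst e%:E \_ `[a, b]) x)%E.
    rewrite !patchE; case: ifPn => [|_]; last by rewrite lexx.
    by rewrite inE /= in_itv /= => /hg.
  apply/andP; split.
    by apply: integral_ge0 => x /=; rewrite in_itv /= => /hg/andP[].
  have lenE : (e * (b - a))%:E = (\int[lebesgue_measure]_(x in `[a, b]) cst e%:E x)%E.
    rewrite integral_cst // EFinM; congr (_ * _)%E; apply/esym; exact: lebesgue_measure_segment.
  rewrite lenE integral_mkcond [leRHS]integral_mkcond ge0_integralTE; last by move=> x; case/andP: (gD x).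
  rewrite ge0_integralTE; last first.
    by move=> x; case/andP: (gD x) => h1 h2; exact: le_trans h2.
  apply: le_ereal_sup => _ [h /= hh <-]; exists h => //= x.
  by apply: le_trans (hh x) _; case/andP: (gD x).
rewrite /Rintegral integralE.
have fp : (0 <= \int[lebesgue_measure]_(x in `[a, b]) (EFin \o f)^\+ x <= (e * (b - a))%:E)%E.
  apply: bound => x /fe h; rewrite funeposE le_max lexx orbT /= ge_max !lee_fin e0 andbT.
  exact: le_trans (ler_norm _) h.
have fn : (0 <= \int[lebesgue_measure]_(x in `[a, b]) (EFin \o f)^\- x <= (e * (b - a))%:E)%E.
  apply: bound => x /fe h; rewrite funenegE le_max lexx orbT /= ge_max !lee_fin e0 andbT.
  by rewrite (le_trans (ler_norm _)) // normrN.
move: fp fn; set X := (\int[_]_(x in _) _ x)%E; set Y := (\int[_]_(x in _) _ x)%E.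
case: X => [x||] //=; case: Y => [y||] //=; rewrite ?lee_fin => /andP[h1 h2] /andP[h3 h4] //.
by rewrite ler_norml; apply/andP; split; lra.
Qed.

End EdgeEstimate.

(** * Geometry of the contours *)

Section Contours.
Context {R : realType}.
Implicit Types (x y t v s : R) (z w : R[i]).

Lemma abs_atan_le x : `|atan x| <= `|x|.
Proof.
have := @lipschitz_between R atan (fun t => (1 + t ^+ 2)^-1) 1 0 x.
rewrite atan0 !subr0 mul1r; apply => t _.
rewrite ger0_norm ?invr_ge0 ?addr_ge0 ?sqr_ge0 //.
by rewrite invf_le1 ?lerDl ?sqr_ge0 // ltr_pwDl // sqr_ge0.
Qed.

(** The angle is the arctangent of Im z / (1 + Re z), legitimate as 1 + Re z >= 1/2, and |atan x| <=
    |x| bounds it. *)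
Lemma polar_near_one z : cabs z <= 2^-1 ->
  exists s v, [/\ 0 < s, `|v| <= 2 * cabs z & 1 + z = cR s * expi v].
Proof.
move=> z2; pose X := 1 + Rec z; pose v := atan (Imc z / X).
have rz := le_Rec_cabs z; have iz := le_Imc_cabs z.
have X2 : 2^-1 <= X.
  by move: rz; rewrite ler_norml => /andP[h1 _]; rewrite /X; lra.
have X0 : 0 < X by lra.
have cv : 0 < cos v.
  by rewrite cos_atan invr_gt0 sqrtr_gt0 ltr_pwDl // sqr_ge0.
have tv : sin v = Imc z / X * cos v.
  by rewrite -(atanK (Imc z / X)) -/v /tan divfK // gt_eqF.
exists (X / cos v), v; split; first by rewrite divr_gt0.
  apply: le_trans (abs_atan_le _) _; rewrite normrM [`|X^-1|]ger0_norm ?invr_ge0 ?(ltW X0) //.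
  rewrite ler_pdivrMr // mulrAC; apply: le_trans iz _.
  have : cabs z * 1 <= cabs z * (2 * X) by rewrite ler_wpM2l ?cabs_ge0 //; lra.
  by rewrite mulr1 mulrA [cabs z * 2]mulrC mulrAC.
apply: ceqP; rewrite ?RecD ?ImcD ?RecM ?ImcM /= ?mul0r ?subr0 ?addr0 ?add0r.
  by rewrite divfK ?gt_eqF.
by rewrite tv; field; rewrite !gt_eqF.
Qed.

Lemma expi_cperiod n : (0 < n)%N -> expi (cperiod n : R) ^+ n = 1.
Proof. by move=> n0; rewrite -expiMn /cperiod mulrCA divff ?pnatr_eq0 -?lt0n // mulr1 expi_2pi. Qed.

Lemma cperiod_gt0 n : (0 < n)%N -> 0 < cperiod n :> R.
Proof. by move=> n0; rewrite /cperiod divr_gt0 ?mulr_gt0 ?pi_gt0 ?ltr0n. Qed.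

Lemma Gam_increment (r : R -> R) (K x y : R) : 0 <= r y ->
  `|r x - r y| <= K * `|x - y| ->
  cabs (Gam r x - Gam r y) <= (K + 2 * r y) * `|x - y|.
Proof.
move=> ry rxy; have -> : Gam r x - Gam r y = cR (r x - r y) * expi x + cR (r y) * (expi x - expi y).
  by rewrite /Gam cRB; ring.
apply: le_trans (cabsD _ _) _; rewrite !cabsM cabs_expi mulr1 !cabs_cR (ger0_norm ry) mulrDl lerD //.
by rewrite -mulrA [leRHS]mulrCA ler_wpM2l // cabs_expiB.
Qed.

(** If z is close to the contour and z^n is an eigenvalue, then z is the branch root unless its
    argument leaves [0, 2 pi / n). In that case a rotation by 2 pi / n gives the branch root, and
    since the radius agrees at both ends this root is close to the other end of the contour. *)
Lemma contour_separation n a b p Pa Pb (rr : nat -> R -> R) : (0 < n)%N ->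
  acceptable n a b p Pa Pb rr ->
  exists d r0 : R, 0 < d /\ forall l t, 0 <= t <= cperiod n -> r0 <= rr l t ->
    forall z, cabs (z - Gam (rr l) t) <= d -> ~ Defs.eigenvalue n a b zero_pot Pa Pb (z ^+ n).
Proof.
move=> n0 [sm [_ [[c1 [c2 [c10 [c20 bnd]]]] [del [del0 sep]]]]].
set T := cperiod n in bnd sep *; have T0 : 0 < T := cperiod_gt0 n0.
have T00 : 0 <= T by exact: ltW.
(* Moving to the end of the contour costs at most (3 c2 + 2) 2d, and the distance from z another d;
   the sum (6 c2 + 5) d stays below [del]. *)
pose d := del / (6 * c2 + 6).
have q0 : 0 < 6 * c2 + 6 by lra.
have d0 : 0 < d by rewrite divr_gt0.
have dE : d * (6 * c2 + 6) = del by rewrite divfK // gt_eqF.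
have dc : 0 < d * c2 by rewrite mulr_gt0.
(* The summand c1 makes all radii on the contour at most 3 times the one at t, 2d keeps the relative
   displacement below 1/2, and 2d/T keeps the angular displacement below one period. *)
exists d, (c1 + 2 * d + 2 * d / T + 1); split=> // l t tT rt z zd ev.
have td0 : 0 < 2 * d / T by rewrite divr_gt0 // mulr_gt0.
set r := rr l in rt zd.
have rt0 : 0 < r t by lra.
have inT x : 0 <= x <= T -> x \in (`[0, T] : set R) by rewrite in_seg.
have [_ [dr [_ [r0T _]]]] := sm l; rewrite -/T -/r in dr r0T.
have rbnd x : 0 <= x <= T -> `|r x - r 0| <= c1 /\ `|derive1 r x| <= c2 * r x.
  by move=> /inT; exact: bnd.
have r3 x : 0 <= x <= T -> r x <= 3 * r t.
  move=> xT; have [+ _] := rbnd x xT; have [+ _] := rbnd t tT.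
  rewrite !ler_norml => /andP[h1 h2] /andP[h3 h4]; lra.
have lip x y : 0 <= x -> x <= y -> y <= T -> `|r y - r x| <= 3 * c2 * r t * (y - x).
  move=> x0 xy yT; apply: (bounded_derivative_lipschitz (df := derive1 r)) => // s /andP[h1 h2].
    have sT : 0 <= s <= T by rewrite (le_trans x0 h1) (le_trans h2 yT).
    by apply: DeriveDef; [exact: dr (inT _ sT)|rewrite derive1E].
  have sT : 0 <= s <= T by rewrite (le_trans x0 h1) (le_trans h2 yT).
  have [_ h] := rbnd s sT; apply: le_trans h _.
  have : c2 * r s <= c2 * (3 * r t) by rewrite ler_wpM2l ?r3 // ltW.
  lra.
have Gt : cabs (Gam r t) = r t by rewrite cabsM cabs_expi mulr1 cabs_cR ger0_norm // ltW.
have Gt0 : Gam r t != 0 by rewrite -cabs_gt0 Gt.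
pose eta := (z - Gam r t) / Gam r t.
have etad : cabs eta * r t <= d by rewrite cabsM cabsV Gt divfK ?gt_eqF.
have eta2 : cabs eta <= 2^-1.
  rewrite -(ler_pM2r rt0); apply: le_trans etad _; lra.
have [s [v [s0 vs E]]] := polar_near_one eta2.
have vr : `|v| * r t <= 2 * d.
  have : `|v| * r t <= 2 * cabs eta * r t by rewrite ler_wpM2r // ltW.
  lra.
have zE : z = cR (r t * s) * expi (t + v).
  have -> : z = Gam r t * (1 + eta).
    by rewrite mulrDr mulr1 /eta mulrC divfK // addrC subrK.
  by rewrite E /Gam expiD cRM; ring.
have vT : `|v| < T.
  rewrite -(ltr_pM2r rt0); apply: le_lt_trans vr _; rewrite [ltRHS]mulrC -ltr_pdivrMr //; lra.
have rs0 : 0 <= r t * s by rewrite mulr_ge0 // ltW.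
have /andP[t0 tT'] := tT.
move: vT; rewrite ltr_norml => /andP[vT1 vT2].
have final x w : 0 <= x <= T -> w ^+ n = z ^+ n ->
    (exists rho th : R, 0 <= rho /\ 0 <= th < cperiod n /\ w = cR rho * expi th) ->
    cabs (Gam r x - w) < del -> False.
  move=> xT wn br lt.
  have := sep l x (inT x xT) (z ^+ n) w (or_introl ev) (conj wn br).
  by rewrite -/r leNgt lt.
have zGt : cabs (Gam r t - z) <= d by rewrite cabs_distC.
(* Three cases for the argument t + v of z: below the branch (rotate forward, compare at T), within
   it (compare at t), and beyond it (rotate back, compare at 0). *)
have [tv0|tv0] := ltP (t + v) 0.
  have tv : t <= `|v| by have := ler_norm (- v); rewrite normrN; lra.
  have trd : t * r t <= 2 * d by apply: le_trans vr; rewrite ler_wpM2r // ltW.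
  apply: (final T (z * expi T)); first by rewrite lexx T00.
  - by rewrite exprMn expi_cperiod // mulr1.
  - exists (r t * s), (t + v + T); split => //; split; last by rewrite zE -mulrA -expiD.
    by rewrite -/T; apply/andP; split; lra.
  have -> : Gam r T - z * expi T = (Gam r 0 - z) * expi T.
    by rewrite /Gam -r0T expi0 mulr1 mulrBl.
  rewrite cabsM cabs_expi mulr1.
  have lip0 : `|r 0 - r t| <= 3 * c2 * r t * `|0 - t|.
    by rewrite distrC sub0r normrN (ger0_norm t0) -[X in _ * X](subr0 t); exact: lip.
  have := Gam_increment (ltW rt0) lip0; rewrite sub0r normrN (ger0_norm t0) => G0.
  have := cabsD (Gam r 0 - Gam r t) (Gam r t - z); rewrite addrA subrK => h.
  have h2 : (3 * c2 * r t + 2 * r t) * t <= (3 * c2 + 2) * (2 * d).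
    have -> : (3 * c2 * r t + 2 * r t) * t = (3 * c2 + 2) * (t * r t) by ring.
    by rewrite ler_wpM2l //; lra.
  lra.
have [tvT|tvT] := ltP (t + v) T.
  apply: (final t z) => //; last by lra.
  by exists (r t * s), (t + v); rewrite tv0 tvT.
have Ttv : T - t <= `|v| by have := ler_norm v; lra.
have trd : (T - t) * r t <= 2 * d by apply: le_trans vr; rewrite ler_wpM2r // ltW.
apply: (final 0 (z * expi (- T))); first by rewrite lexx T00.
- have eT : expi (- T) ^+ n = 1.
    have := expi_cperiod n0; rewrite -/T => e1.
    by rewrite -[LHS]mulr1 -[X in _ * X = _]e1 -exprMn expiN_mul expr1n.
  by rewrite exprMn eT mulr1.
- exists (r t * s), (t + v - T); split => //; split; last by rewrite zE -mulrA -expiD.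
  by rewrite -/T; apply/andP; split; lra.
have -> : Gam r 0 - z * expi (- T) = (Gam r T - z) * expi (- T).
  rewrite /Gam r0T expi0 mulr1 mulrBl -mulrA -expiD subrr expi0 mulr1 //.
rewrite cabsM cabs_expi mulr1.
have Tt : `|T - t| = T - t by rewrite ger0_norm // subr_ge0.
have lipT : `|r T - r t| <= 3 * c2 * r t * `|T - t| by rewrite Tt; exact: lip.
have := Gam_increment (ltW rt0) lipT; rewrite Tt => G0.
have := cabsD (Gam r T - Gam r t) (Gam r t - z); rewrite addrA subrK => h.
have h2 : (3 * c2 * r t + 2 * r t) * (T - t) <= (3 * c2 + 2) * (2 * d).
  have -> : (3 * c2 * r t + 2 * r t) * (T - t) = (3 * c2 + 2) * ((T - t) * r t) by ring.
  by rewrite ler_wpM2l //; lra.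
lra.
Qed.

Lemma sin_ge_sin x y : 0 <= y -> y <= x -> x <= pi - y -> sin y <= sin x.
Proof.
move=> y0 yx xy; have p0 := @pi_ge0 R.
have sinE u : sin u = cos (pi / 2 - u) :> R.
  by rewrite cosB cos_pihalf sin_pihalf mul0r mul1r add0r.
have le_cos u v : 0 <= u -> u <= v -> v <= pi -> cos v <= cos u :> R.
  move=> u0 uv vp; rewrite leNgt; apply/negP.
  have := @ltr_cos R v u; rewrite !in_itv /= u0 vp (le_trans u0 uv) (le_trans uv vp) => /(_ isT isT) ->.
  by rewrite ltNge uv.
rewrite !sinE; have [h|h] := leP x (pi / 2); first by apply: le_cos; lra.
rewrite -[X in _ <= X]cosN; apply: le_cos; lra.
Qed.

(* Multiplication by e, an n-th root of i^n, turns roots of lambda into characteristic exponents and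
   moves the exponent closest to the imaginary axis to index 0. As n is odd, no other exponent comes
   close to the axis. *)
Lemma sector_choice n t : (0 < n)%N -> odd n -> 0 <= t <= cperiod n ->
  exists (e : R[i]) (sg : bool), [/\ cabs e = 1, e ^+ n = ci ^+ n &
    forall r : R, 0 < r -> @sector R n (sin (pi / (2 * n%:R))) sg (e * (cR r * expi t))].
Proof.
move=> n0 n_odd tT.
have nR : 0 < n%:R :> R by rewrite ltr0n.
have nn : n%:R != 0 :> R by rewrite gt_eqF.
pose w : R := pi / (2 * n%:R).
have w0 : 0 < w by rewrite divr_gt0 ?pi_gt0 // mulr_gt0.
have piE : pi = 2 * n%:R * w :> R by rewrite /w; field.
have TE : cperiod n = 4 * w :> R by rewrite /cperiod /w; field.
(* In units of w the period is 4 and pi is 2n = 4h + 2 with n = 2h + 1. Hence tau + 4mw stays at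
   distance at least w from the multiples of pi for 0 < m < n; this is where n odd enters. *)
have key tau (m : nat) : `|tau| <= w -> (m < n)%N -> m != 0%N ->
    if (m <= n./2)%N then sin w <= sin (tau + m%:R * cperiod n) else sin (tau + m%:R * cperiod n) <= - sin w.
  move=> tw mn m0; rewrite TE; move: tw; rewrite ler_norml => /andP[tw1 tw2].
  have nE : n = (n./2 + n./2).+1 by rewrite addnn -[LHS](odd_double_half n) n_odd.
  set h := n./2 in nE *.
  have nEr : n%:R = 2 * h%:R + 1 :> R by rewrite [in LHS]nE -natr1 natrD; ring.
  have m1 : 1 <= m%:R :> R by rewrite ler1n lt0n.
  case: leqP => mh.
    have mh' : m%:R <= h%:R :> R by rewrite ler_nat.
    have l1 : w <= m%:R * w by rewrite ler_peMl // ltW.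
    have l2 : m%:R * w <= h%:R * w by rewrite ler_pM2r.
    apply: sin_ge_sin; rewrite ?(ltW w0) //; first by lra.
    rewrite piE nEr; lra.
  have mh' : h%:R + 1 <= m%:R :> R by rewrite natr1 ler_nat.
  have mn' : m%:R <= 2 * h%:R :> R by rewrite -natrM ler_nat; lia.
  have l1 : (h%:R + 1) * w <= m%:R * w by rewrite ler_pM2r.
  have l2 : m%:R * w <= 2 * h%:R * w by rewrite ler_pM2r.
  have -> : sin (tau + m%:R * (4 * w)) = - sin (tau + m%:R * (4 * w) - pi).
    by rewrite sinB cospi sinpi mulr0 subr0 mulrN1 opprK.
  rewrite lerN2; apply: sin_ge_sin; rewrite ?(ltW w0) // piE nEr; lra.
have main (e : R[i]) (sg : bool) tau : `|tau| <= w ->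
    e * expi t = (if sg then ci else - ci) * expi tau ->
    forall r : R, 0 < r -> @sector R n (sin w) sg (e * (cR r * expi t)).
  move=> tw eE r r0 m mn0.
  have uE : e * (cR r * expi t) = (if sg then ci else - ci) * (cR r * expi tau).
    by rewrite mulrCA eE mulrCA.
  have cu : cabs (e * (cR r * expi t)) = r.
    rewrite uE cabsM (_ : cabs (if sg then ci else - ci) = 1); last by case: (sg); rewrite ?cabsN cabs_ci.
    by rewrite mul1r cabsM cabs_expi mulr1 cabs_cR ger0_norm // ltW.
  have zE : zeta n ^+ m = expi (m%:R * cperiod n) :> R[i] by rewrite /zeta -expiMn.
  rewrite cu; have := key tau m tw (ltn_ord m) mn0.
  have -> : kap (e * (cR r * expi t)) m = (if sg then ci else - ci) * (cR r * expi (tau + m%:R * cperiod n)).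
    by rewrite /kap uE zE expiD; ring.
  set x := tau + m%:R * cperiod n.
  have -> : Rec ((if sg then ci else - ci) * (cR r * expi x)) = if sg then - (sin x * r) else sin x * r.
    by case: (sg); rewrite ?mulNr ?RecN RecM ImcM RecM /=; ring.
  rewrite /decaying; case: sg {eE uE cu} => /=.
    rewrite lt0n mn0 /=; case: ifP => _ h; first by rewrite lerN2 ler_pM2r.
    by rewrite -mulNr ler_pM2r // lerNr.
  rewrite ltnNge; case: ifP => _ h /=; first by rewrite ler_pM2r.
  by rewrite -mulNr ler_pM2r.
have /andP[t0 tT'] := tT; rewrite TE in tT'.
have odd_ci : (- ci : R[i]) ^+ n = - ci ^+ n by rewrite exprNn -signr_odd n_odd expr1 mulN1r.
(* The range [0, 4w] is cut at w and 3w, and the nearest of 0, 2w, 4w is rotated onto the imaginary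
   axis. For 2w the rotation contributes e^(-i pi) = -1 to the n-th power, compensated by using -i
   in place of i. *)
have [t1|t1] := leP t w.
  exists ci, true; split => //; first exact: cabs_ci.
  by apply: (main _ true t) => //; rewrite ger0_norm.
have [t3|t3] := leP t (3 * w).
  exists (- ci * expi (- (2 * w))), false; split.
  - by rewrite cabsM cabsN cabs_ci cabs_expi mulr1.
  - rewrite exprMn odd_ci -expiMn (_ : n%:R * - (2 * w) = - pi); last by rewrite piE; ring.
    have -> : expi (- pi) = -1 :> R[i] by apply: ceqP; rewrite /= ?cosN ?sinN ?cospi ?sinpi ?oppr0.
    by rewrite mulrNN mulr1.
  apply: (main _ false (t - 2 * w)); first by rewrite ler_norml; apply/andP; split; lra.
  by rewrite -mulrA -expiD addrC.
exists (ci * expi (- (4 * w))), true; split.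
- by rewrite cabsM cabs_ci cabs_expi mulr1.
- rewrite exprMn -expiMn (_ : n%:R * - (4 * w) = - (2 * pi)); last by rewrite piE; ring.
  have := expiN_mul (2 * pi : R); rewrite expi_2pi mulr1 => ->.
  by rewrite mulr1.
apply: (main _ true (t - 4 * w)); first by rewrite ler_norml; apply/andP; split; lra.
by rewrite -mulrA -expiD addrC.
Qed.

Lemma cabs_dgam_le n (r : R -> R) t (c : R) : (0 < n)%N -> 0 < r t -> derivable r t 1 ->
  0 <= c -> `|derive1 r t| <= c * r t -> cabs (dgam n r t) <= 2 * (n%:R * (c + 1)) * r t ^+ n.
Proof.
move=> n0 rt0 dr c0 r'.
have Dr : is_derive t 1 r (derive1 r t) by apply: DeriveDef => //; rewrite derive1E.
have DX : is_derive t 1 (fun s => r s ^+ n) (n%:R * r t ^+ n.-1 * derive1 r t).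
  by apply: is_derive_congr (is_deriveX n Dr) => // s; rewrite exprfctE.
pose q s : R := n%:R * (s - 0).
have Dq : is_derive t 1 q n%:R by exact: is_derive_affine.
have Dc : is_derive t 1 (fun s => cos (q s)) (- (n%:R * sin (q t))).
  apply: is_derive_congr (is_derive1_comp (is_derive_cos (q t)) Dq) => //.
  by rewrite /GRing.scale /= mulrC mulrN.
have Ds : is_derive t 1 (fun s => sin (q s)) (n%:R * cos (q t)).
  apply: is_derive_congr (is_derive1_comp (is_derive_sin (q t)) Dq) => //.
  by rewrite /GRing.scale /= mulrC.
have rn0 : 0 <= r t ^+ n by rewrite exprn_ge0 // ltW.
have nR : 0 <= n%:R :> R by [].
have rE : r t ^+ n.-1 * r t = r t ^+ n by rewrite -exprSr prednK.
have bound (x y : R) : `|x| <= 1 -> `|y| <= 1 ->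
    `|r t ^+ n * (n%:R * x) + y * (n%:R * r t ^+ n.-1 * derive1 r t)| <= n%:R * (c + 1) * r t ^+ n.
  move=> x1 y1; apply: le_trans (ler_normD _ _) _; rewrite !normrM.
  rewrite (ger0_norm nR) (ger0_norm rn0) [`|r t ^+ n.-1|]ger0_norm ?exprn_ge0 ?(ltW rt0) //.
  have h1 : r t ^+ n * (n%:R * `|x|) <= r t ^+ n * n%:R.
    by rewrite ler_wpM2l // ler_piMr.
  have h2 : `|y| * (n%:R * r t ^+ n.-1 * `|derive1 r t|) <= 1 * (n%:R * r t ^+ n.-1 * (c * r t)).
    apply: ler_pM => //; first by rewrite !mulr_ge0 // exprn_ge0 // ltW.
    by apply: ler_wpM2l => //; rewrite mulr_ge0 // exprn_ge0 // ltW.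
  apply: le_trans (lerD h1 h2) _; rewrite -rE; lra.
have gR : (fun s => Rec (gam n r s)) = (fun s => r s ^+ n * cos (q s)).
  by apply/funext => s; rewrite /gam /q RecM /= mul0r subr0 subr0.
have gI : (fun s => Imc (gam n r s)) = (fun s => r s ^+ n * sin (q s)).
  by apply/funext => s; rewrite /gam /q ImcM /= mul0r addr0 subr0.
have E1 : derive1 (fun s => Rec (gam n r s)) t =
    r t ^+ n * (n%:R * - sin (q t)) + cos (q t) * (n%:R * r t ^+ n.-1 * derive1 r t).
  rewrite gR derive1E; have [_ ->] := is_deriveM DX Dc; rewrite /GRing.scale /=; ring.
have E2 : derive1 (fun s => Imc (gam n r s)) t =
    r t ^+ n * (n%:R * cos (q t)) + sin (q t) * (n%:R * r t ^+ n.-1 * derive1 r t).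
  rewrite gI derive1E; have [_ ->] := is_deriveM DX Ds; rewrite /GRing.scale /=; ring.
have cos1 : `|cos (q t)| <= 1 by rewrite ler_norml cos_geN1 cos_le1.
have sin1 : `|sin (q t)| <= 1 by rewrite ler_norml sin_geN1 sin_le1.
apply: le_trans (cabs_le_RecImc _) _; rewrite /dgam /= E1 E2.
have -> : 2 * (n%:R * (c + 1)) * r t ^+ n = n%:R * (c + 1) * r t ^+ n + n%:R * (c + 1) * r t ^+ n by ring.
by apply: lerD; apply: bound; rewrite ?normrN.
Qed.

Lemma gamE n (r : R -> R) t : gam n r t = Gam r t ^+ n.
Proof. by rewrite /gam /Gam exprMn cRX expiMn. Qed.

End Contours.

(** * Majorants for the distribution function of the measure *)

Section SignedMass.
Context {R : realType}.
Implicit Types (a b e s : R) (m : {finite_measure set R -> \bar R}).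

(** Within distance d of a the linear term suffices; farther away M <= (M/d^2)(s - a)^2. This trades
    a local smallness condition for a bound on the whole segment. *)
Lemma quadratic_majorant (f : R -> R) a b e M : 0 <= e -> f a = 0 ->
  (exists2 d : R, 0 < d & forall h : R, 0 < h < d -> `|f (a + h)| <= e * h) ->
  (forall s, a <= s <= b -> `|f s| <= M) ->
  exists2 K : R, 0 <= K & forall s, a <= s <= b -> `|f s| <= e * (s - a) + K * (s - a) ^+ 2.
Proof.
move=> e0 fa [d d0 fd] fM; have d2 : 0 < d ^+ 2 by exact: exprn_gt0.
exists (`|M| / d ^+ 2); first by rewrite divr_ge0 // ltW.
move=> s sab; have /andP[as_ sb] := sab.
have K0 : 0 <= `|M| / d ^+ 2 by rewrite divr_ge0 // ltW.
have sa0 : 0 <= s - a by rewrite subr_ge0.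
have t1 : 0 <= e * (s - a) by exact: mulr_ge0.
have t2 : 0 <= `|M| / d ^+ 2 * (s - a) ^+ 2 by apply: mulr_ge0 => //; exact: sqr_ge0.
have [->|sna] := eqVneq s a; first by rewrite fa normr0 subrr mulr0 add0r expr0n mulr0.
have [sd|sd] := ltP (s - a) d.
  have h0 : 0 < s - a by rewrite lt_def sa0 subr_eq0 sna.
  have := fd (s - a); rewrite h0 sd addrC subrK => /(_ isT); lra.
apply: le_trans (fM s sab) _; apply: le_trans (ler_norm M) _.
have h1 : `|M| / d ^+ 2 * d ^+ 2 <= `|M| / d ^+ 2 * (s - a) ^+ 2.
  by apply: ler_wpM2l => //; apply: lerXn2r; rewrite ?nnegrE // ltW.
by rewrite divfK ?gt_eqF // in h1; lra.
Qed.

Lemma cdist_le m a b s : s <= b -> 0 <= cdist m a s <= fine (m `[a, b]).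
Proof.
move=> sb; rewrite /cdist fine_ge0 //=; apply: fine_le; rewrite ?fin_num_measure //.
by apply: le_measure; rewrite ?inE //; exact: subset_itvl.
Qed.

Lemma signed_mass_majorant (m1 m2 : {finite_measure set R -> \bar R}) a b e : a < b -> 0 < e ->
  cdist m1 a a = cdist m2 a a -> cdist m1 a b = cdist m2 a b ->
  (exists2 d : R, 0 < d & forall h : R, 0 < h < d -> `|cdist m1 a (a + h) - cdist m2 a (a + h)| <= e * h) ->
  (exists2 d : R, 0 < d & forall h : R, 0 < h < d -> `|cdist m1 a (b - h) - cdist m2 a (b - h)| <= e * h) ->
  exists2 K : R, 0 <= K & forall s, a <= s <= b ->
    `|cdist m1 a s - cdist m2 a s| <= e * (s - a) + K * (s - a) ^+ 2 /\
    `|cdist m1 a s - cdist m2 a s| <= e * (b - s) + K * (b - s) ^+ 2.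
Proof.
move=> ab e0 ma mb Qa Qb.
pose M := fine (m1 `[a, b]) + fine (m2 `[a, b]).
have QM s : s <= b -> `|cdist m1 a s - cdist m2 a s| <= M.
  move=> sb; have /andP[h1 h2] := cdist_le m1 a sb; have /andP[h3 h4] := cdist_le m2 a sb.
  by rewrite /M ler_norml; apply/andP; split; lra.
have [K1 K10 h1] : exists2 K : R, 0 <= K & forall s, a <= s <= b ->
    `|cdist m1 a s - cdist m2 a s| <= e * (s - a) + K * (s - a) ^+ 2.
  apply: (@quadratic_majorant (fun s => cdist m1 a s - cdist m2 a s) a b e M); rewrite ?(ltW e0) ?ma ?subrr //.
  by move=> s /andP[_]; exact: QM.
(* The endpoint b is reduced to a by the reflection s -> a + b - s. *)
have [K2 K20 h2] : exists2 K : R, 0 <= K & forall s, a <= s <= b ->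
    `|cdist m1 a (a + b - s) - cdist m2 a (a + b - s)| <= e * (s - a) + K * (s - a) ^+ 2.
  apply: (@quadratic_majorant (fun s => cdist m1 a (a + b - s) - cdist m2 a (a + b - s)) a b e M);
    rewrite ?(ltW e0) //.
  - by rewrite addrAC subrr add0r mb subrr.
  - have [d d0 hd] := Qb; exists d => // h hh.
    by rewrite (_ : a + b - (a + h) = b - h); [exact: hd|ring].
  by move=> s /andP[as_ _]; apply: QM; lra.
exists (K1 + K2); first exact: addr_ge0.
move=> s sab; have /andP[as_ sb] := sab.
have s1 : 0 <= (s - a) ^+ 2 by exact: sqr_ge0.
have s2 : 0 <= (b - s) ^+ 2 by exact: sqr_ge0.
split; first by have := h1 s sab; have := mulr_ge0 K20 s1; lra.
have s'ab : a <= a + b - s <= b by apply/andP; split; lra.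
have := h2 _ s'ab; have -> : a + b - (a + b - s) = s by ring.
have -> : a + b - s - a = b - s by ring.
by have := mulr_ge0 K10 s2; lra.
Qed.

(** Real and imaginary parts of the integrand against the real and the imaginary part of the measure
    give four real estimates, whence the factor 4. *)
Lemma cmint_edge_estimate (m1 m2 m3 m4 : {finite_measure set R -> \bar R}) (H H' : R -> R[i])
    a b (P e K k : R) :
  a < b -> 0 <= P -> 0 <= e -> 0 <= K -> 0 < k ->
  (forall x, cdrv H x (H' x)) -> ccont `[a, b] H' ->
  (forall s, a <= s <= b -> cabs (H' s) <= P * edge_decay a b k s) ->
  cdist m1 a b = cdist m2 a b -> cdist m3 a b = cdist m4 a b ->
  (forall s, a <= s <= b ->
    `|cdist m1 a s - cdist m2 a s| <= e * (s - a) + K * (s - a) ^+ 2 /\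
    `|cdist m1 a s - cdist m2 a s| <= e * (b - s) + K * (b - s) ^+ 2) ->
  (forall s, a <= s <= b ->
    `|cdist m3 a s - cdist m4 a s| <= e * (s - a) + K * (s - a) ^+ 2 /\
    `|cdist m3 a s - cdist m4 a s| <= e * (b - s) + K * (b - s) ^+ 2) ->
  cabs (cmint m1 m2 m3 m4 `[a, b] H) <= 4 * (P * (e * (2 / k) + K * (16 / k ^+ 2)) * (4 / k)).
Proof.
move=> ab P0 e0 K0 k0 HH' [c1 c2] H'P m12 m34 Q12 Q34.
set X := P * _ * _.
have R1 s : a <= s <= b -> `|Rec (H' s)| <= P * edge_decay a b k s.
  by move=> sab; apply: le_trans (le_Rec_cabs _) (H'P s sab).
have I1 s : a <= s <= b -> `|Imc (H' s)| <= P * edge_decay a b k s.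
  by move=> sab; apply: le_trans (le_Imc_cabs _) (H'P s sab).
have dR x : a <= x <= b -> is_derive x 1 (fun t => Rec (H t)) (Rec (H' x)) by move=> _; case: (HH' x).
have dI x : a <= x <= b -> is_derive x 1 (fun t => Imc (H t)) (Imc (H' x)) by move=> _; case: (HH' x).
have x1 := rmint_edge_estimate ab P0 e0 K0 k0 dR c1 R1 m12 (fun s h => proj1 (Q12 s h)) (fun s h => proj2 (Q12 s h)).
have x2 := rmint_edge_estimate ab P0 e0 K0 k0 dI c2 I1 m12 (fun s h => proj1 (Q12 s h)) (fun s h => proj2 (Q12 s h)).
have x3 := rmint_edge_estimate ab P0 e0 K0 k0 dR c1 R1 m34 (fun s h => proj1 (Q34 s h)) (fun s h => proj2 (Q34 s h)).
have x4 := rmint_edge_estimate ab P0 e0 K0 k0 dI c2 I1 m34 (fun s h => proj1 (Q34 s h)) (fun s h => proj2 (Q34 s h)).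
rewrite -/X in x1 x2 x3 x4.
rewrite /cmint; apply: le_trans (cabsD _ _) _; rewrite [cabs (ci * _)]cabsM cabs_ci mul1r.
have -> : 4 * X = (X + X) + (X + X) by ring.
by apply: lerD; apply: le_trans (cabs_le_RecImc _) _; apply: lerD.
Qed.

End SignedMass.

(** * Diagonal bounds along the contours and passage to the limit *)

Lemma green_diagonal_on_contours (R : realType) (n : nat) (a b : R) (Pa Pb : nat -> {poly R[i]})
    (p : nat -> R -> R[i]) (G : R -> R -> R[i] -> R[i]) (rr : nat -> R -> R) :
  (3 <= n)%N -> odd n -> a < b ->
  (forall j, (j < n)%N -> (size (Pa j) <= n)%N /\ (size (Pb j) <= n)%N) ->
  birkhoff_regular_odd n Pa Pb -> green0 n a b Pa Pb G -> acceptable n a b p Pa Pb rr ->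
  exists C c r0 : R, [/\ 0 < C, 0 < c, 1 <= r0 & forall l t, 0 <= t <= cperiod n -> r0 <= rr l t ->
    exists H H' : R -> R[i],
      [/\ forall x, a <= x <= b -> G x x (gam n (rr l) t) = H x, forall x, cdrv H x (H' x),
          ccont `[a, b] H' &
          forall x, a <= x <= b ->
            cabs (H' x) * rr l t ^+ n <= C * rr l t ^+ 2 * edge_decay a b (c * rr l t) x]].
Proof.
move=> n3 n_odd ab sizeP reg gG acc.
have n0 : (0 < n)%N by exact: leq_trans n3.
have n1 : (1 < n)%N by exact: leq_trans n3.
have [d [r0 [d0 sep]]] := contour_separation n0 acc.
(* Half of the aperture provided by the choice of sector, since the determinant bound requires
   aperture 2c at u in order to keep c on a disc around it. *)
pose c : R := sin (pi / (2 * n%:R)) / 2.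
have s0 : 0 < sin (pi / (2 * n%:R)) :> R.
  have p0 := @pi_gt0 R; have q0 : 0 < 2 * n%:R :> R by rewrite mulr_gt0 // ltr0n.
  apply: sin_gt0_pi; rewrite ?in_itv /= divr_gt0 //= ltr_pdivrMr // ltr_pMr //.
  by rewrite -natrM ltr1n; lia.
have c0 : 0 < c by rewrite divr_gt0.
have c2E : sin (pi / (2 * n%:R)) = 2 * c :> R by rewrite /c; field.
have [K1 [r1 [K10 r11 inv1]]] := charmx_inverse_bound n0 n_odd ab sizeP reg true c0 d0.
have [K2 [r2 [K20 r21 inv2]]] := charmx_inverse_bound n0 n_odd ab sizeP reg false c0 d0.
have K0 : 0 < K1 + K2 by exact: addr_gt0.
have [C C0 green] := green_diagonal_bound n1 ab sizeP K0 c0.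
clearbody c; have r0n := ler_norm r0; have r0p := normr_ge0 r0.
(* The summand d keeps 0 out of the disc of radius d around u; the absolute value covers a threshold
   of unknown sign. *)
exists C, c, (`|r0| + r1 + r2 + d); split => //; first by lra.
move=> l t tT rt.
have [r0' rt1 rt2 rtd] : [/\ r0 <= rr l t, r1 <= rr l t, r2 <= rr l t & d < rr l t] by split; lra.
have rt11 : 1 <= rr l t by exact: le_trans r11 rt1.
have rtp : 0 < rr l t by exact: lt_le_trans rt11.
have {}sep := sep l t tT r0'.
have [e1 [sg [e11 e1n sec]]] := sector_choice n0 n_odd tT.
have e10 : e1 != 0 by rewrite -cabs_gt0 e11.
have {}sec := sec (rr l t) rtp; rewrite c2E in sec.
pose u := e1 * Gam (rr l) t; rewrite -/(Gam (rr l) t) -/u in sec.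
have uabs : cabs u = rr l t.
  by rewrite /u !cabsM e11 mul1r cabs_expi mulr1 cabs_cR ger0_norm // ltW.
(* A zero v of the determinant makes (v/e1)^n an eigenvalue, and v/e1 is within d of the contour
   point, which separation excludes. *)
have nz v : cabs (v - u) <= d -> \det (charmx_raw a b Pa Pb (@decaying0 n sg) v) != 0.
  move=> vu; apply/eqP => det0.
  have v0 : v != 0.
    rewrite -cabs_gt0; have := cabs_ge_sub u (v - u); rewrite (addrC u) subrK uabs.
    by move: vu rtd; clear; lra.
  have vE : v ^+ n = ci ^+ n * (v / e1) ^+ n.
    by rewrite exprMn exprVn -e1n mulrCA divff ?mulr1 // expf_neq0.
  have ev := eigenvalue_of_det0 n0 ab sizeP v0 vE det0.
  apply: (sep (v / e1) _ ev).
  have -> : v / e1 - Gam (rr l) t = (v - u) / e1 by rewrite mulrBl [u / e1]mulrAC divff // mul1r.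
  by rewrite cabsM cabsV e11 invr1 mulr1.
have [neg [sgn chU chK]] : exists neg : 'I_n -> bool,
    [/\ forall m, if neg m then Rec (kap u m) <= 0 else 0 <= Rec (kap u m),
        charmx a b Pa Pb neg u \in unitmx &
        forall i j, cabs (invmx (charmx a b Pa Pb neg u) i j) <= K1 + K2].
  case: (sg) sec nz => sec nz.
    have := inv1 u sec; rewrite uabs => /(_ rt1 nz)[neg [h1 h2 h3]].
    by exists neg; split => // i j; apply: le_trans (h3 i j) _; rewrite lerDl ltW.
  have := inv2 u sec; rewrite uabs => /(_ rt2 nz)[neg [h1 h2 h3]].
  by exists neg; split => // i j; apply: le_trans (h3 i j) _; rewrite lerDr ltW.
have big (m : 'I_n) : val m != 0%N -> c * cabs u <= `|Rec (kap u m)|.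
  have cu : 0 <= c * cabs u by apply: mulr_ge0; [exact: ltW|exact: cabs_ge0].
  have cu2 : c * cabs u <= 2 * c * cabs u by move: cu; clear; lra.
  move=> mn0; have := sec m mn0; case: ifP => _ h; apply: (le_trans cu2).
    by rewrite -normrN; apply: le_trans (ler_norm _); rewrite lerNr.
  exact: le_trans h (ler_norm _).
have nev : ~ Defs.eigenvalue n a b zero_pot Pa Pb (gam n (rr l) t).
  by rewrite gamE; apply: sep; rewrite subrr cabs0 ltW.
have ulam : u ^+ n = ci ^+ n * gam n (rr l) t by rewrite gamE exprMn e1n.
have u1 : 1 <= cabs u by rewrite uabs.
have [H [H' [GH HH' cH' H'b]]] := green G u _ neg gG nev u1 ulam chU chK sgn big.
by exists H, H'; rewrite uabs in H'b.
Qed.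

Theorem theorem1p5 (R : realType) (n : nat) (a b : R)
    (Pa Pb : nat -> {poly R[i]}) (p : nat -> R -> R[i])
    (G : R -> R -> R[i] -> R[i])
    (m1 m2 m3 m4 : {finite_measure set R -> \bar R})
    (rr : nat -> R -> R) :
  (3 <= n)%N -> odd n -> a < b ->
  (* boundary conditions: polynomials of degree < n, normalized, Birkhoff regular *)
  (forall j, (j < n)%N -> (size (Pa j) <= n)%N /\ (size (Pb j) <= n)%N) ->
  bc_normalized n Pa Pb -> birkhoff_regular_odd n Pa Pb ->
  (* potentials p_0, ..., p_{n-2} of L are in L_1(a,b) *)
  (forall k, (k < n.-1)%N -> cintegrable a b (p k)) ->
  (* G is the Green function of L_0 - lam *)
  green0 n a b Pa Pb G ->
  (* q = (m1 - m2) + i (m3 - m4): no atoms at a, b and total mass 0 *)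
  cmeas m1 m2 m3 m4 [set a] = 0 -> cmeas m1 m2 m3 m4 [set b] = 0 ->
  cmeas m1 m2 m3 m4 `[a, b] = 0 ->
  (* Q(x) = q([a,x]);  Q'(a) = 0 (right derivative) and Q'(b) = 0 (left derivative) *)
  (forall e : R, 0 < e -> exists d : R, 0 < d /\ forall h : R, 0 < h < d ->
     cabs (cmeas m1 m2 m3 m4 `[a, a + h] - cmeas m1 m2 m3 m4 `[a, a]) <= e * h) ->
  (forall e : R, 0 < e -> exists d : R, 0 < d /\ forall h : R, 0 < h < d ->
     cabs (cmeas m1 m2 m3 m4 `[a, b - h] - cmeas m1 m2 m3 m4 `[a, b]) <= e * h) ->
  acceptable n a b p Pa Pb rr ->
  let I := fun l : nat =>
    cont_int n (rr l) (fun lam => cmint m1 m2 m3 m4 `[a, b] (fun x => G x x lam)) in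
  (fun l => Rec (I l)) @ \oo --> 0 /\ (fun l => Imc (I l)) @ \oo --> 0.
Proof.
move=> n3 n_odd ab sizeP _ reg _ gG qa _ qtot Qa Qb acc I.
have n0 : (0 < n)%N by exact: leq_trans n3.
have nR : 0 < n%:R :> R by rewrite ltr0n.
have [C [c [r0 [C0 c0 r01 green]]]] := green_diagonal_on_contours n3 n_odd ab sizeP reg gG acc.
have T0 := @cperiod_gt0 R n n0; have T00 := ltW T0; set T := cperiod n in T0 T00.
have [sm [rinf [[c1 [c2 [c10 [c20 bnd]]]] _]]] := acc.
pose W : R := 2 * (n%:R * (c2 + 1)).
have W0 : 0 < W by rewrite /W !mulr_gt0 // addr_gt0.
have WE l t : 0 <= t <= T -> 0 < rr l t -> cabs (dgam n (rr l) t) <= W * rr l t ^+ n.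
  move=> tT rt; have tI : t \in (`[0, T] : set R) by rewrite in_seg.
  have [_ [dr _]] := sm l; have [_ h] := bnd l t tI.
  exact: cabs_dgam_le n0 rt (dr t tI) (ltW c20) h.
clearbody W.
have dist12 (A : set R) : Rec (cmeas m1 m2 m3 m4 A) = fine (m1 A) - fine (m2 A) by [].
have dist34 (A : set R) : Imc (cmeas m1 m2 m3 m4 A) = fine (m3 A) - fine (m4 A) by [].
(* Absence of an atom at a gives Q(a) = 0, and zero total mass gives Q(b) = 0, so the derivative
   conditions bound Q itself by o(distance) at both ends. *)
have qaa : cmeas m1 m2 m3 m4 `[a, a] = 0 by rewrite set_itv1.
have ma12 : cdist m1 a a = cdist m2 a a by apply/eqP; rewrite -subr_eq0 -dist12 qaa.
have ma34 : cdist m3 a a = cdist m4 a a by apply/eqP; rewrite -subr_eq0 -dist34 qaa.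
have mb12 : cdist m1 a b = cdist m2 a b by apply/eqP; rewrite -subr_eq0 -dist12 qtot.
have mb34 : cdist m3 a b = cdist m4 a b by apply/eqP; rewrite -subr_eq0 -dist34 qtot.
have key (e : R) : 0 < e -> exists A : R, forall l, A <= rr l 0 -> forall t, 0 <= t <= T ->
    cabs (cmint m1 m2 m3 m4 `[a, b] (fun x => G x x (gam n (rr l) t)) * dgam n (rr l) t) <= e.
  (* With k = cr the linear part of the majorant contributes 32 C W eps / c^2, independent of r;
     this choice makes it e/2. *)
  move=> e0; pose eps := e * c ^+ 2 / (64 * (C * W)).
  have CW : 0 < C * W by exact: mulr_gt0.
  have eps0 : 0 < eps.
    by apply: divr_gt0; [apply: mulr_gt0 => //; exact: exprn_gt0|exact: mulr_gt0].
  have [da [da0 hda]] := Qa eps eps0; have [db [db0 hdb]] := Qb eps eps0.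
  have [Ka Ka0 Q12] : exists2 K : R, 0 <= K & forall s, a <= s <= b ->
      `|cdist m1 a s - cdist m2 a s| <= eps * (s - a) + K * (s - a) ^+ 2 /\
      `|cdist m1 a s - cdist m2 a s| <= eps * (b - s) + K * (b - s) ^+ 2.
    apply: signed_mass_majorant => //; [exists da => // h /hda|exists db => // h /hdb].
      by rewrite qaa subr0 => /(le_trans (le_Rec_cabs _)).
    by rewrite qtot subr0 => /(le_trans (le_Rec_cabs _)).
  have [Kb Kb0 Q34] : exists2 K : R, 0 <= K & forall s, a <= s <= b ->
      `|cdist m3 a s - cdist m4 a s| <= eps * (s - a) + K * (s - a) ^+ 2 /\
      `|cdist m3 a s - cdist m4 a s| <= eps * (b - s) + K * (b - s) ^+ 2.
    apply: signed_mass_majorant => //; [exists da => // h /hda|exists db => // h /hdb].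
      by rewrite qaa subr0 => /(le_trans (le_Imc_cabs _)).
    by rewrite qtot subr0 => /(le_trans (le_Imc_cabs _)).
  pose K := Ka + Kb.
  have KK0 : 0 <= K by exact: addr_ge0.
  have Q12' s : a <= s <= b ->
      `|cdist m1 a s - cdist m2 a s| <= eps * (s - a) + K * (s - a) ^+ 2 /\
      `|cdist m1 a s - cdist m2 a s| <= eps * (b - s) + K * (b - s) ^+ 2.
    move=> sab; have [h1 h2] := Q12 s sab.
    rewrite /K !mulrDl; split.
      by apply: le_trans h1 _; rewrite lerD2l lerDl mulr_ge0 // sqr_ge0.
    by apply: le_trans h2 _; rewrite lerD2l lerDl mulr_ge0 // sqr_ge0.
  have Q34' s : a <= s <= b ->
      `|cdist m3 a s - cdist m4 a s| <= eps * (s - a) + K * (s - a) ^+ 2 /\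
      `|cdist m3 a s - cdist m4 a s| <= eps * (b - s) + K * (b - s) ^+ 2.
    move=> sab; have [h1 h2] := Q34 s sab.
    rewrite /K !mulrDl; split.
      by apply: le_trans h1 _; rewrite lerD2l lerDr mulr_ge0 // sqr_ge0.
    by apply: le_trans h2 _; rewrite lerD2l lerDr mulr_ge0 // sqr_ge0.
  clearbody K.
  (* The quadratic part contributes 256 C W K / (c^3 r), which is at most e/2 as soon as r >= B. *)
  pose B := 512 * (C * W) * K / (c ^+ 3 * e).
  have B0 : 0 <= B.
    apply: divr_ge0; last by apply: mulr_ge0; [apply: exprn_ge0; exact: ltW|exact: ltW].
    apply: mulr_ge0; last exact: KK0.
    by apply: mulr_ge0; [exact: ler0n|apply: mulr_ge0; exact: ltW].
  (* Divergence is assumed for the radius at 0 only; the oscillation bound c1 passes it on to all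
     t. *)
  exists (c1 + r0 + B) => l Al t tT.
  have tI : t \in (`[0, T] : set R) by rewrite in_seg.
  have [rc1 _] := bnd l t tI.
  have [rt0 rtB] : r0 <= rr l t /\ B <= rr l t.
    move: rc1 Al B0 r01; rewrite ler_norml => /andP[h1 h2]; clearbody B; clear -h1 h2.
    by move=> h3 h4 h5; split; lra.
  have rtp : 0 < rr l t by apply: lt_le_trans rt0; exact: lt_le_trans r01.
  have [H [H' [GH HH' cH' H'b]]] := green l t tT rt0.
  have -> : cmint m1 m2 m3 m4 `[a, b] (fun x => G x x (gam n (rr l) t)) = cmint m1 m2 m3 m4 `[a, b] H.
    have GHs x : x \in (`[a, b] : set R) -> G x x (gam n (rr l) t) = H x by rewrite in_seg; exact: GH.
    have EIr (m : {finite_measure set R -> \bar R}) :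
        Rintegral m `[a, b] (fun x => Rec (G x x (gam n (rr l) t))) = Rintegral m `[a, b] (fun x => Rec (H x)).
      by apply: eq_Rintegral => x /GHs ->.
    have EIi (m : {finite_measure set R -> \bar R}) :
        Rintegral m `[a, b] (fun x => Imc (G x x (gam n (rr l) t))) = Rintegral m `[a, b] (fun x => Imc (H x)).
      by apply: eq_Rintegral => x /GHs ->.
    by rewrite /cmint /rmint !EIr !EIi.
  set r := rr l t in rtp rtB H'b *.
  have rn0 : 0 < r ^+ n by exact: exprn_gt0.
  pose P := C * r ^+ 2 / r ^+ n.
  have P0 : 0 <= P by apply: divr_ge0; [apply: mulr_ge0; [exact: ltW|exact: sqr_ge0]|exact: ltW].
  have k0 : 0 < c * r by exact: mulr_gt0.
  have H'P s : a <= s <= b -> cabs (H' s) <= P * edge_decay a b (c * r) s.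
    by move=> /H'b; rewrite /P -ler_pdivlMr // [leRHS]mulrAC.
  have est := cmint_edge_estimate ab P0 (ltW eps0) KK0 k0 HH' cH' H'P mb12 mb34 Q12' Q34'.
  rewrite cabsM; apply: le_trans (ler_pM (cabs_ge0 _) (cabs_ge0 _) est (WE l t tT rtp)) _.
  rewrite -/r.
  have rn : r != 0 by rewrite gt_eqF.
  have cn : c != 0 by rewrite gt_eqF.
  have Cn : C != 0 by rewrite gt_eqF.
  have Wn : W != 0 by rewrite gt_eqF.
  have en : e != 0 by rewrite gt_eqF.
  have rnn : r ^+ n != 0 by rewrite gt_eqF.
  have -> : 4 * (P * (eps * (2 / (c * r)) + K * (16 / (c * r) ^+ 2)) * (4 / (c * r))) * (W * r ^+ n) =
      e / 2 + 256 * (C * W) * K / c ^+ 3 / r.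
    by rewrite /P /eps; clearbody r; field; rewrite rn cn Cn Wn rnn.
  have eE : e = e / 2 + e / 2 by field.
  rewrite [leRHS]eE lerD2l ler_pdivrMr //.
  have -> : 256 * (C * W) * K / c ^+ 3 = e / 2 * B by rewrite /B; field; rewrite cn en.
  by apply: ler_wpM2l => //; apply: divr_ge0 => //; exact: ltW.
(* The parameter interval has fixed length T, so the pointwise bound e/T for the integrand, which
   already contains the line element, bounds both components of the integral by e. *)
have concl (e : R) : 0 < e -> \forall l \near \oo, `|Rec (I l)| <= e /\ `|Imc (I l)| <= e.
  move=> e0; have eT : 0 < e / T by exact: divr_gt0.
  have [A hA] := key (e / T) eT.
  have [N _ large] := (cvgryPge (fun l => rr l 0)).1 rinf A.
  exists N => // l /large Al.
  have h t : 0 <= t <= T -> cabs (cmint m1 m2 m3 m4 `[a, b] (fun x => G x x (gam n (rr l) t)) * dgam n (rr l) t) <= e / T.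
    exact: hA.
  have E : e = e / T * (T - 0) by rewrite subr0 divfK // gt_eqF.
  rewrite E; split; apply: Rintegral_abs_le => //; rewrite ?(ltW eT) // => t tT.
    exact: le_trans (le_Rec_cabs _) (h t tT).
  exact: le_trans (le_Imc_cabs _) (h t tT).
split; apply/cvgrPdist_le => e e0; have [N _ h] := concl e e0; exists N => // l /h[h1 h2] /=.
  by rewrite sub0r normrN.
by rewrite sub0r normrN.
Qed.
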